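(* Suppose the following hold. (A1) $\mathbb M$ is bounded on $L^2$; there exist positive functions $\phi,\phi^*\in L^2$ and a scalar $\rho>0$ with $\mathbb M\phi=\rho\phi$ and $\mathbb M^*\phi^*=\rho\phi^*$; $\phi$ and $\phi^*$ are the unique (up to scale) positive solutions in $L^2$ of these two problems; $\rho$ is a simple and isolated eigenvalue of $\mathbb M$ and is the largest eigenvalue of $\mathbb M$; and, when $\phi,\phi^*$ are scaled so that $\mathbb E[\phi(X_t)\phi^*(X_t)]=1$, $\lim_{\tau\to\infty}\rho^{-\tau}\mathbb M_\tau\psi(x)=\mathbb E[\psi(X_t)\phi^*(X_t)]\,\phi(x)$ for all $\psi\in L^2$. (A2) $\|\Pi_k\mathbb M-\mathbb M\|=o(1)$. (A3) $\|\widehat{\mathbf G}^o-\mathbf I\|=o_p(1)$ and $\|\widehat{\mathbf M}^o-\mathbf M^o\|=o_p(1)$. (A4) (a) $\|\Pi_k\phi-\phi\|=o(n^{-1/2})$ and $\|\Pi_k\phi^*-\phi^*\|=o(n^{-1/2})$; (b) $\|\widehat{\mathbf G}^o-\mathbf I\|=o_p(n^{-1/4})$ and $\|\widehat{\mathbf M}^o-\mathbf M^o\|=o_p(n^{-1/4})$; (c) $\mathbb E[(\phi^*(X_t)m(X_t,X_{t+1})\phi(X_{t+1}))^2]<\infty$. (A5) $X$ is uniformly ergodic: $\lim_{n\to\infty}\sup_{x\in\mathcal X}\|P_n(x,\cdot)-Q\|_{TV}=0$, where $P_n(x,A)=\Pr(X_{t+n}\in A\mid X_t=x)$ and $\|\cdot\|_{TV}$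 is total variation norm. Normalize $\phi,\phi^*$ so that $\|\phi\|=1$, $\langle\phi,\phi^*\rangle=1$ and set $V_\rho=\mathbb E[\psi_\rho(X_0,X_1)^2]$ with $\psi_\rho(x_0,x_1)=\phi^*(x_0)m(x_0,x_1)\phi(x_1)-\rho\,\phi^*(x_0)\phi(x_0)$. Then the semiparametric efficiency bound for $\rho$ is $V_\rho$, and $\hat\rho$ is semiparametrically efficient.
   Context: $X=\{X_t\}$ is a time-homogeneous, strictly stationary and ergodic first-order Markov process with values in $\mathcal X\subseteq\mathbb R^d$, stationary distribution $Q$, and one-step transition probability $P_1$. $m:\mathcal X^2\to(0,\infty)$ is a known measurable function. $L^2$ is the space of $\psi:\mathcal X\to\mathbb R$ with $\int\psi^2\,dQ<\infty$, with norm $\|\cdot\|$ and inner product $\langle\cdot,\cdot\rangle$; functions are identified $Q$-a.e., and ''positive'' means positive $Q$-a.e. The operator $\mathbb M\psi(x)=\mathbb E[m(X_t,X_{t+1})\psi(X_{t+1})\mid X_t=x]$ acts on $L^2$; $\mathbb M_\tau=\mathbb M^\tau$; $\mathbb M^*$ is the adjoint, $\mathbb M^*\psi(x)=\mathbb E[m(X_t,X_{t+1})\psi(X_t)\mid X_{t+1}=x]$. $\|\cdot\|$ also denotes the operator norm on $L^2$ and the operator norm (largest singular value) of matrices. An eigenvalue is simple if it has a unique eigenfunction up to scale, and isolated if some neighborhood of it contains no other point of the spectrum. Sieve: for each $k$, $b_{k1},\dots,b_{kk}\in L^2$ are linearly independent, $B_k$ is their linear span, $b^k(x)=(b_{k1}(x),\dots,b_{kk}(x))'$,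 and $\Pi_k:L^2\to B_k$ is the orthogonal projection. The dimension $k=k(n)\to\infty$ as $n\to\infty$. $\mathbf G=\mathbb E[b^k(X_t)b^k(X_t)']$ (nonsingular) and $\mathbf M=\mathbb E[b^k(X_t)m(X_t,X_{t+1})b^k(X_{t+1})']$. From data $X_0,\dots,X_n$, $\widehat{\mathbf G}=\frac1n\sum_{t=0}^{n-1}b^k(X_t)b^k(X_t)'$ and $\widehat{\mathbf M}=\frac1n\sum_{t=0}^{n-1}b^k(X_t)m(X_t,X_{t+1})b^k(X_{t+1})'$. $\hat\rho$ is the largest real generalized eigenvalue of $(\widehat{\mathbf M},\widehat{\mathbf G})$ (well defined with probability approaching one). $\mathbf M^o=\mathbf G^{-1/2}\mathbf M\mathbf G^{-1/2}$, $\widehat{\mathbf G}^o=\mathbf G^{-1/2}\widehat{\mathbf G}\mathbf G^{-1/2}$, $\widehat{\mathbf M}^o=\mathbf G^{-1/2}\widehat{\mathbf M}\mathbf G^{-1/2}$; $\mathbf I$ is the $k\times k$ identity. Efficiency bound (transition law of $X$ unknown and unrestricted, $m$ known). Let $Q_2$ be the law of $(X_t,X_{t+1})$. The tangent space is $\mathcal H_0=\{g\in L^2(Q_2):\mathbb E[g(X_t,X_{t+1})\mid X_t]=0\text{ a.s.}\}$ with the $L^2(Q_2)$ norm. For bounded $g\in\mathcal H_0$ consider the one-dimensional submodel of transition probabilities $dP_1^{\tau,g}(x_1|x_0)/dP_1(x_1|x_0)=\exp(\tau g(x_0,x_1)-A(\tau,x_0))$, $|\tau|\le1$, where $A(\tau,x_0)=\log\int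 e^{\tau g(x_0,x_1)}P_1(dx_1|x_0)$; the value of $\rho$ in the submodel is the largest eigenvalue $\rho_{(\tau,g)}$ of $\psi\mapsto\int m(\cdot,x_1)\psi(x_1)P_1^{\tau,g}(dx_1|\cdot)$ on $L^2$. If $\frac{d}{d\tau}\rho_{(\tau,g)}|_{\tau=0}=\int\tilde\psi g\,dQ_2$ for all bounded $g\in\mathcal H_0$ and some $\tilde\psi\in L^2(Q_2)$, the efficient influence function is the projection of $\tilde\psi$ onto $\mathcal H_0$, and the semiparametric efficiency bound is its squared $L^2(Q_2)$ norm. $\hat\rho$ is semiparametrically efficient if it is asymptotically linear with the efficient influence function as influence function (so that its asymptotic variance attains the bound). *)

(* Defs.v *)
From HB Require Import structures.
From mathcomp Require Import all_boot all_order all_algebra.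
From mathcomp Require Import all_classical all_reals all_analysis.

Set Implicit Arguments.
Unset Strict Implicit.
Unset Printing Implicit Defensive.
Import Order.TTheory GRing.Theory Num.Theory.
Import numFieldNormedType.Exports.

Local Open Scope classical_set_scope.
Local Open Scope ring_scope.

(* A subset of R^d with the trace of the Borel sigma-algebra.
   A [measurableType] is pointed, hence the base point [x0]; a set in which a
   process takes its values is nonempty anyway. *)

Definition pointed_subset (R : realType) (d : nat) (XX : set (d.-tuple R))
  (x0 : XX) : Type := XX.
HB.instance Definition _ (R : realType) (d : nat) (XX : set (d.-tuple R))
  (x0 : XX) :=
  Choice.copy (pointed_subset x0) (set_type XX).
HB.instance Definition _ (R : realType) (d : nat) (XX : set (d.-tuple R))
  (x0 : XX) :=
  isPointed.Build (pointed_subset x0) x0.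

Definition state_val (R : realType) (d : nat) (XX : set (d.-tuple R)) (x0 : XX)
  (x : pointed_subset x0) : d.-tuple R := val (x : set_type XX).

Definition state (R : realType) (d : nat) (XX : set (d.-tuple R)) (x0 : XX) :=
  g_sigma_algebra_preimageType (@state_val R d XX x0).
HB.instance Definition _ (R : realType) (d : nat) (XX : set (d.-tuple R))
  (x0 : XX) :=
  Measurable.on (state x0).

(* The real Hilbert space L^2(Q).
   Elements of L^2(Q) are represented by functions in [Lfun Q 2], and two of them
   are identified when they are equal Q-almost everywhere. *)

Section L2.
Context {d : measure_display} {T : measurableType d} {R : realType}.
Variable Q : {measure set T -> \bar R}.
Implicit Types (f g h u v : T -> R) (A : (T -> R) -> T -> R) (a b r : R).

Definition L2 : set (T -> R) := [set f | f \in Lfun Q 2%:E].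

Definition L2norm f : \bar R := Lnorm Q 2%:E (EFin \o f).

Definition inner f g : R := \int[Q]_x (f x * g x).

Definition aeeq f g : Prop := {ae Q, forall x, f x = g x}.

Definition positive f : Prop := {ae Q, forall x, 0 < f x}.

Definition opnorm A : \bar R :=
  ereal_sup [set L2norm (A f) | f in [set f | L2 f /\ (L2norm f <= 1)%E]].

(* [is_adjoint A g h] : h is the image of g under the adjoint of A. *)
Definition is_adjoint A g h : Prop :=
  L2 h /\ forall f, L2 f -> inner (A f) g = inner f h.

(* Spectral notions refer to the complexification of L^2(Q): the function u + iv
   is the pair (u, v) and the complex number a + ib is the pair (a, b), so that
   (a + ib)(u + iv) = (au - bv) + i(bu + av). *)
Definition L2eigenvalue A a b : Prop :=
  exists u v, [/\ L2 u, L2 v, ~ (aeeq u (cst 0) /\ aeeq v (cst 0)),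
    aeeq (A u) (fun x => a * u x - b * v x) &
    aeeq (A v) (fun x => b * u x + a * v x)].

(* (a + ib) - A is injective, and onto with a bounded inverse. *)
Definition resolvent A a b : Prop :=
  ~ L2eigenvalue A a b /\
  exists C : R, forall f g, L2 f -> L2 g -> exists u v, [/\ L2 u, L2 v,
    aeeq (fun x => a * u x - b * v x - A u x) f,
    aeeq (fun x => b * u x + a * v x - A v x) g &
    (L2norm u + L2norm v <= C%:E * (L2norm f + L2norm g))%E].

Definition spectrum A a b : Prop := ~ resolvent A a b.

Definition isolated A r : Prop :=
  exists2 e : R, 0 < e & forall a b, spectrum A a b ->
    Num.sqrt ((a - r) ^+ 2 + b ^+ 2) < e -> a = r /\ b = 0.

Definition simple_eigenvalue A r : Prop :=
  L2eigenvalue A r 0 /\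
  forall f g, L2 f -> L2 g -> ~ aeeq f (cst 0) -> ~ aeeq g (cst 0) ->
    aeeq (A f) (fun x => r * f x) -> aeeq (A g) (fun x => r * g x) ->
    exists c : R, aeeq g (fun x => c * f x).

Definition largest_eigenvalue A r : Prop :=
  L2eigenvalue A r 0 /\
  forall a b, L2eigenvalue A a b -> Num.sqrt (a ^+ 2 + b ^+ 2) <= r.

Section sieve.
Variables (k : nat) (b : 'I_k -> T -> R).

Definition lin_indep : Prop :=
  forall c : 'I_k -> R,
    aeeq (fun x => \sum_(j < k) c j * b j x) (cst 0) -> forall j, c j = 0.

Definition sieve_span : set (T -> R) :=
  [set p | exists c : 'I_k -> R, p = fun x => \sum_(j < k) c j * b j x].

(* Orthogonal projection onto the span; [lin_indep] makes it unique. *)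
Definition sieve_proj f : T -> R :=
  xget (cst 0) [set p | sieve_span p /\
    forall q, sieve_span q -> inner (f \- p) q = 0].

End sieve.
End L2.


Section matrices.
Context {R : realType} {k : nat}.
Implicit Types (A B S : 'M[R]_k).

Definition enorm (v : 'cV[R]_k) : R := Num.sqrt (\sum_i v i 0 ^+ 2).

Definition mxopnorm A : R :=
  sup [set enorm (A *m v) | v in [set v | enorm v <= 1]].

(* The positive semidefinite square root, unique when it exists. *)
Definition mxsqrt A : 'M[R]_k :=
  xget 0 [set S | [/\ S^T = S, forall v : 'cV[R]_k, 0 <= (v^T *m S *m v) 0 0 &
                      S *m S = A]].

Definition mxinvsqrt A : 'M[R]_k := invmx (mxsqrt A).

Definition gen_eigenvalue A B (l : R) : Prop :=
  exists2 v : 'cV[R]_k, v != 0 & A *m v = l *: (B *m v).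

Definition largest_gen_eigenvalue A B (l : R) : Prop :=
  gen_eigenvalue A B l /\ forall l', gen_eigenvalue A B l' -> l' <= l.

End matrices.


(* Z n = o_p(r n).  The outer probability [mu_ext P] agrees with P on events, and
   dispenses with the measurability of Z n. *)
Definition is_op {d} {Om : measurableType d} {R : realType}
    (P : probability Om R) (Z : nat -> Om -> R) (r : nat -> R) : Prop :=
  forall e : R, 0 < e ->
    (fun n => mu_ext P [set w | e * r n < `|Z n w| ]) @ \oo --> 0%E.


Section markov.
Context {dO : measure_display} {Om : measurableType dO}.
Context {d : measure_display} {T : measurableType d} {R : realType}.
Variables (P : probability Om R) (X : nat -> {mfun Om >-> T}).
Variables (Q : probability T R) (P1 : R.-pker T ~> T).

Definition past (t : nat) : set (set Om) :=
  <<s [set E | exists s B, [/\ (s <= t)%N, measurable B & E = X s @^-1` B]] >>.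

Definition markov : Prop :=
  forall t E A, past t E -> measurable A ->
    P (E `&` X t.+1 @^-1` A) = (\int[P]_(w in E) P1 (X t w) A)%E.

Definition strictly_stationary : Prop :=
  forall (n h : nat) (A : nat -> set T), (forall i, measurable (A i)) ->
    P (\bigcap_(i in [set i | (i < n)%N]) X (i + h)%N @^-1` A i) =
    P (\bigcap_(i in [set i | (i < n)%N]) X i @^-1` A i).

Definition path_sigma : set (set (nat -> T)) :=
  <<s [set E | exists (t : nat) (B : set T),
         measurable B /\ E = [set x | B (x t)]] >>.

Definition ergodic : Prop :=
  forall E : set (nat -> T), path_sigma E ->
    [set x | E (fun t => x t.+1)] = E ->
    P [set w | E (fun t => X t w)] = 0%E \/ P [set w | E (fun t => X t w)] = 1%E.

Record stationary_ergodic_markov : Prop := {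
  sem_markov : markov;
  sem_stationary : strictly_stationary;
  sem_ergodic : ergodic;
  sem_law : forall t A, measurable A -> P (X t @^-1` A) = Q A }.

(* P_n(x, A), by the Chapman-Kolmogorov recursion. *)
Fixpoint nstep (n : nat) (x : T) (A : set T) : \bar R :=
  if n is n'.+1 then (\int[P1 x]_y nstep n' y A)%E else \d_x A.

(* Total variation as the supremum of |P_n(x, A) - Q(A)| over events A; the other
   usual normalization differs by a factor 2. *)
Definition uniformly_ergodic : Prop :=
  (fun n => ereal_sup [set e : \bar R | exists (x : T) (A : set T),
      measurable A /\ e = `|nstep n x A - Q A|%E]) @ \oo --> 0%E.

Definition step (w : Om) : T * T := (X 0%N w, X 1%N w).

Lemma measurable_step : measurable_fun setT step.
Proof. by apply: measurable_fun_pair; exact: measurable_funPT. Qed.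

HB.instance Definition _ := isMeasurableFun.Build _ _ _ _ step measurable_step.

Definition Q2 := distribution P step.

HB.instance Definition _ := Probability.on Q2.

End markov.


Section operator.
Context {d : measure_display} {T : measurableType d} {R : realType}.
Variables (Q : probability T R) (P1 : R.-pker T ~> T) (m : T * T -> R).

Definition Mop (f : T -> R) (x : T) : R := \int[P1 x]_y (m (x, y) * f y).

(* The integrability clause says that the conditional expectation defining
   [Mop f] makes sense; [Rintegral] is 0 when the integral is undefined. *)
Definition Mbounded : Prop :=
  [/\ forall f, L2 Q f ->
        {ae Q, forall x, (P1 x).-integrable setT (fun y => (m (x, y) * f y)%:E)},
      forall f, L2 Q f -> L2 Q (Mop f) &
      (opnorm Q Mop < +oo)%E].

(* [pe_limit] is the limit of rho^-tau M^tau psi(x) for Q-almost every x, with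
   a phi and a' phis the rescaled eigenfunctions. *)
Record principal_eigenpair (rho : R) (phi phis : T -> R) : Prop := {
  pe_bounded : Mbounded;
  pe_rho : 0 < rho;
  pe_phi_L2 : L2 Q phi;
  pe_phis_L2 : L2 Q phis;
  pe_phi_pos : positive Q phi;
  pe_phis_pos : positive Q phis;
  pe_phi_eigen : aeeq Q (Mop phi) (fun x => rho * phi x);
  pe_phis_eigen : is_adjoint Q Mop phis (fun x => rho * phis x);
  pe_phi_unique : forall psi, L2 Q psi -> positive Q psi ->
    aeeq Q (Mop psi) (fun x => rho * psi x) ->
    exists c : R, aeeq Q psi (fun x => c * phi x);
  pe_phis_unique : forall psi, L2 Q psi -> positive Q psi ->
    is_adjoint Q Mop psi (fun x => rho * psi x) ->
    exists c : R, aeeq Q psi (fun x => c * phis x);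
  pe_simple : simple_eigenvalue Q Mop rho;
  pe_isolated : isolated Q Mop rho;
  pe_largest : largest_eigenvalue Q Mop rho;
  pe_limit : forall a a' : R, 0 < a -> 0 < a' ->
    inner Q (a \*o phi) (a' \*o phis) = 1 ->
    forall psi, L2 Q psi -> {ae Q, forall x,
      (fun tau : nat => rho ^- tau * iter tau Mop psi x) @ \oo -->
        inner Q psi (a' \*o phis) * (a \*o phi) x} }.

End operator.


Section estimator.
Context {dO : measure_display} {Om : measurableType dO}.
Context {d : measure_display} {T : measurableType d} {R : realType}.
Variables (P : probability Om R) (X : nat -> {mfun Om >-> T}) (m : T * T -> R).
Variables (k : nat) (b : 'I_k -> T -> R).

Definition bvec (x : T) : 'cV[R]_k := \col_j b j x.

Definition mxexp (F : Om -> 'M[R]_k) : 'M[R]_k :=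
  \matrix_(i, j) \int[P]_w F w i j.

Definition Gterm (t : nat) (w : Om) : 'M[R]_k :=
  bvec (X t w) *m (bvec (X t w))^T.

Definition Mterm (t : nat) (w : Om) : 'M[R]_k :=
  m (X t w, X t.+1 w) *: (bvec (X t w) *m (bvec (X t.+1 w))^T).

Definition Gmx : 'M[R]_k := mxexp (Gterm 0).
Definition Mmx : 'M[R]_k := mxexp (Mterm 0).
Definition Ghat (n : nat) (w : Om) : 'M[R]_k :=
  n%:R^-1 *: \sum_(t < n) Gterm t w.
Definition Mhat (n : nat) (w : Om) : 'M[R]_k :=
  n%:R^-1 *: \sum_(t < n) Mterm t w.

Definition orthonormalized (A : 'M[R]_k) : 'M[R]_k :=
  mxinvsqrt Gmx *m A *m mxinvsqrt Gmx.

Definition Gerr (n : nat) (w : Om) : R :=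
  mxopnorm (orthonormalized (Ghat n w) - 1%:M).
Definition Merr (n : nat) (w : Om) : R :=
  mxopnorm (orthonormalized (Mhat n w) - orthonormalized Mmx).

(* The value 0 when there is no largest real generalized eigenvalue is arbitrary. *)
Definition rhohat (n : nat) (w : Om) : R :=
  xget 0 [set l | largest_gen_eigenvalue (Mhat n w) (Ghat n w) l].

End estimator.


Section efficiency.
Context {dO : measure_display} {Om : measurableType dO}.
Context {d : measure_display} {T : measurableType d} {R : realType}.
Variables (P : probability Om R) (X : nat -> {mfun Om >-> T}).
Variables (Q : probability T R) (P1 : R.-pker T ~> T) (m : T * T -> R).

(* E[g(X_t, X_{t+1}) | X_t = x] is the integral of g(x, .) against P1 x. *)
Definition tangent_space : set (T * T -> R) :=
  [set g | L2 (Q2 P X) g /\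
    {ae Q, forall x, (\int[P1 x]_y (g (x, y))%:E)%E = 0%E}].

Definition bounded_score (g : T * T -> R) : Prop :=
  tangent_space g /\ exists C : R, forall z, `|g z| <= C.

Definition log_mgf (g : T * T -> R) (tau : R) (x : T) : R :=
  ln (\int[P1 x]_y expR (tau * g (x, y))).

Definition submodel_density (g : T * T -> R) (tau : R) (z : T * T) : R :=
  expR (tau * g z - log_mgf g tau z.1).

(* The integral of m(x, y) f(y) against P1^(tau,g)(dy | x), which is
   [submodel_density g tau (x, y)] times P1(dy | x). *)
Definition submodel_op (g : T * T -> R) (tau : R) : (T -> R) -> T -> R :=
  Mop P1 (fun z => m z * submodel_density g tau z).

(* There is at most one largest eigenvalue. As [rho_submodel g 0] is positive,
   differentiability at 0 forces it to exist for all small tau. *)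
Definition rho_submodel (g : T * T -> R) (tau : R) : R :=
  xget 0 [set r | largest_eigenvalue Q (submodel_op g tau) r].

Definition pathwise_gradient (psit : T * T -> R) : Prop :=
  L2 (Q2 P X) psit /\
  forall g, bounded_score g ->
    is_derive (0 : R) (1 : R) (rho_submodel g) (inner (Q2 P X) psit g).

Definition efficient_influence (psi : T * T -> R) : Prop :=
  exists2 psit, pathwise_gradient psit &
    tangent_space psi /\
    forall h, tangent_space h -> inner (Q2 P X) (psit \- psi) h = 0.

Definition efficiency_bound (v : R) : Prop :=
  exists2 psi, efficient_influence psi & v = inner (Q2 P X) psi psi.

Definition asymptotically_linear (est : nat -> Om -> R) (rho : R)
    (psi : T * T -> R) : Prop :=
  is_op P (fun n w => Num.sqrt n%:R * (est n w - rho) -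
      (Num.sqrt n%:R)^-1 * \sum_(t < n) psi (X t w, X t.+1 w)) (fun=> 1).

Definition semiparametrically_efficient (est : nat -> Om -> R) (rho : R) : Prop :=
  exists2 psi, efficient_influence psi & asymptotically_linear est rho psi.

Definition psi_rho (rho : R) (phi phis : T -> R) (z : T * T) : R :=
  phis z.1 * m z * phi z.2 - rho * phis z.1 * phi z.1.

Definition V_rho (rho : R) (phi phis : T -> R) : R :=
  \int[P]_w psi_rho rho phi phis (X 0%N w, X 1%N w) ^+ 2.

End efficiency.

(* Main.v *)
(** A spectral gap comes from (A1) and (A2). Let [phi], [phis] be the
    eigenfunctions, [<phi, phis> = 1]. By (A2) the operator [M] is a norm limit of
    finite rank operators, and [M / rho] does not increase [int |u| phis dQ] because
    [phis > 0] is an eigenfunction of the adjoint. An Ehrling-type inequality,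
    [|M u| <= e |u| + C_e int |u| phis dQ], then makes the powers of [M / rho]
    bounded, and turns the almost everywhere convergence in (A1) into norm
    convergence to 0 on the complement [{u | <u, phis> = 0}]; by compactness the
    convergence is uniform on the unit ball. So some equivalent Hilbert norm makes
    [M] a contraction by [kap < rho] on that complement.

    For any operator [A] close to [M], on [L^2] or on a subspace embedded in it, the
    map [v |-> A v / <A v, phis>] contracts a neighbourhood of [phi] in that norm.
    Its fixed point is an eigenvector of [A], its eigenvalue [r] satisfies
    [r - rho = <(A - M) f, phis>] and dominates all other complex eigenvalues of [A].

    With [A] the operator of a submodel, expanding the density to second order
    in [tau] gives the derivative [int phis m phi g dQ2] of the largest eigenvalue;
    this is the inner product of [g] with [psi_rho], which has conditional mean zero
    and thus lies in the tangent space.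

    With [A = Ghat^-1 Mhat] in coordinates orthonormal for [G], the first order terms
    cancel because [phis] is a left eigenvector, and [rhohat - rho] equals the
    empirical mean of [f2 m f1 - rho f2 f1], with [f1], [f2] the projections of [phi],
    [phis], up to a product of two errors of order [o_p(n^-1/4)]. Replacing [f1], [f2]
    by [phi], [phis] costs [o_p(n^-1/2)] by Markov's inequality. *)

Require Import Defs.
From HB Require Import structures.
From mathcomp Require Import all_boot all_order all_algebra.
From mathcomp Require Import all_classical all_reals all_analysis.
From mathcomp Require Import measurable_realfun ring lra.

Set Implicit Arguments.
Unset Strict Implicit.
Unset Printing Implicit Defensive.
Import Order.TTheory GRing.Theory Num.Theory.
Import numFieldNormedType.Exports.
Local Open Scope classical_set_scope.
Local Open Scope ring_scope.

(** * Perturbation of a dominant eigenpair *)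

(** Neither [M] nor [Ghat^-1 Mhat] is symmetric, so no variational characterisation of the
    eigenvalue is at hand, and the eigenvalues to be dominated may be complex. The spaces stay real:
    a complex eigenvector is a pair of real vectors. For an inner product norm, multiplication by
    [x + iy] scales the norm of a pair by exactly its modulus; this is why the equivalent norm has
    to be a Hilbert norm. The formula for [r - rho] is exact, so a second order expansion only
    requires a first order bound on [f - phi], which the gap supplies. For the sieve there is an
    obstacle: the projection error of [M] is merely o(1), far too large for the expansion. Its
    action on [phi] is governed by the much smaller projection error of [phi], because
    [M phi = rho phi]; what is left acts on [f - phi] and is absorbed. All constants depend on [M]
    and its eigenfunctions only, never on the dimension of the sieve. *)

Lemma geometric_cauchy_real (R : realType) (x : nat -> R) (C q : R) :
  0 <= q -> q < 1 -> (forall i, `|x i.+1 - x i| <= C * q ^+ i) ->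
  exists l, forall i, `|x i - l| <= C * q ^+ i / (1 - q).
Proof.
move=> q0 q1 hx; have q1' : 0 < 1 - q by rewrite subr_gt0.
have C0 : 0 <= C by have := hx 0; rewrite expr0 mulr1; exact: le_trans.
(* [r i] is the tail of the geometric series from [i] on, so the intervals [[x i - r i, x i + r i]]
   are nested. A common point is the limit, and the error bound comes with it. *)
pose r i := C * q ^+ i / (1 - q).
have rE i : r i = C * q ^+ i + r i.+1.
  by rewrite /r exprS; field; rewrite gt_eqF.
have r0 i : 0 <= r i by rewrite divr_ge0 ?mulr_ge0 ?exprn_ge0 // ltW.
have zi i j : x i - r i <= x (i + j)%N - r (i + j)%N.
  elim: j => [|j IH]; first by rewrite addn0.
  apply: le_trans IH _; rewrite addnS.
  have := hx (i + j)%N; rewrite ler_norml => /andP[h _].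
  have := rE (i + j)%N; lra.
have yd i j : x (i + j)%N + r (i + j)%N <= x i + r i.
  elim: j => [|j IH]; first by rewrite addn0.
  apply: le_trans IH; rewrite addnS.
  have := hx (i + j)%N; rewrite ler_norml => /andP[_ h].
  have := rE (i + j)%N; lra.
have zy i j : x i - r i <= x j + r j.
  apply: le_trans (zi i j) _; rewrite addnC; apply: le_trans _ (yd j i).
  by have := r0 (j + i)%N; lra.
pose S := [set x i - r i | i in [set: nat]].
have S0 : S !=set0 by exists (x 0 - r 0), 0.
have ubS j : ubound S (x j + r j) by move=> _ [i _ <-].
exists (sup S) => i; rewrite distrC ler_norml; apply/andP; split.
  have : x i - r i <= sup S by apply: ub_le_sup; [exists (x 0 + r 0) | exists i].
  rewrite -/(r i); lra.
have : sup S <= x i + r i by apply: ge_sup.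
rewrite -/(r i); lra.
Qed.

Lemma cvg_geometric_eps (R : realType) (C q e : R) : 0 <= q -> q < 1 -> 0 < e ->
  exists i, C * q ^+ i < e.
Proof.
move=> q0 q1 e0.
have [C0|C0] := leP C 0.
  by exists 0; apply: le_lt_trans e0; rewrite expr0 mulr1.
have := @cvg_expr R q; rewrite ger0_norm // => /(_ q1).
move=> /cvgr0_norm_lt /(_ (e / C)); rewrite divr_gt0 // => /(_ isT)[N _ /(_ N (leqnn N))] /= h.
by exists N; rewrite mulrC -ltr_pdivlMr //; apply: le_lt_trans h; rewrite ler_norm.
Qed.

(** Inner products are values and not a structure on the space, because one space carries several:
    the [L^2] product, the adapted one, and the forms of semidefinite matrices. Definiteness is
    assumed separately where it matters. *)
Record semi_ip (R : realType) (E : lmodType R) := SemiIp {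
  ip :> E -> E -> R;
  ipC : forall u v, ip u v = ip v u;
  ipDl : forall u v w, ip (u + v) w = ip u w + ip v w;
  ipZl : forall a u v, ip (a *: u) v = a * ip u v;
  ip_ge0 : forall u, 0 <= ip u u }.

Definition ipnorm (R : realType) (E : lmodType R) (b : semi_ip E) (u : E) : R :=
  Num.sqrt (b u u).

Section semi_ip_theory.
Variables (R : realType) (E : lmodType R) (b : semi_ip E).
Implicit Types (u v w : E) (c : R).
Local Notation n := (ipnorm b).

Lemma ipDr u v w : b u (v + w) = b u v + b u w.
Proof. by rewrite ipC ipDl ![b _ u]ipC. Qed.

Lemma ipZr c u v : b u (c *: v) = c * b u v.
Proof. by rewrite ipC ipZl ipC. Qed.

Lemma ipNl u v : b (- u) v = - b u v.
Proof. by rewrite -scaleN1r ipZl mulN1r. Qed.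

Lemma ipNr u v : b u (- v) = - b u v.
Proof. by rewrite ipC ipNl ipC. Qed.

Lemma ipBl u v w : b (u - v) w = b u w - b v w.
Proof. by rewrite ipDl ipNl. Qed.

Lemma ipBr u v w : b u (v - w) = b u v - b u w.
Proof. by rewrite ipDr ipNr. Qed.

Lemma ip0l u : b 0 u = 0.
Proof. by rewrite -(scale0r u) ipZl mul0r. Qed.

Lemma ip0r u : b u 0 = 0.
Proof. by rewrite ipC ip0l. Qed.

Lemma ip_suml (I : Type) (r : seq I) (P : pred I) (F : I -> E) v :
  b (\sum_(i <- r | P i) F i) v = \sum_(i <- r | P i) b (F i) v.
Proof.
apply: (big_morph (fun u => b u v)); last exact: ip0l.
by move=> x y; rewrite ipDl.
Qed.

Lemma ip_sumr (I : Type) (r : seq I) (P : pred I) (F : I -> E) v :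
  b v (\sum_(i <- r | P i) F i) = \sum_(i <- r | P i) b v (F i).
Proof. by rewrite ipC ip_suml; apply: eq_bigr => i _; rewrite ipC. Qed.

Lemma ipnorm_ge0 u : 0 <= n u.
Proof. exact: sqrtr_ge0. Qed.

Lemma sqr_ipnorm u : n u ^+ 2 = b u u.
Proof. by rewrite sqr_sqrtr // ip_ge0. Qed.

Lemma ipnormZ c u : n (c *: u) = `|c| * n u.
Proof.
by rewrite /ipnorm ipZl ipZr mulrA -expr2 sqrtrM ?sqr_ge0 // sqrtr_sqr.
Qed.

Lemma ipnormN u : n (- u) = n u.
Proof. by rewrite -scaleN1r ipnormZ normrN1 mul1r. Qed.

Lemma ipnormB u v : n (u - v) = n (v - u).
Proof. by rewrite -ipnormN opprB. Qed.

Lemma ipnorm0 : n 0 = 0.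
Proof. by rewrite /ipnorm ip0l sqrtr0. Qed.

Lemma ip_cauchy_schwarz u v : `|b u v| <= n u * n v.
Proof.
rewrite -sqrtrM ?ip_ge0 // -sqrtr_sqr ler_sqrt ?mulr_ge0 ?ip_ge0 //.
have q t : 0 <= b u u - t * b u v *+ 2 + t ^+ 2 * b v v.
  have := ip_ge0 b (u - t *: v).
  rewrite ipBl !ipBr !ipZl !ipZr (ipC b v u) expr2 mulr2n; lra.
have [v0|v0] := eqVneq (b v v) 0.
  rewrite v0 mulr0; have [->|uv0] := eqVneq (b u v) 0; first by rewrite expr0n.
  (* When [b v v = 0] the polynomial is affine in [t], and this value of [t] would make it
     negative. *)
  have := q ((b u u + 1) / (b u v)); rewrite v0 mulr0 addr0 divfK // mulr2n.
  by have := ip_ge0 b u; lra.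
have := q (b u v / b v v).
have v1 : 0 < b v v by rewrite lt_neqAle eq_sym v0 ip_ge0.
have -> : b u u - b u v / b v v * b u v *+ 2 + (b u v / b v v) ^+ 2 * b v v
  = (b u u * b v v - b u v ^+ 2) / b v v by field.
by rewrite pmulr_lge0 ?invr_gt0 // subr_ge0.
Qed.

Lemma ipnormD u v : n (u + v) <= n u + n v.
Proof.
rewrite -(@ler_pXn2r _ 2) ?nnegrE ?addr_ge0 ?ipnorm_ge0 //.
rewrite sqrrD !sqr_ipnorm ipDl !ipDr (ipC b v u).
have := ip_cauchy_schwarz u v; rewrite ler_norml => /andP[_]; rewrite mulr2n; lra.
Qed.

Lemma ipnorm_triangleB u v : n (u - v) <= n u + n v.
Proof. by rewrite -(ipnormN v); exact: ipnormD. Qed.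

Lemma ipnorm_sum (I : Type) (r : seq I) (P : pred I) (F : I -> E) :
  n (\sum_(i <- r | P i) F i) <= \sum_(i <- r | P i) n (F i).
Proof.
apply: (big_ind2 (fun u x => n u <= x)) => //; first by rewrite ipnorm0.
by move=> u x v y hu hv; apply: le_trans (ipnormD _ _) (lerD hu hv).
Qed.

End semi_ip_theory.

(* The Hilbert norm makes the complexification of [T] a contraction by [kap] for
   the norm of the pair, so that no complex eigenvalue exceeds [kap]. *)
Lemma complex_eigenvalue_bound (R : realType) (E : lmodType R) (a : semi_ip E)
    (u v u' v' : E) (kap x y : R) : 0 <= kap ->
  0 < a u u + a v v ->
  ipnorm a u' <= kap * ipnorm a u -> ipnorm a v' <= kap * ipnorm a v ->
  u' = x *: u - y *: v -> v' = y *: u + x *: v ->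
  Num.sqrt (x ^+ 2 + y ^+ 2) <= kap.
Proof.
move=> k0 h hu hv eu ev.
have sq (w w' : E) : ipnorm a w' <= kap * ipnorm a w -> a w' w' <= kap ^+ 2 * a w w.
  by move=> hw; rewrite -!sqr_ipnorm -exprMn lerXn2r ?nnegrE ?mulr_ge0 ?ipnorm_ge0.
have := lerD (sq _ _ hu) (sq _ _ hv); rewrite {}eu {}ev.
rewrite ipBl ipDl !ipDr !ipNr !ipZl !ipZr (ipC a v u) => hh.
have {}hh : (x ^+ 2 + y ^+ 2) * (a u u + a v v) <= kap ^+ 2 * (a u u + a v v).
  by move: hh; rewrite !expr2; lra.
rewrite -(@ger0_norm _ kap) // -sqrtr_sqr ler_sqrt ?sqr_ge0 //.
by move: hh; rewrite ler_pM2r.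
Qed.

(** A Hilbert counterpart of the norm [max_j kap^-j |M^j u|]: it turns [M] into a contraction by
    [kap] as soon as the single power [M^J] contracts by [kap^J]. A sum of squares replaces the
    maximum so that the result is again an inner product. *)
Definition adapted_ip_fun (R : realType) (E : lmodType R) (b : semi_ip E)
    (M : {linear E -> E}) (kap : R) (J : nat) (u v : E) : R :=
  \sum_(j < J) kap ^- (2 * j) * b (iter j M u) (iter j M v).

Lemma iter_linearD (R : realType) (E : lmodType R) (M : {linear E -> E}) j u v :
  iter j M (u + v) = iter j M u + iter j M v.
Proof. by elim: j => //= j ->; rewrite linearD. Qed.

Lemma iter_linearZ (R : realType) (E : lmodType R) (M : {linear E -> E}) j c u :
  iter j M (c *: u) = c *: iter j M u.
Proof. by elim: j => //= j ->; rewrite linearZ. Qed.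

Section adapted.
Variables (R : realType) (E : lmodType R) (b : semi_ip E) (M : {linear E -> E}).
Variables (kap : R) (J : nat) (kap0 : 0 < kap).

Local Notation a := (adapted_ip_fun b M kap J).

Lemma adapted_ip_axioms : exists a' : semi_ip E, forall u v, a' u v = a u v.
Proof.
have aC u v : a u v = a v u by apply: eq_bigr => j _; rewrite ipC.
have aD u v w : a (u + v) w = a u w + a v w.
  by rewrite /a -big_split; apply: eq_bigr => j _; rewrite iter_linearD ipDl mulrDr.
have aZ c u v : a (c *: u) v = c * a u v.
  by rewrite /a mulr_sumr; apply: eq_bigr => j _; rewrite iter_linearZ ipZl mulrCA.
have a0 u : 0 <= a u u.
  by apply: sumr_ge0 => j _; rewrite mulr_ge0 ?ip_ge0 // invr_ge0 exprn_ge0 // ltW.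
by exists (SemiIp aC aD aZ a0).
Qed.

Lemma adapted_ip_lower u : (0 < J)%N -> b u u <= a u u.
Proof.
case: J => // J' _; rewrite /adapted_ip_fun big_ord_recl /= muln0 expr0 invr1 mul1r lerDl.
by apply: sumr_ge0 => j _; rewrite mulr_ge0 ?ip_ge0 // invr_ge0 exprn_ge0 // ltW.
Qed.

Lemma adapted_ip_upper B : (forall u, ipnorm b (M u) <= B * ipnorm b u) -> 0 <= B ->
  exists2 K, 0 <= K & forall u, a u u <= K ^+ 2 * b u u.
Proof.
move=> hB B0; pose s := \sum_(j < J) kap ^- (2 * j) * B ^+ (2 * j).
have s0 : 0 <= s.
  by apply: sumr_ge0 => j _; rewrite mulr_ge0 ?invr_ge0 ?exprn_ge0 // ltW.
exists (Num.sqrt s); first exact: sqrtr_ge0.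
move=> u; rewrite sqr_sqrtr // mulr_suml; apply: ler_sum => j _.
rewrite -mulrA ler_wpM2l ?invr_ge0 ?exprn_ge0 ?(ltW kap0) //.
rewrite -!sqr_ipnorm mulnC exprM -exprMn lerXn2r ?nnegrE ?mulr_ge0 ?ipnorm_ge0 ?exprn_ge0 //.
elim: (j : nat) => [|i IH] /=; first by rewrite mul1r.
by apply: le_trans (hB _) _; rewrite exprS -mulrA ler_wpM2l.
Qed.

(** Replacing [u] by [M u] shifts the sum by one index and brings out [kap^2]; the term of index 0
    is lost and that of index [J] gained. Only the behaviour of [M^J] at [u] itself enters. *)
Lemma adapted_ip_contraction u : ipnorm b (iter J M u) <= kap ^+ J * ipnorm b u ->
  a (M u) (M u) <= kap ^+ 2 * a u u.
Proof.
move=> hJ; have k0 := lt0r_neq0 kap0.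
pose F j := kap ^- (2 * j) * b (iter j M u) (iter j M u).
have -> : a (M u) (M u) = kap ^+ 2 * \sum_(j < J) F j.+1.
  rewrite mulr_sumr; apply: eq_bigr => j _; rewrite /F mulrA -!iterSr.
  by congr (_ * _); rewrite mulnS exprD invfM mulVKf ?expf_neq0.
rewrite ler_wpM2l ?sqr_ge0 //.
have : \sum_(j < J) F j.+1 + F 0%N = a u u + F J.
  by rewrite addrC -(big_ord_recl J (fun j => F j)) big_ord_recr.
suff : F J <= F 0%N by lra.
rewrite /F muln0 expr0 invr1 mul1r -!sqr_ipnorm ler_pdivrMl ?exprn_gt0 //.
by rewrite mulnC exprM -exprMn lerXn2r ?nnegrE ?mulr_ge0 ?ipnorm_ge0 ?exprn_ge0 // ltW.
Qed.

End adapted.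

(** With [deflation_im], the real and imaginary parts of [z w - l r f = z (w - l f) + l (z - r) f],
    where [z = x + iy], [w = u + iv] and [l = c + id]. *)
Lemma deflation_re (R : realType) (V : lmodType R) (x y c d r : R) (u v f : V) :
  x *: u - y *: v - c *: (r *: f) =
  x *: (u - c *: f) - y *: (v - d *: f) + (x * c - y * d - c * r) *: f.
Proof.
rewrite !scalerBr !scalerBl !scalerA opprB addrA; congr (_ - _).
rewrite [RHS]addrACA subrK -!addrA; congr (_ + _).
by rewrite addrCA subrr addr0.
Qed.

Lemma deflation_im (R : realType) (V : lmodType R) (x y c d r : R) (u v f : V) :
  y *: u + x *: v - d *: (r *: f) =
  y *: (u - c *: f) + x *: (v - d *: f) + (y * c + x * d - d * r) *: f.
Proof.
rewrite !scalerBr !scalerBl !scalerDl !scalerA addrA; congr (_ - _).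
by rewrite [RHS]addrACA !subrK.
Qed.

(** * Dominant eigenpairs of operators close to [M] *)

Section perturbation.
Variables (R : realType) (E : lmodType R) (b a : semi_ip E).
Local Notation n := (ipnorm b).
Local Notation na := (ipnorm a).
Variables (M : {linear E -> E}) (phi phis : E) (rho kap K : R).
Hypotheses (b_def : forall u, n u = 0 -> u = 0) (kap0 : 0 <= kap) (kap_rho : kap < rho).
Hypotheses (n_na : forall u, n u <= na u) (na_n : forall u, na u <= K * n u) (K0 : 0 <= K).
Hypotheses (M_phi : M phi = rho *: phi) (M_phis : forall u, b (M u) phis = rho * b u phis).
Hypotheses (phi_phis : b phi phis = 1).
Hypotheses (gap : forall u, b u phis = 0 -> na (M u) <= kap * na u).

Local Notation F := (n phi).
Local Notation S := (n phis).

(** Multiplied by [eps], it dominates every error of one step of the iteration: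
    [K (F + 1) (1 + S F)] bounds the error off [phi] in the adapted norm, [S (F + 1)] the change of
    the normalising factor, and [K + S (K F + 1)] the error in the Lipschitz estimate. *)
Definition perturbation_const : R :=
  K * (F + 1) * (1 + S * F) + S * (F + 1) + K + S * (K * F + 1).

(** On the complement the inverse of [alpha - M] is bounded by [2 / (rho - kap)], since [alpha]
    exceeds [(rho + kap) / 2]; the factor [K (1 + S F)] is the cost of projecting the error along
    [phi]. *)
Definition deviation_const : R := 2 * K * (1 + S * F) / (rho - kap).

Local Notation c := perturbation_const.

Section one_perturbation.
Variables (V : lmodType R) (iota : {linear V -> E}) (A : {linear V -> V}) (eps : R).
Hypothesis iota_inj : forall v, iota v = 0 -> v = 0.
(** Completeness in the form that a contraction uses. It is available both for classes of functions
    and, with the same constant, for coordinate vectors of any dimension. *)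
Hypothesis V_complete : forall (v : nat -> V) C q, 0 <= q -> q < 1 ->
  (forall i, n (iota (v i.+1 - v i)) <= C * q ^+ i) ->
  exists l, forall i, n (iota (v i - l)) <= C * q ^+ i / (1 - q).
Hypotheses (eps0 : 0 <= eps) (eps_small : 4 * (c * eps) <= rho - kap).
Hypothesis A_close : forall v, n (iota (A v) - M (iota v)) <= eps * n (iota v).

Local Notation ell v := (b (iota v) phis).
Local Notation err v := (iota (A v) - M (iota v)).
Local Notation alpha v := (ell (A v)).
Local Notation T v := ((alpha v)^-1 *: A v).

Let F0 : 0 <= F. Proof. exact: ipnorm_ge0. Qed.
Let S0 : 0 <= S. Proof. exact: ipnorm_ge0. Qed.
Let SF0 : 0 <= S * F. Proof. exact: mulr_ge0. Qed.

Let c_parts : [/\ K * (F + 1) * (1 + S * F) * eps + S * (F + 1) * eps <= c * eps,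
  K * eps + S * (K * F + 1) * eps <= c * eps & S * (F + 1) * eps <= c * eps].
Proof.
have h1 : 0 <= K * (F + 1) * (1 + S * F) * eps by rewrite !mulr_ge0 // addr_ge0.
have h2 : 0 <= S * (F + 1) * eps by rewrite !mulr_ge0 // addr_ge0.
have h3 : 0 <= K * eps by rewrite mulr_ge0.
have h4 : 0 <= S * (K * F + 1) * eps by rewrite !mulr_ge0 // addr_ge0 // mulr_ge0.
by rewrite /c !mulrDl; split; lra.
Qed.

Let gap0 : 0 < rho - kap. Proof. by rewrite subr_gt0. Qed.

Lemma alphaE v : alpha v = rho * ell v + b (err v) phis.
Proof. by rewrite ipBl M_phis addrC subrK. Qed.

Lemma ell_errB v w : err (v - w) = err v - err w.
Proof.
rewrite (linearB A) !(linearB iota) (linearB M) /= !opprB.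
by rewrite addrACA [RHS]addrACA; congr (_ + _); rewrite addrC. Qed.

Lemma na_proj e : na (e - b e phis *: phi) <= K * (1 + S * F) * n e.
Proof.
apply: le_trans (na_n _) _; rewrite -mulrA ler_wpM2l //.
apply: le_trans (ipnorm_triangleB _ _ _) _; rewrite ipnormZ mulrDl mul1r lerD2l.
by rewrite mulrAC ler_wpM2r // mulrC ip_cauchy_schwarz.
Qed.

(** The invariant set of the iteration. On the slice [ell v = 1] all differences are annihilated by
    [phis], which is where the gap applies. *)
Definition near_phi v := ell v = 1 /\ na (iota v - phi) <= 1.

Lemma near_phi_norm v : near_phi v -> n (iota v) <= F + 1.
Proof.
move=> [_ h]; rewrite -(subrK phi (iota v)) addrC.
by apply: le_trans (ipnormD _ _ _) _; rewrite lerD2l (le_trans (n_na _)).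
Qed.

Lemma near_phi_err v : near_phi v -> n (err v) <= eps * (F + 1).
Proof.
by move=> hv; apply: le_trans (A_close v) _; rewrite ler_wpM2l // near_phi_norm.
Qed.

Lemma near_phi_alpha v : near_phi v -> rho - c * eps <= alpha v.
Proof.
move=> hv; rewrite alphaE hv.1 mulr1 lerD2l.
have h : `|b (err v) phis| <= S * (F + 1) * eps.
  apply: le_trans (ip_cauchy_schwarz _ _ _) _.
  by rewrite mulrC -mulrA ler_wpM2l // mulrC near_phi_err.
have [_ _ h3] := c_parts; move: h; rewrite ler_norml => /andP[h _]; lra.
Qed.

Lemma near_phi_alpha_gt v : near_phi v -> (rho + kap) / 2 < alpha v.
Proof. by move=> /near_phi_alpha; move: eps_small gap0; lra. Qed.

Lemma near_phi_alpha_gt0 v : near_phi v -> 0 < alpha v.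
Proof. by move=> /near_phi_alpha; move: eps_small gap0 kap0; lra. Qed.

(** The components along [phi] cancel: [alpha v] is [rho] plus the pairing of the error with [phis].
    There remain [M] acting on the complement and the error projected along [phi]. *)
Lemma step_dev v : ell v = 1 ->
  iota (A v) - alpha v *: phi = M (iota v - phi) + (err v - b (err v) phis *: phi).
Proof.
move=> h1; rewrite alphaE h1 mulr1 scalerDl linearB /= M_phi.
rewrite opprD !addrA; congr (_ - _).
by rewrite [RHS]addrAC (addrAC (M _)) subrr add0r addrC.
Qed.

Lemma near_phi_step v : near_phi v -> near_phi (T v).
Proof.
move=> hv; have al0 := near_phi_alpha_gt0 hv.
have iv0 : 0 <= (alpha v)^-1 by rewrite invr_ge0 ltW.
split.
  by rewrite linearZ /= ipZl mulVf // gt_eqF.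
have -> : iota (T v) - phi = (alpha v)^-1 *: (iota (A v) - alpha v *: phi).
  by rewrite linearZ /= scalerBr scalerA mulVf ?gt_eqF // scale1r.
rewrite ipnormZ (ger0_norm iv0) ler_pdivrMl // mulr1.
rewrite step_dev ?hv.1 //; apply: le_trans (ipnormD _ _ _) _.
have h1 : na (M (iota v - phi)) <= kap.
  apply: le_trans (gap _) _; first by rewrite ipBl hv.1 phi_phis subrr.
  by rewrite ler_piMr // hv.2.
have h2 : na (err v - b (err v) phis *: phi) <= K * (F + 1) * (1 + S * F) * eps.
  apply: le_trans (na_proj _) _.
  have -> : K * (F + 1) * (1 + S * F) * eps = K * (1 + S * F) * (eps * (F + 1)) by ring.
  by rewrite ler_wpM2l ?near_phi_err // mulr_ge0 // addr_ge0.
have [p1 _ _] := c_parts; have := near_phi_alpha hv.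
have : 0 <= S * (F + 1) * eps by rewrite !mulr_ge0 // addr_ge0.
move: eps_small gap0; lra.
Qed.

Lemma near_phi_na v : near_phi v -> na (iota v) <= K * F + 1.
Proof.
move=> [_ h]; rewrite -(subrK phi (iota v)) addrC.
by apply: le_trans (ipnormD _ _ _) _; rewrite lerD.
Qed.

Definition rate : R := (kap + c * eps) / (rho - c * eps).

Lemma rate_ge0 : 0 <= rate.
Proof.
have [p1 p2 p3] := c_parts.
have h : 0 <= S * (F + 1) * eps by rewrite !mulr_ge0 // addr_ge0.
rewrite /rate divr_ge0 //; move: kap0 eps_small gap0; lra.
Qed.

Lemma rate_lt1 : rate < 1.
Proof.
rewrite /rate ltr_pdivrMr ?mul1r; move: kap0 eps_small gap0; lra.
Qed.

(** For [ell v = 0] the number [b (err v) phis] is [ell (A v)], so subtracting this multiple of a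
    [g] with [<g, phis> = 1] leads back to the complement. [g] is left free because it is the next
    iterate in the contraction estimate and the eigenvector in the dominance argument. *)
Lemma deflated_step v g : ell v = 0 -> na g <= K * F + 1 ->
  na (iota (A v) - b (err v) phis *: g) <= (kap + c * eps) * na (iota v).
Proof.
move=> hv hg.
have -> : iota (A v) - b (err v) phis *: g = M (iota v) + (err v - b (err v) phis *: g).
  by rewrite addrA addrCA subrr addr0.
have he : n (err v) <= eps * na (iota v).
  by apply: le_trans (A_close v) _; rewrite ler_wpM2l.
apply: le_trans (ipnormD _ _ _) _; rewrite mulrDl; apply: lerD; first exact: gap.
have [_ p2 _] := c_parts.
apply: le_trans (_ : (K * eps + S * (K * F + 1) * eps) * na (iota v) <= _); last first.
  by rewrite ler_wpM2r ?ipnorm_ge0.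
apply: le_trans (ipnorm_triangleB _ _ _) _; rewrite mulrDl; apply: lerD.
  by apply: le_trans (na_n _) _; rewrite -mulrA ler_wpM2l.
rewrite ipnormZ; apply: le_trans (_ : (n (err v) * S) * (K * F + 1) <= _).
  by apply: ler_pM; rewrite ?ipnorm_ge0 // ip_cauchy_schwarz.
have -> : S * (K * F + 1) * eps * na (iota v) = eps * na (iota v) * S * (K * F + 1) by ring.
by rewrite ler_wpM2r ?addr_ge0 ?mulr_ge0 // ler_wpM2r.
Qed.

Lemma step_contraction v w : near_phi v -> near_phi w ->
  na (iota (T v - T w)) <= rate * na (iota (v - w)).
Proof.
move=> hv hw; have av := near_phi_alpha_gt0 hv; have aw := near_phi_alpha_gt0 hw.
have iv0 : 0 <= (alpha v)^-1 by rewrite invr_ge0 ltW.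
have e0 : ell (v - w) = 0 by rewrite linearB /= ipBl hv.1 hw.1 subrr.
(* [T v - T w] is [(alpha v)^-1] times [A (v - w) - (alpha v - alpha w) T w], where
   [alpha v - alpha w] is linear in [v - w]: a deflated step with [g = T w]. *)
have -> : iota (T v - T w) = (alpha v)^-1 *:
    (iota (A (v - w)) - b (err (v - w)) phis *: iota (T w)).
  have -> : b (err (v - w)) phis = alpha v - alpha w.
    by rewrite ell_errB ipBl !ipBl !M_phis hv.1 hw.1; ring.
  rewrite (linearB A) !(linearB iota) 2!linearZ /= scalerA mulrBl.
  rewrite mulfV ?gt_eqF // scalerBl scale1r opprB addrA subrK scalerBr scalerA.
  by rewrite mulrA mulVf ?gt_eqF // mul1r.
rewrite ipnormZ (ger0_norm iv0) ler_pdivrMl //.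
have h := deflated_step e0 (near_phi_na (near_phi_step hw)).
apply: le_trans h _; rewrite mulrA ler_wpM2r ?ipnorm_ge0 //.
have al := near_phi_alpha hv.
have r1 : 0 < rho - c * eps by move: kap0 eps_small gap0; lra.
have -> : kap + c * eps = (rho - c * eps) * rate.
  by rewrite /rate mulrCA mulfV ?mulr1 // gt_eqF.
by rewrite ler_wpM2r ?rate_ge0.
Qed.

Lemma fixed_point v0 : near_phi v0 -> exists2 f, near_phi f & A f = alpha f *: f.
Proof.
move=> h0; pose v i := iter i (fun v => T v) v0.
have hv i : near_phi (v i) by elim: i => //= i; exact: near_phi_step.
have r0 := rate_ge0; have r1 := rate_lt1.
have r1' : 0 < 1 - rate by rewrite subr_gt0.
pose C0 := na (iota (v 1%N - v 0%N)).
have hC i : na (iota (v i.+1 - v i)) <= C0 * rate ^+ i.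
  elim: i => [|i IH]; first by rewrite expr0 mulr1.
  apply: le_trans (step_contraction (hv i.+1) (hv i)) _.
  by rewrite exprS mulrCA ler_wpM2l.
have [l hl] := V_complete r0 r1 (fun i => le_trans (n_na _) (hC i)).
have small e : 0 < e -> exists i, na (iota (v i - l)) < e.
  move=> e0; have [i hi] := cvg_geometric_eps (K * C0 / (1 - rate)) r0 r1 e0.
  exists i; apply: le_lt_trans hi; apply: le_trans (na_n _) _.
  by apply: le_trans (ler_wpM2l K0 (hl i)) _; rewrite !mulrA [leRHS]mulrAC.
have hl1 : ell l = 1.
  apply/eqP; rewrite -subr_eq0 -normr_eq0; apply/eqP/le_anti; rewrite normr_ge0 andbT.
  apply/ler_addgt0Pl => e e0.
  have e1 : 0 < e / (S + 1) by rewrite divr_gt0 // ltr_pwDr.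
  have [i hi] := small _ e1; rewrite addr0.
  rewrite -(hv i).1 -ipBl -(linearB iota) /=; apply: le_trans (ip_cauchy_schwarz _ _ _) _.
  apply: le_trans (_ : e / (S + 1) * (S + 1) <= _); last by rewrite divfK // gt_eqF // ltr_pwDr.
  apply: ler_pM; rewrite ?ipnorm_ge0 //; last by rewrite lerDl.
  by rewrite (linearB iota) ipnormB -(linearB iota); apply: le_trans (n_na _) (ltW hi).
have hl2 : na (iota l - phi) <= 1.
  apply/ler_addgt0Pl => e e0; have [i hi] := small _ e0.
  rewrite -(subrK (iota (v i)) (iota l)) -addrA.
  apply: le_trans (ipnormD _ _ _) _; apply: lerD; last exact: (hv i).2.
  by rewrite ipnormB -(linearB iota); exact: ltW.
have nl : near_phi l by [].
exists l => //.
have al := near_phi_alpha_gt0 nl.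
suff : iota (T l - l) = 0.
  move=> /iota_inj /eqP; rewrite subr_eq0 => /eqP e.
  by rewrite -[X in _ = _ *: X]e scalerA mulfV ?gt_eqF // scale1r.
apply: b_def; apply/le_anti; rewrite ipnorm_ge0 andbT; apply/ler_addgt0Pl => e e0.
have [i hi] : exists i, na (iota (v i - l)) < e / 3 /\ na (iota (v i.+1 - v i)) < e / 3.
  have e1 : 0 < e / 3 by rewrite divr_gt0.
  pose D := Num.max (K * C0 / (1 - rate)) C0.
  have [i hi] := cvg_geometric_eps D r0 r1 e1.
  exists i; split; apply: le_lt_trans hi.
    apply: le_trans (na_n _) _; apply: le_trans (_ : K * C0 / (1 - rate) * rate ^+ i <= _).
      by apply: le_trans (ler_wpM2l K0 (hl i)) _; rewrite !mulrA [leRHS]mulrAC.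
    by rewrite ler_wpM2r ?exprn_ge0 // le_max lexx.
  by apply: le_trans (hC i) _; rewrite ler_wpM2r ?exprn_ge0 // le_max lexx orbT.
rewrite addr0; apply: le_trans (n_na _) _.
have -> : T l - l = (T l - T (v i)) + (v i.+1 - v i) + (v i - l).
  by rewrite (_ : v i.+1 = T (v i)) // !subrKA.
rewrite (linearD iota (_ + _)); apply: le_trans (ipnormD _ _ _) _.
rewrite (linearD iota (_ - _)); have := ipnormD a (iota (T l - T (v i))) (iota (v i.+1 - v i)).
have := step_contraction nl (hv i); rewrite (linearB _ l) [X in _ * X]ipnormB -(linearB iota).
have : rate * na (iota (v i - l)) <= na (iota (v i - l)) by rewrite ler_piMl ?ipnorm_ge0 // ltW.
move: hi => [hi1 hi2]; lra.
Qed.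

Lemma deviation f : near_phi f -> A f = alpha f *: f ->
  n (iota f - phi) <= deviation_const * n (err f).
Proof.
move=> hf hA; have al := near_phi_alpha_gt hf.
have h1 : alpha f *: (iota f - phi) = M (iota f - phi) + (err f - b (err f) phis *: phi).
  by rewrite -step_dev ?hf.1 // scalerBr; congr (_ - _); rewrite -linearZ -hA.
have h2 : alpha f * na (iota f - phi) <=
    kap * na (iota f - phi) + K * (1 + S * F) * n (err f).
  have al0 := near_phi_alpha_gt0 hf.
  rewrite -[X in X * _](ger0_norm (ltW al0)) -ipnormZ h1.
  apply: le_trans (ipnormD _ _ _) _; apply: lerD; last exact: na_proj.
  by apply: gap; rewrite ipBl hf.1 phi_phis subrr.
apply: le_trans (n_na _) _; rewrite /deviation_const.
rewrite mulrAC ler_pdivlMr //.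
have h3 : (rho + kap) / 2 * na (iota f - phi) <= alpha f * na (iota f - phi).
  by rewrite ler_wpM2r ?ipnorm_ge0 // ltW.
move: h2 h3; set x := na _; set y := n _; nra.
Qed.

(** Removing the [f] component of a complex eigenvector either leaves an eigenvector of the deflated
    operator, whose eigenvalue has modulus at most [kap + c * eps <= r], or leaves nothing, and then
    the eigenvalue is [r]. *)
Lemma dominant f : near_phi f -> A f = alpha f *: f ->
  forall (x y : R) u v, ~ (u = 0 /\ v = 0) ->
    A u = x *: u - y *: v -> A v = y *: u + x *: v ->
    Num.sqrt (x ^+ 2 + y ^+ 2) <= alpha f.
Proof.
move=> hf hA x y u v huv hu hv; have al0 := near_phi_alpha_gt0 hf.
set r := alpha f in hA al0 *.
pose u' := u - ell u *: f; pose v' := v - ell v *: f.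
have eu' : ell u' = 0 by rewrite (linearB iota) linearZ /= ipBl ipZl hf.1 mulr1 subrr.
have ev' : ell v' = 0 by rewrite (linearB iota) linearZ /= ipBl ipZl hf.1 mulr1 subrr.
have h1 : A u' = x *: u' - y *: v' + (x * ell u - y * ell v - ell u * r) *: f.
  by rewrite /u' /v' (linearB A) linearZ /= hu hA (deflation_re _ _ _ (ell v)).
have h2 : A v' = y *: u' + x *: v' + (y * ell u + x * ell v - ell v * r) *: f.
  by rewrite /u' /v' (linearB A) linearZ /= hv hA (deflation_im _ _ (ell u)).
(* Pairing with [phis] shows that the multiple of [f] left over by the deflation is the correction
   of [deflated_step]; once it is subtracted, [(u', v')] satisfies an exact complex eigenvalue
   equation. *)
have g1 : x * ell u - y * ell v - ell u * r = b (err u') phis.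
  rewrite ipBl M_phis eu' mulr0 subr0 h1 linearD /= (linearB iota) ipDl ipBl !linearZ /= !ipZl.
  by rewrite eu' ev' hf.1; ring.
have g2 : y * ell u + x * ell v - ell v * r = b (err v') phis.
  rewrite ipBl M_phis ev' mulr0 subr0 h2 !(linearD iota) !ipDl !linearZ /= !ipZl.
  by rewrite eu' ev' hf.1; ring.
have [z|nz] := eqVneq (a (iota u') (iota u') + a (iota v') (iota v')) 0; last first.
  apply: le_trans (_ : kap + c * eps <= r); last first.
    by have := near_phi_alpha hf; rewrite -/r; move: eps_small gap0; lra.
  have k1 : 0 <= kap + c * eps.
    have [p1 p2 p3] := c_parts.
    have h : 0 <= S * (F + 1) * eps by rewrite !mulr_ge0 // addr_ge0.
    by move: kap0; lra.
  have hg := near_phi_na hf.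
  apply: (@complex_eigenvalue_bound _ _ a (iota u') (iota v')
    (iota (A u') - b (err u') phis *: iota f) (iota (A v') - b (err v') phis *: iota f)) => //.
  - by rewrite lt_neqAle eq_sym nz addr_ge0 // ip_ge0.
  - exact: deflated_step.
  - exact: deflated_step.
  - by rewrite -g1 -[_ *: iota f]linearZ -(linearB iota) h1 addrK (linearB iota) !linearZ.
  - by rewrite -g2 -[_ *: iota f]linearZ -(linearB iota) h2 addrK linearD !linearZ.
have zz w : a (iota w) (iota w) = 0 -> w = 0.
  move=> h; apply: iota_inj; apply: b_def; apply/le_anti; rewrite ipnorm_ge0 andbT.
  by apply: le_trans (n_na _) _; rewrite /ipnorm h sqrtr0.
have [u0 v0] : u' = 0 /\ v' = 0.
  have := ip_ge0 a (iota u'); have := ip_ge0 a (iota v'); split; apply: zz; lra.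
have cd : ~ (ell u = 0 /\ ell v = 0).
  move=> [cu cv]; apply: huv; move: u0 v0; rewrite /u' /v' cu cv !scale0r !subr0.
  by [].
move: g1 g2; rewrite u0 v0 !linear0 !addr0 !ip0l => g1 g2.
(* The squared modulus of [(z - r) l], with [l] the complex coordinate of the eigenvector along [f].
   As [l] is nonzero, [z = r]. *)
have q : ((x - r) ^+ 2 + y ^+ 2) * (ell u ^+ 2 + ell v ^+ 2) = 0.
  have -> : ((x - r) ^+ 2 + y ^+ 2) * (ell u ^+ 2 + ell v ^+ 2) =
    (x * ell u - y * ell v - ell u * r) ^+ 2 + (y * ell u + x * ell v - ell v * r) ^+ 2 by ring.
  by rewrite g1 g2 !expr0n addr0.
move/eqP: q; rewrite mulf_eq0 => /orP[|/eqP h]; last first.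
  case: cd; have s1 := sqr_ge0 (ell u); have s2 := sqr_ge0 (ell v).
  by split; apply/eqP; rewrite -sqrf_eq0; apply/eqP; lra.
move=> /eqP h; have s1 := sqr_ge0 (x - r); have s2 := sqr_ge0 y.
have /eqP : y ^+ 2 = 0 by lra.
have /eqP : (x - r) ^+ 2 = 0 by lra.
rewrite !sqrf_eq0 subr_eq0 => /eqP -> /eqP ->.
by rewrite expr0n addr0 sqrtr_sqr ger0_norm // ltW.
Qed.

(** The starting point [v0] stands for [phi], which need not belong to the range of [iota]: in [L^2]
    it is [phi] itself, in coordinates a rescaled projection of [phi]. *)
Theorem perturbed_eigenpair v0 : ell v0 = 1 -> K * n (iota v0 - phi) <= 1 ->
  exists f r, [/\ ell f = 1 /\ n (iota f) <= F + 1, A f = r *: f,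
    r = rho + b (err f) phis /\ 0 < r, n (iota f - phi) <= deviation_const * n (err f) &
    forall (x y : R) u v, ~ (u = 0 /\ v = 0) ->
      A u = x *: u - y *: v -> A v = y *: u + x *: v ->
      Num.sqrt (x ^+ 2 + y ^+ 2) <= r].
Proof.
move=> h1 h2; have h0 : near_phi v0 by split=> //; exact: le_trans (na_n _) _.
have [f hf hA] := fixed_point h0.
exists f, (alpha f); split => //; last exact: dominant.
- by split; [exact: hf.1 | exact: near_phi_norm].
- by split; [rewrite alphaE hf.1 mulr1 | exact: near_phi_alpha_gt0].
- exact: deviation.
Qed.

End one_perturbation.
End perturbation.

(** * Euclidean matrix norms and square roots *)

Section dot.
Variables (R : realType) (k : nat).
Implicit Types (u v w : 'cV[R]_k) (A B : 'M[R]_k).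

Definition dot u v : R := (u^T *m v) 0 0.

Lemma dotE u v : dot u v = \sum_i u i 0 * v i 0.
Proof. by rewrite /dot mxE; apply: eq_bigr => i _; rewrite mxE. Qed.

Definition form_mx A u v : R := (u^T *m A *m v) 0 0.

Lemma form_mxE A u v : form_mx A u v = dot u (A *m v).
Proof. by rewrite /form_mx /dot mulmxA. Qed.

Lemma dot_trmx A u v : dot u (A *m v) = dot (A^T *m u) v.
Proof. by rewrite /dot trmx_mul trmxK mulmxA. Qed.

Lemma dotC u v : dot u v = dot v u.
Proof. by rewrite !dotE; apply: eq_bigr => i _; rewrite mulrC. Qed.

(** Gives Cauchy-Schwarz for semidefinite matrices, the substitute for diagonalisation in the
    construction of square roots. *)
Lemma form_mx_axioms A : A^T = A -> (forall v, 0 <= form_mx A v v) ->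
  exists f : semi_ip 'cV[R]_k, forall u v, f u v = form_mx A u v.
Proof.
move=> At A0.
have fC u v : form_mx A u v = form_mx A v u.
  by rewrite !form_mxE dot_trmx At dotC.
have fD u v w : form_mx A (u + v) w = form_mx A u w + form_mx A v w.
  by rewrite /form_mx linearD /= !mulmxDl mxE.
have fZ a u v : form_mx A (a *: u) v = a * form_mx A u v.
  by rewrite /form_mx linearZ /= -!scalemxAl mxE.
by exists (SemiIp fC fD fZ A0).
Qed.

Lemma dot_ge0 v : 0 <= dot v v.
Proof. by rewrite dotE; apply: sumr_ge0 => i _; rewrite -expr2 sqr_ge0. Qed.

Lemma dotDl u v w : dot (u + v) w = dot u w + dot v w.
Proof. by rewrite /dot linearD /= mulmxDl mxE. Qed.

Lemma dotZl a u v : dot (a *: u) v = a * dot u v.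
Proof. by rewrite /dot linearZ /= -scalemxAl mxE. Qed.

Definition dot_ip : semi_ip 'cV[R]_k := SemiIp dotC dotDl dotZl dot_ge0.

Lemma enormE v : enorm v = ipnorm dot_ip v.
Proof.
by rewrite /enorm /ipnorm /= dotE; congr Num.sqrt; apply: eq_bigr => i _; rewrite expr2.
Qed.

Lemma dot_def v : dot v v = 0 -> v = 0.
Proof.
rewrite dotE => /eqP; rewrite psumr_eq0 => [|i _]; last by rewrite -expr2 sqr_ge0.
move=> /allP h; apply/colP => i; rewrite mxE; apply/eqP.
by have := h i (mem_index_enum _); rewrite /= mulf_eq0 orbb.
Qed.

Lemma coord_le_enorm v i : `|v i 0| <= enorm v.
Proof.
rewrite /enorm -sqrtr_sqr ler_wsqrtr // (bigD1 i) //= lerDl.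
by apply: sumr_ge0 => j _; rewrite sqr_ge0.
Qed.

(** A real supremum carries information only when the set is bounded; the sum of the column norms is
    a crude bound. *)
Lemma mxopnorm_has_sup A :
  has_sup [set enorm (A *m v) | v in [set v : 'cV[R]_k | enorm v <= 1]].
Proof.
split; first by exists (enorm (A *m 0)), 0 => //=; rewrite enormE ipnorm0.
exists (\sum_i enorm (col i A)) => _ [v /= hv <-].
have -> : A *m v = \sum_i v i 0 *: col i A.
  apply/colP => j; rewrite !mxE summxE; apply: eq_bigr => i _.
  by rewrite !mxE mulrC.
rewrite enormE; apply: le_trans (ipnorm_sum _ _ _ _) _.
apply: ler_sum => i _; rewrite ipnormZ -enormE ler_piMl //.
  by rewrite enormE ipnorm_ge0.
exact: le_trans (coord_le_enorm _ _) hv.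
Qed.

Lemma mxopnormP A v : enorm (A *m v) <= mxopnorm A * enorm v.
Proof.
have [v0|v0] := eqVneq (enorm v) 0.
  have -> : v = 0.
    apply: dot_def; have := sqr_ipnorm dot_ip v; rewrite -enormE v0 expr0n /= => <-.
    by [].
  by rewrite mulmx0 enormE ipnorm0 mulr0.
have vp : 0 < enorm v by rewrite lt_neqAle eq_sym v0 enormE ipnorm_ge0.
rewrite -ler_pdivrMr //; apply: ub_le_sup; first by have [] := mxopnorm_has_sup A.
exists ((enorm v)^-1 *: v) => /=.
  by rewrite enormE ipnormZ -enormE ger0_norm ?mulVf // invr_ge0 ltW.
by rewrite -scalemxAr enormE ipnormZ -!enormE ger0_norm ?invr_ge0 ?(ltW vp) // mulrC.
Qed.

Lemma mxopnorm_ge0 A : 0 <= mxopnorm A.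
Proof.
apply: le_trans (_ : enorm (A *m 0) <= _); first by rewrite enormE ipnorm_ge0.
apply: ub_le_sup; first by have [] := mxopnorm_has_sup A.
by exists 0 => //=; rewrite enormE ipnorm0.
Qed.

Lemma mxopnorm_le A c : 0 <= c -> (forall v, enorm (A *m v) <= c * enorm v) ->
  mxopnorm A <= c.
Proof.
move=> c0 h; apply: ge_sup; first by have [] := mxopnorm_has_sup A.
by move=> _ [v /= hv <-]; apply: le_trans (h v) _; rewrite ler_piMr.
Qed.

Lemma mxopnormM A B : mxopnorm (A *m B) <= mxopnorm A * mxopnorm B.
Proof.
apply: mxopnorm_le => [|v]; first by rewrite mulr_ge0 ?mxopnorm_ge0.
rewrite -mulmxA; apply: le_trans (mxopnormP _ _) _.
by rewrite -mulrA ler_wpM2l ?mxopnorm_ge0 // mxopnormP.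
Qed.

Lemma mxopnormD A B : mxopnorm (A + B) <= mxopnorm A + mxopnorm B.
Proof.
apply: mxopnorm_le => [|v]; first by rewrite addr_ge0 ?mxopnorm_ge0.
rewrite mulmxDl mulrDl enormE; apply: le_trans (ipnormD _ _ _) _.
by rewrite -!enormE; apply: lerD; exact: mxopnormP.
Qed.

Lemma mxopnormZ c A : mxopnorm (c *: A) <= `|c| * mxopnorm A.
Proof.
apply: mxopnorm_le => [|v]; first by rewrite mulr_ge0 ?mxopnorm_ge0.
rewrite -scalemxAl enormE ipnormZ -!enormE -mulrA ler_wpM2l //; exact: mxopnormP.
Qed.

Lemma enorm_delta_mx (j : 'I_k) : enorm (delta_mx j 0 : 'cV[R]_k) = 1.
Proof.
rewrite /enorm (bigD1 j) //= big1 => [|s hs]; first by rewrite mxE !eqxx addr0 expr1n sqrtr1.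
by rewrite mxE (negbTE hs) expr0n.
Qed.

Lemma entry_le_mxopnorm A i j : `|A i j| <= mxopnorm A.
Proof.
have -> : A i j = (A *m delta_mx j 0 : 'cV_k) i 0 by rewrite -colE mxE.
apply: le_trans (coord_le_enorm _ _) _; apply: le_trans (mxopnormP _ _) _.
by rewrite enorm_delta_mx mulr1.
Qed.

End dot.

Lemma unitmx_inj (R : realType) (k : nat) (A : 'M[R]_k) :
  (forall v : 'cV[R]_k, A *m v = 0 -> v = 0) -> A \in unitmx.
Proof.
move=> h; rewrite -unitmx_tr -row_free_unit -kermx_eq0; apply/eqP/trmx_inj/matrixP => i j.
rewrite trmx0 [RHS]mxE.
have h0 : A *m (kermx A^T)^T = 0 by rewrite -{1}[A]trmxK -trmx_mul mulmx_ker trmx0.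
have := h (col j (kermx A^T)^T); rewrite {1}colE mulmxA h0 mul0mx => /(_ erefl) /colP /(_ i).
by rewrite mxE [RHS]mxE.
Qed.

Lemma cvg_sum_real (R : realType) (I : Type) (r : seq I) (f : I -> nat -> R) (l : I -> R) :
  (forall i, f i p @[p --> \oo] --> l i) ->
  \sum_(i <- r) f i p @[p --> \oo] --> \sum_(i <- r) l i.
Proof.
move=> h; elim: r => [|i r IH].
  by rewrite big_nil; under eq_fun do rewrite big_nil; exact: cvg_cst.
rewrite big_cons; under eq_fun do rewrite big_cons.
by apply: cvgD => //; exact: h.
Qed.

(** * Square roots of positive definite matrices *)

Section psd_sqrt.
Variables (R : realType) (k : nat).

(* [Y = (X + Y^2) / 2] means [(1 - Y)^2 = 1 - X]; the map contracts the ball of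
   radius [q] for the operator norm. *)
Lemma mxsqrt_one_sub (X : 'M[R]_k) q : 0 <= q -> q < 1 -> X^T = X ->
  mxopnorm X <= q ->
  exists Y : 'M[R]_k, [/\ Y^T = Y, mxopnorm Y <= q & (1%:M - Y) *m (1%:M - Y) = 1%:M - X].
Proof.
move=> q0 q1 Xt hX.
pose f (Y : 'M[R]_k) := 2^-1 *: (X + Y *m Y).
pose Y i := iter i f 0.
have hY i : (Y i)^T = Y i /\ mxopnorm (Y i) <= q.
  elim: i => [|i [IH1 IH2]] /=.
    rewrite trmx0; split => //; apply: mxopnorm_le => // v.
    by rewrite mul0mx enormE ipnorm0 mulr_ge0 // enormE ipnorm_ge0.
  rewrite /f; split.
    by rewrite linearZ linearD /= trmx_mul IH1 Xt.
  apply: le_trans (mxopnormZ _ _) _; rewrite ger0_norm ?invr_ge0 // ler_pdivrMl //.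
  apply: le_trans (mxopnormD _ _) _.
  have h := mxopnormM (Y i) (Y i).
  have h2 : mxopnorm (Y i) * mxopnorm (Y i) <= q * 1.
    by apply: ler_pM; rewrite ?mxopnorm_ge0 // (le_trans IH2) // ltW.
  by rewrite mulr1 in h2; lra.
have hd i : mxopnorm (Y i.+1 - Y i) <= mxopnorm X * q ^+ i.
  elim: i => [|i IH].
    rewrite expr0 mulr1 /= subr0 /f mulmx0 addr0.
    apply: le_trans (mxopnormZ _ _) _; rewrite ger0_norm ?invr_ge0 // ler_pdivrMl //.
    by have := mxopnorm_ge0 X; lra.
  have -> : Y i.+2 - Y i.+1 = 2^-1 *: (Y i.+1 *m (Y i.+1 - Y i) + (Y i.+1 - Y i) *m Y i).
    rewrite [Y i.+2]/(f (Y i.+1)) [X in _ - X]/(f (Y i)) /f -scalerBr; congr (_ *: _).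
    by rewrite mulmxBr mulmxBl addrA subrK opprD addrACA subrr add0r.
  apply: le_trans (mxopnormZ _ _) _; rewrite ger0_norm ?invr_ge0 // ler_pdivrMl //.
  apply: le_trans (mxopnormD _ _) _.
  have h1 : mxopnorm (Y i.+1 *m (Y i.+1 - Y i)) <= q * (mxopnorm X * q ^+ i).
    apply: le_trans (mxopnormM _ _) _.
    by apply: ler_pM; rewrite ?mxopnorm_ge0 //; exact: (hY i.+1).2.
  have h2 : mxopnorm ((Y i.+1 - Y i) *m Y i) <= q * (mxopnorm X * q ^+ i).
    apply: le_trans (mxopnormM _ _) _; rewrite mulrC.
    by apply: ler_pM; rewrite ?mxopnorm_ge0 //; exact: (hY i).2.
  by rewrite exprS mulrCA; lra.
(* The limit is taken entry by entry. Symmetry, the norm bound (tested on each vector) and the fixed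
   point equation are closed conditions and pass to it. *)
have lim i j : exists l, forall p, `|Y p i j - l| <= mxopnorm X * q ^+ p / (1 - q).
  apply: geometric_cauchy_real => // p.
  apply: le_trans (hd p); apply: le_trans (entry_le_mxopnorm _ i j).
  by rewrite !mxE.
have [L hL] := choice (fun ij : 'I_k * 'I_k => lim ij.1 ij.2).
pose Z : 'M[R]_k := \matrix_(i, j) L (i, j).
have hZ i j : Y p i j @[p --> \oo] --> Z i j.
  rewrite mxE; apply/cvgrPdist_le => e e0.
  have [N hN] := cvg_geometric_eps (mxopnorm X / (1 - q)) q0 q1 e0.
  exists N => // p /= hp; rewrite distrC; apply: le_trans (hL (i, j) p) _.
  apply: le_trans (ltW hN); rewrite mulrAC ler_wpM2l //.
    by rewrite divr_ge0 ?mxopnorm_ge0 // subr_ge0 ltW.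
  by apply: ler_wiXn2l; rewrite // ltW.
exists Z; split.
- apply/matrixP => i j; rewrite mxE; apply: cvg_unique (hZ j i) _ => //.
  have -> : (fun p => Y p j i) = (fun p => Y p i j).
    by apply/funext => p; rewrite -[in RHS](hY p).1 mxE.
  exact: hZ.
- apply: mxopnorm_le => // v; rewrite -(@ler_pXn2r _ 2) ?nnegrE ?mulr_ge0 ?enormE ?ipnorm_ge0 //.
  rewrite [leLHS]sqr_ipnorm /= dotE.
  have h : \sum_i (Y p *m v) i 0 * (Y p *m v) i 0 @[p --> \oo] -->
           \sum_i (Z *m v) i 0 * (Z *m v) i 0.
    apply: (@cvg_sum_real R _ _ (fun i p => (Y p *m v) i 0 * (Y p *m v) i 0)) => i.
    have h : (Y p *m v) i 0 @[p --> \oo] --> (Z *m v) i 0.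
      rewrite [X in _ --> X]mxE; under eq_fun do rewrite mxE.
      apply: (@cvg_sum_real R _ _ (fun j p => Y p i j * v j 0)) => j.
      by apply: cvgMr_tmp; exact: hZ.
    exact: cvgM.
  apply: (@cvgr_to_le _ _ _ _ _ _ _ h) => //; apply: nearW => p.
  rewrite -dotE -[dot _ _]/(dot_ip R k _ _) -sqr_ipnorm -!enormE.
  rewrite lerXn2r ?nnegrE ?mulr_ge0 ?enormE ?ipnorm_ge0 // -!enormE.
  apply: le_trans (mxopnormP _ _) _; rewrite ler_wpM2r ?enormE ?ipnorm_ge0 //.
  exact: (hY p).2.
- have e : Z = f Z.
    apply/matrixP => i j; suff h : Y p i j @[p --> \oo] --> f Z i j.
      by apply: cvg_unique (hZ i j) h.
    rewrite -(cvg_shiftS (fun p => Y p i j)) /=.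
    have fE (W : 'M[R]_k) : f W i j = 2^-1 * (X i j + \sum_l W i l * W l j).
      by rewrite /f !mxE.
    rewrite fE; under eq_fun do rewrite fE.
    apply: cvgMl_tmp; apply: cvgD; first exact: cvg_cst.
    apply: (@cvg_sum_real R _ _ (fun l p => Y p i l * Y p l j)) => l.
    by apply: cvgM; exact: hZ.
  have {}e : 2 *: Z = X + Z *m Z by rewrite {1}e /f scalerA mulfV // scale1r.
  have ZZ : Z + Z = X + Z *m Z by rewrite -e scaler_nat mulr2n.
  rewrite mulmxBl mul1mx mulmxBr mulmx1 opprB addrACA -opprD ZZ opprD addrACA.
  by rewrite subrr addr0.
Qed.

(** Divided by [nG], the matrix becomes [1 - X] with [0 <= X <= q < 1] as quadratic forms, the
    situation of [mxsqrt_one_sub]. The value [q = 1 - (nG nI)^-2] comes from [|v| <= nI |G v|] and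
    [|G v|^2 <= nG <v, G v>]. As [mxsqrt] is chosen by [xget], everything follows from the existence
    of one root. *)
Lemma posdef_mxsqrt (G : 'M[R]_k) : G^T = G -> (forall v, 0 <= form_mx G v v) ->
  G \in unitmx ->
  [/\ (mxsqrt G)^T = mxsqrt G, mxsqrt G *m mxsqrt G = G & mxsqrt G \in unitmx].
Proof.
move=> Gt G0 Gu.
suff [S hS] : exists S : 'M[R]_k, [/\ S^T = S, forall v : 'cV[R]_k,
    0 <= (v^T *m S *m v) 0 0 & S *m S = G].
  have [h1 _ h2] := @xgetPex _ 0 [set S : 'M[R]_k | [/\ S^T = S,
    forall v : 'cV[R]_k, 0 <= (v^T *m S *m v) 0 0 & S *m S = G]] (ex_intro _ S hS).
  have h3 : mxsqrt G *m mxsqrt G = G := h2.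
  split => //; have : mxsqrt G *m mxsqrt G \in unitmx by rewrite h3.
  by rewrite !unitmxE det_mulmx unitrM => /andP[].
have [g hg] := form_mx_axioms Gt G0.
(* The added 1 makes both constants at least 1, in dimension 0 as well. *)
pose nG := mxopnorm G + 1; pose nI := mxopnorm (invmx G) + 1.
have nG0 : 0 < nG by rewrite ltr_wpDl ?mxopnorm_ge0.
have nI0 : 0 < nI by rewrite ltr_wpDl ?mxopnorm_ge0.
have nI1 : 1 <= nI by rewrite lerDr mxopnorm_ge0.
have nGP v : enorm (G *m v) <= nG * enorm v.
  apply: le_trans (mxopnormP _ _) _.
  by rewrite ler_wpM2r ?enormE ?ipnorm_ge0 // lerDl.
have nIP v : enorm v <= nI * enorm (G *m v).
  rewrite -{1}[v](mulKmx Gu); apply: le_trans (mxopnormP _ _) _.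
  by rewrite ler_wpM2r ?enormE ?ipnorm_ge0 // lerDl.
have upper v : form_mx G v v <= nG * enorm v ^+ 2.
  rewrite form_mxE; apply: le_trans (ler_norm _) _.
  apply: le_trans (ip_cauchy_schwarz (dot_ip R k) _ _) _; rewrite -!enormE.
  by rewrite expr2 mulrCA ler_wpM2l ?enormE ?ipnorm_ge0 // -!enormE.
have lower v : enorm (G *m v) ^+ 2 <= nG * form_mx G v v.
  have [z|z] := eqVneq (enorm (G *m v)) 0.
    by rewrite z expr0n mulr_ge0 // ltW.
  have zp : 0 < enorm (G *m v) by rewrite lt_neqAle eq_sym z enormE ipnorm_ge0.
  (* Cauchy-Schwarz for the form of [G] at [v] and [G v], whose product in this form is
     [|G v|^2]. *)
  have : enorm (G *m v) ^+ 2 ^+ 2 <= form_mx G v v * form_mx G (G *m v) (G *m v).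
    rewrite enormE sqr_ipnorm /= [dot _ _]dot_trmx dotC Gt -form_mxE.
    rewrite -!hg -!sqr_ipnorm -exprMn -[X in X <= _]ger0_norm ?sqr_ge0 // normrX.
    rewrite lerXn2r ?nnegrE ?mulr_ge0 ?ipnorm_ge0 //; exact: ip_cauchy_schwarz.
  have := upper (G *m v); set x := enorm _; set y := form_mx G v v => h1 h2.
  have {h1}h2 : x ^+ 2 ^+ 2 <= y * (nG * x ^+ 2).
    by apply: le_trans h2 _; rewrite ler_wpM2l // G0.
  by move: h2; rewrite expr2 mulrA ler_pM2r ?exprn_gt0 // mulrC.
pose c := nG^-1; pose q := 1 - (nG * nI) ^- 2.
have q1 : q < 1 by rewrite gtrBl invr_gt0 exprn_gt0 // mulr_gt0.
pose X := 1%:M - c *: G.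
have Xt : X^T = X by rewrite linearB /= trmx1 linearZ /= Gt.
have XE v : form_mx X v v = enorm v ^+ 2 - c * form_mx G v v.
  rewrite /X !form_mxE mulmxBl mul1mx -scalemxAl enormE sqr_ipnorm.
  by rewrite -![dot _ _]/(dot_ip R k _ _) ipBr ipZr.
have X0 v : 0 <= form_mx X v v.
  by rewrite XE subr_ge0 /c ler_pdivrMl.
have Xq v : form_mx X v v <= q * enorm v ^+ 2.
  rewrite XE /q mulrBl mul1r lerD2l lerN2 -exprVn -exprMn invfM.
  have -> : c * form_mx G v v = nG^-1 ^+ 2 * (nG * form_mx G v v).
    by rewrite /c expr2 -mulrA mulKf // gt_eqF.
  rewrite -mulrA exprMn ler_wpM2l ?sqr_ge0 //.
  apply: le_trans (lower v); rewrite lerXn2r ?nnegrE ?mulr_ge0 ?invr_ge0 ?(ltW nI0) ?enormE ?ipnorm_ge0 //.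
  by rewrite -!enormE ler_pdivrMl.
have [x hx] := form_mx_axioms Xt X0.
have [k0|k0] := boolP [forall v : 'I_k, false].
  have e (A B : 'M[R]_k) : A = B.
    by apply/matrixP => i; have := forallP k0 i.
  exists 0; split; [exact: e| |exact: e].
  by move=> v; rewrite mulmx0 mul0mx mxE.
have q0 : 0 <= q.
  rewrite /q subr_ge0 invf_le1 ?exprn_gt0 ?mulr_gt0 //; apply: exprn_ege1.
  by apply: mulr_ege1 => //; rewrite lerDr mxopnorm_ge0.
have hX : mxopnorm X <= q.
  apply: mxopnorm_le => // v.
  have [z|z] := eqVneq (enorm (X *m v)) 0.
    by rewrite z mulr_ge0 // enormE ipnorm_ge0.
  have zp : 0 < enorm (X *m v) by rewrite lt_neqAle eq_sym z enormE ipnorm_ge0.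
  (* The same device for [X] turns the bound on its quadratic form into a bound on its operator
     norm. *)
  have : enorm (X *m v) ^+ 2 ^+ 2 <= form_mx X v v * form_mx X (X *m v) (X *m v).
    rewrite enormE sqr_ipnorm /= [dot _ _]dot_trmx dotC Xt -form_mxE.
    rewrite -!hx -!sqr_ipnorm -exprMn -[X in X <= _]ger0_norm ?sqr_ge0 // normrX.
    rewrite lerXn2r ?nnegrE ?mulr_ge0 ?ipnorm_ge0 //; exact: ip_cauchy_schwarz.
  have := Xq (X *m v); have := Xq v.
  set s := enorm (X *m v); set y := form_mx X v v; set z' := form_mx _ _ _ => h1 h2 h3.
  have {h3} : s ^+ 2 ^+ 2 <= q * enorm v ^+ 2 * (q * s ^+ 2).
    by apply: le_trans h3 _; apply: ler_pM => //; exact: X0.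
  have -> : q * enorm v ^+ 2 * (q * s ^+ 2) = (q * enorm v) ^+ 2 * s ^+ 2 by ring.
  rewrite [X in X <= _]expr2 ler_pM2r ?exprn_gt0 //.
  by rewrite ler_pXn2r ?nnegrE ?mulr_ge0 // ?enormE ?ipnorm_ge0 // ltW.
have [Y [Yt hY eY]] := mxsqrt_one_sub q0 q1 Xt hX.
have sq : Num.sqrt nG ^+ 2 = nG by rewrite sqr_sqrtr // ltW.
exists (Num.sqrt nG *: (1%:M - Y)); split.
- by rewrite linearZ linearB /= trmx1 Yt.
- move=> v; rewrite -scalemxAr -scalemxAl mxE mulr_ge0 ?sqrtr_ge0 //.
  rewrite -[X in 0 <= X]/(form_mx _ _ _) form_mxE mulmxBl mul1mx.
  rewrite -[dot _ _]/(dot_ip R k _ _) ipBr subr_ge0 -sqr_ipnorm.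
  apply: le_trans (ler_norm _) _; apply: le_trans (ip_cauchy_schwarz _ _ _) _.
  rewrite expr2 ler_wpM2l ?ipnorm_ge0 // -!enormE.
  apply: le_trans (mxopnormP _ _) _; rewrite ler_piMl ?enormE ?ipnorm_ge0 //.
  exact: le_trans hY (ltW q1).
- rewrite -scalemxAr -scalemxAl scalerA -expr2 sq eY /X opprB addrCA subrr addr0.
  by rewrite scalerA /c mulfV ?gt_eqF // scale1r.
Qed.

End psd_sqrt.

(** * The Hilbert space of classes of square integrable functions *)

Lemma abse_EFin_pow2 (R : realType) (a : R) : (`|a%:E| `^ 2%R)%E = (a ^+ 2)%:E.
Proof. by rewrite abse_EFin poweR_EFin powR_mulrn // real_normK ?num_real. Qed.

Section aeeq_theory.
Context {d : measure_display} {T : measurableType d} {R : realType}.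
Variable Q : {measure set T -> \bar R}.
Implicit Types (f g h : T -> R).

Lemma aeeq_refl f : aeeq Q f f.
Proof. exact: nearW. Qed.

Lemma aeeq_sym f g : aeeq Q f g -> aeeq Q g f.
Proof. by apply: filterS => x ->. Qed.

Lemma aeeq_trans g f h : aeeq Q f g -> aeeq Q g h -> aeeq Q f h.
Proof. by apply: filterS2 => x -> ->. Qed.

Lemma L2_measurable f : L2 Q f -> measurable_fun setT f.
Proof. by move=> /andP[]; rewrite inE. Qed.

Lemma L2_sqr_integrable f : L2 Q f -> Q.-integrable setT (fun x => (f x ^+ 2)%:E).
Proof. exact: Lfun2_integrable_sqr. Qed.

Lemma L2P f : measurable_fun setT f -> (\int[Q]_x (f x ^+ 2)%:E < +oo)%E -> L2 Q f.
Proof.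
move=> mf h; apply/andP; split; rewrite inE //=.
rewrite /finite_norm unlock; apply: poweR_lty.
by under eq_integral => x _ do rewrite abse_EFin_pow2.
Qed.

Lemma L2_cst0 : L2 Q (cst 0).
Proof.
apply: L2P => //; under eq_integral do rewrite /= expr0n.
by rewrite integral0.
Qed.

Lemma L2_le f g : measurable_fun setT f -> L2 Q g -> (forall x, `|f x| <= `|g x|) ->
  L2 Q f.
Proof.
move=> mf hg fg; apply: L2P => //.
have /integrableP[_] := L2_sqr_integrable hg; apply: le_lt_trans.
apply: ge0_le_integral => //.
- by move=> x _; rewrite lee_fin sqr_ge0.
- by apply/measurable_EFinP; exact: measurable_funX.
- by apply: measurableT_comp => //; apply/measurable_EFinP; apply: measurable_funX; exact: L2_measurable.
- move=> x _ /=; rewrite lee_fin [leRHS]ger0_norm ?sqr_ge0 // -(real_normK (num_real (f x))).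
  by rewrite -(real_normK (num_real (g x))) lerXn2r ?nnegrE.
Qed.

Lemma L2_addP f g : L2 Q f -> L2 Q g -> L2 Q (f \+ g).
Proof. by move=> hf hg; exact: (Lfun_addr_closed Q (lee1n 2)).2. Qed.

Lemma L2_oppP f : L2 Q f -> L2 Q (\- f).
Proof. by move=> hf; exact: (Lfun_oppr_closed (mu := Q) (p := 2%:E)). Qed.

Lemma L2_subP f g : L2 Q f -> L2 Q g -> L2 Q (f \- g).
Proof. by move=> hf hg; apply: L2_addP hf (L2_oppP hg). Qed.

Lemma L2_scaleP a f : L2 Q f -> L2 Q (fun x => a * f x).
Proof. move=> hf; rewrite (_ : (fun x => _) = a \o* f); last by apply/funext => x /=; rewrite mulrC.
by apply: Lfun_scale => //; rewrite ler1n. Qed.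

Lemma L2_normP f : L2 Q f -> L2 Q (fun x => `|f x|).
Proof.
move=> hf; apply: (L2_le _ hf) => [|x]; last by rewrite normr_id.
by apply: measurableT_comp => //; exact: L2_measurable.
Qed.

Lemma L2_sumP (I : Type) (r : seq I) (F : I -> T -> R) : (forall i, L2 Q (F i)) ->
  L2 Q (fun x => \sum_(i <- r) F i x).
Proof.
move=> hF; elim: r => [|i r IH].
  have -> : (fun x => \sum_(i <- [::]) F i x) = cst 0 by apply/funext => x; rewrite big_nil.
  exact: L2_cst0.
rewrite (_ : (fun x => _) = F i \+ (fun x => \sum_(i <- r) F i x)); last first.
  by apply/funext => x; rewrite big_cons.
exact: L2_addP.
Qed.

Lemma L2_mul_integrable f g : L2 Q f -> L2 Q g ->
  Q.-integrable setT (fun x => (f x * g x)%:E).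
Proof. by move=> hf hg; apply/Lfun1_integrable; exact: Lfun2_mul_Lfun1. Qed.

Lemma L2norm_sqrt f : L2 Q f -> L2norm Q f = (Num.sqrt (inner Q f f))%:E.
Proof.
move=> hf; rewrite /L2norm unlock.
have -> : (\int[Q]_x `|(EFin \o f) x| `^ 2)%E = (inner Q f f)%:E.
  rewrite /inner /Rintegral fineK; last first.
    by apply: integrable_fin_num => //; exact: L2_mul_integrable.
  by apply: eq_integral => x _; rewrite abse_EFin_pow2 expr2.
rewrite poweR_EFin powR12_sqrt //.
by apply: Rintegral_ge0 => x _; rewrite -expr2 sqr_ge0.
Qed.

Lemma inner_ae f f' g g' : L2 Q f -> L2 Q g -> L2 Q f' -> L2 Q g' ->
  aeeq Q f f' -> aeeq Q g g' -> inner Q f g = inner Q f' g'.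
Proof.
move=> hf hg hf' hg' ff' gg'; congr fine; apply: ae_eq_integral => //.
- by have /integrableP[] := L2_mul_integrable hf hg.
- by have /integrableP[] := L2_mul_integrable hf' hg'.
- by apply: filterS2 ff' gg' => x -> ->.
Qed.

Lemma innerC f g : inner Q f g = inner Q g f.
Proof. by apply: eq_Rintegral => x _; rewrite mulrC. Qed.

Lemma innerDl f g h : L2 Q f -> L2 Q g -> L2 Q h ->
  inner Q (f \+ g) h = inner Q f h + inner Q g h.
Proof.
move=> hf hg hh; rewrite /inner -RintegralD //; try exact: L2_mul_integrable.
by apply: eq_Rintegral => x _; rewrite mulrDl.
Qed.

Lemma innerZl a f g : L2 Q f -> L2 Q g ->
  inner Q (fun x => a * f x) g = a * inner Q f g.
Proof.
move=> hf hg; rewrite /inner -RintegralZl //; last exact: L2_mul_integrable.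
by apply: eq_Rintegral => x _; rewrite mulrA.
Qed.

Lemma inner_ge0 f : 0 <= inner Q f f.
Proof. by apply: Rintegral_ge0 => x _; rewrite -expr2 sqr_ge0. Qed.

Lemma inner_def f : L2 Q f -> inner Q f f = 0 -> aeeq Q f (cst 0).
Proof.
move=> hf h0.
have mf2 : measurable_fun setT (fun x => (f x ^+ 2)%:E).
  by have /integrableP[] := L2_sqr_integrable hf.
have /(ae_eq_integral_abs Q measurableT mf2) : (\int[Q]_x `|(f x ^+ 2)%:E| = 0)%E.
  transitivity (\int[Q]_x (f x * f x)%:E)%E.
    by apply: eq_integral => x _; rewrite /= ger0_norm ?sqr_ge0 // expr2.
  rewrite -[LHS]fineK; first by rewrite -[fine _]/(inner Q f f) h0.
  by apply: integrable_fin_num => //; exact: L2_mul_integrable.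
by apply: filterS => x /(_ I) /= [] /eqP; rewrite sqrf_eq0 => /eqP.
Qed.

(* A canonical representative of each class, so that equality of classes is
   Leibniz equality. *)
Definition canonical_rep f : T -> R := xget (cst 0) [set g | L2 Q g /\ aeeq Q g f].

Record L2class := MkL2class {
  L2rep :> T -> R;
  L2rep_canonical : L2 Q L2rep /\ canonical_rep L2rep = L2rep }.

HB.instance Definition _ := gen_eqMixin L2class.
HB.instance Definition _ := gen_choiceMixin L2class.

Lemma canonical_repP f : L2 Q f -> L2 Q (canonical_rep f) /\ aeeq Q (canonical_rep f) f.
Proof.
by move=> hf; apply: (@xgetPex _ (cst 0) [set g | L2 Q g /\ aeeq Q g f]); exists f; split => //; exact: aeeq_refl.
Qed.

Lemma eq_canonical_rep f g : aeeq Q f g -> canonical_rep f = canonical_rep g.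
Proof.
move=> fg; congr xget; apply/seteqP; split=> h [hh hf]; split => //.
  exact: aeeq_trans fg.
exact: aeeq_trans (aeeq_sym fg).
Qed.

(** The implication sits inside the existential so that [cls] is total: a function outside [L^2]
    gets an arbitrary class, and each use of [clsP] has to supply membership. *)
Lemma L2class_exists f : exists u : L2class, L2 Q f -> aeeq Q u f.
Proof.
suff H g : L2 Q g -> exists u : L2class, L2 Q g -> aeeq Q u g.
  have [hf|nf] := pselect (L2 Q f); first exact: H.
  by have [u _] := H _ L2_cst0; exists u.
move=> hg; have [h1 h2] := canonical_repP hg.
by exists (@MkL2class (canonical_rep g) (conj h1 (eq_canonical_rep h2))).
Qed.

Definition cls f : L2class := projT1 (cid (L2class_exists f)).

Lemma clsP f : L2 Q f -> aeeq Q (cls f) f.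
Proof. by rewrite /cls; case: cid. Qed.

Lemma L2class_L2 (u : L2class) : L2 Q u.
Proof. by have [] := L2rep_canonical u. Qed.
Hint Resolve L2class_L2 : core.

Lemma L2class_inj (u v : L2class) : aeeq Q u v -> u = v.
Proof.
move=> /eq_canonical_rep; have [_ ->] := L2rep_canonical u; have [_ ->] := L2rep_canonical v.
case: u v => [f hf] [g hg] /= fg; move: hf hg; rewrite fg => hf hg.
by congr MkL2class; exact: Prop_irrelevance.
Qed.

Lemma cls_eq f g : L2 Q f -> L2 Q g -> aeeq Q f g -> cls f = cls g.
Proof.
move=> hf hg fg; apply: L2class_inj.
exact: aeeq_trans (clsP hf) (aeeq_trans fg (aeeq_sym (clsP hg))).
Qed.

Lemma cls_rep (u : L2class) : cls u = u.
Proof. by apply: L2class_inj; exact: clsP. Qed.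

Let add (u v : L2class) := cls (u \+ v).
Let opp (u : L2class) := cls (\- u).
Let zero := cls (cst 0).
Let scale (a : R) (u : L2class) := cls (fun x => a * u x).

Let addE u v : aeeq Q (add u v) (u \+ v).
Proof. by apply: clsP; exact: L2_addP. Qed.
Let oppE u : aeeq Q (opp u) (\- u).
Proof. by apply: clsP; exact: L2_oppP. Qed.
Let zeroE : aeeq Q zero (cst 0).
Proof. by apply: clsP; exact: L2_cst0. Qed.
Let scaleE a u : aeeq Q (scale a u) (fun x => a * u x).
Proof. by apply: clsP; exact: L2_scaleP. Qed.

Let addA : associative add.
Proof.
move=> u v w; apply: L2class_inj.
near=> x; have -> : add u (add v w) x = u x + (v x + w x).
  rewrite (near (addE u (add v w)) x) //= (near (addE v w) x) //.
have -> : add (add u v) w x = (u x + v x) + w x.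
  by rewrite (near (addE (add u v) w) x) //= (near (addE u v) x).
by rewrite addrA.
Unshelve. all: by end_near.
Qed.

Let addC : commutative add.
Proof.
move=> u v; apply: L2class_inj; apply: filterS2 (addE u v) (addE v u) => x -> ->.
by rewrite /= addrC.
Qed.

Let add0 : left_id zero add.
Proof.
move=> u; apply: L2class_inj; apply: filterS2 (addE zero u) zeroE => x -> /= ->.
by rewrite add0r.
Qed.

Let addN : left_inverse zero opp add.
Proof.
move=> u; apply: L2class_inj; apply: filterS3 (addE (opp u) u) (oppE u) zeroE => x -> /= -> ->.
by rewrite addNr.
Qed.

HB.instance Definition _ := GRing.isZmodule.Build L2class addA addC add0 addN.

Let scaleA a b u : scale a (scale b u) = scale (a * b) u.
Proof.
apply: L2class_inj; apply: filterS3 (scaleE a (scale b u)) (scaleE b u) (scaleE (a * b) u).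
by move=> x -> /= -> ->; rewrite mulrA.
Qed.

Let scale1 : left_id 1 scale.
Proof.
by move=> u; apply: L2class_inj; apply: filterS (scaleE 1 u) => x ->; rewrite mul1r.
Qed.


Let scaleDr : right_distributive scale +%R.
Proof.
move=> a u v; apply: L2class_inj; near=> x.
have -> : scale a (u + v) x = a * (u x + v x).
  by rewrite (near (scaleE a (u + v)) x) //= (near (addE u v) x).
have -> : (scale a u + scale a v) x = a * u x + a * v x.
  rewrite (near (addE (scale a u) (scale a v)) x) //=.
  by rewrite (near (scaleE a u) x) //= (near (scaleE a v) x).
by rewrite mulrDr.
Unshelve. all: by end_near.
Qed.

Let scaleDl u : {morph scale^~ u : a b / a + b}.
Proof.
move=> a b; apply: L2class_inj; near=> x.
rewrite /= (near (scaleE (a + b) u) x) //=.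
have -> : (scale a u + scale b u) x = a * u x + b * u x.
  rewrite (near (addE (scale a u) (scale b u)) x) //=.
  by rewrite (near (scaleE a u) x) //= (near (scaleE b u) x).
by rewrite mulrDl.
Unshelve. all: by end_near.
Qed.

HB.instance Definition _ :=
  GRing.Zmodule_isLmodule.Build R L2class scaleA scale1 scaleDr scaleDl.

Lemma L2class_addE (u v : L2class) : aeeq Q (u + v) (u \+ v).
Proof. exact: addE. Qed.

Lemma L2class_oppE (u : L2class) : aeeq Q (- u) (\- u).
Proof. exact: oppE. Qed.

Lemma L2class_subE (u v : L2class) : aeeq Q (u - v) (u \- v).
Proof. by apply: filterS2 (addE u (- v)) (oppE v) => x -> /= ->. Qed.

Lemma L2class_0E : aeeq Q (0 : L2class) (cst 0).
Proof. exact: zeroE. Qed.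

Lemma L2class_scaleE a (u : L2class) : aeeq Q (a *: u) (fun x => a * u x).
Proof. exact: scaleE. Qed.

Lemma clsD f g : L2 Q f -> L2 Q g -> cls (f \+ g) = cls f + cls g.
Proof.
move=> hf hg; apply: L2class_inj; near=> x.
rewrite (near (clsP (L2_addP hf hg)) x) //= (near (L2class_addE (cls f) (cls g)) x) //=.
by rewrite (near (clsP hf) x) //= (near (clsP hg) x).
Unshelve. all: by end_near.
Qed.

Lemma clsZ a f : L2 Q f -> cls (fun x => a * f x) = a *: cls f.
Proof.
move=> hf; apply: L2class_inj; near=> x.
rewrite (near (clsP (L2_scaleP a hf)) x) //= (near (L2class_scaleE a (cls f)) x) //=.
by rewrite (near (clsP hf) x).
Unshelve. all: by end_near.
Qed.

Lemma cls0 : cls (cst 0) = 0.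
Proof. by apply: L2class_inj; apply: aeeq_trans (clsP L2_cst0) (aeeq_sym L2class_0E). Qed.

Lemma clsN f : L2 Q f -> cls (\- f) = - cls f.
Proof.
move=> hf; apply: L2class_inj; near=> x.
rewrite (near (clsP (L2_oppP hf)) x) //= (near (L2class_oppE (cls f)) x) //=.
by rewrite (near (clsP hf) x).
Unshelve. all: by end_near.
Qed.

Lemma clsB f g : L2 Q f -> L2 Q g -> cls (f \- g) = cls f - cls g.
Proof. by move=> hf hg; rewrite -clsN // -clsD //; exact: L2_oppP. Qed.

Lemma cls_sum (I : Type) (r : seq I) (F : I -> T -> R) : (forall i, L2 Q (F i)) ->
  cls (fun x => \sum_(i <- r) F i x) = \sum_(i <- r) cls (F i).
Proof.
move=> hF; elim: r => [|i r IH].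
  rewrite big_nil; apply: L2class_inj.
  have -> : (fun x => \sum_(i <- [::]) F i x) = cst 0 by apply/funext => x; rewrite big_nil.
  exact: aeeq_trans (clsP L2_cst0) (aeeq_sym L2class_0E).
rewrite big_cons -IH -clsD //; last exact: L2_sumP.
by congr cls; apply/funext => x; rewrite big_cons.
Qed.

Let ip_fun (u v : L2class) : R := inner Q u v.

Let ip_funC u v : ip_fun u v = ip_fun v u.
Proof. exact: innerC. Qed.

Let ip_funD u v w : ip_fun (u + v) w = ip_fun u w + ip_fun v w.
Proof.
rewrite -innerDl //; apply: inner_ae => //; first exact: L2_addP.
exact: aeeq_refl.
Qed.

Let ip_funZ a u v : ip_fun (a *: u) v = a * ip_fun u v.
Proof.
rewrite -innerZl //; apply: inner_ae => //; first exact: L2_scaleP.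
exact: aeeq_refl.
Qed.

Definition L2ip : semi_ip L2class :=
  SemiIp ip_funC ip_funD ip_funZ (fun u => inner_ge0 u).

Lemma L2ip_cls f g : L2 Q f -> L2 Q g -> L2ip (cls f) (cls g) = inner Q f g.
Proof. by move=> hf hg; apply: inner_ae => //; exact: clsP. Qed.

Lemma L2ip_def (u : L2class) : ipnorm L2ip u = 0 -> u = 0.
Proof.
move=> h; apply: L2class_inj; apply: aeeq_trans (aeeq_sym L2class_0E).
by apply: inner_def => //; rewrite -[inner _ _ _]/(L2ip u u) -sqr_ipnorm h expr0n.
Qed.

Lemma L2norm_cls f : L2 Q f -> L2norm Q f = (ipnorm L2ip (cls f))%:E.
Proof. by move=> hf; rewrite L2norm_sqrt // /ipnorm L2ip_cls. Qed.

Lemma integral_sqr_class (u : L2class) :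
  (\int[Q]_x (u x ^+ 2)%:E = (ipnorm L2ip u ^+ 2)%:E)%E.
Proof.
rewrite sqr_ipnorm /= /inner /Rintegral fineK; last first.
  by apply: integrable_fin_num => //; exact: L2_mul_integrable.
by apply: eq_integral => x _; rewrite expr2.
Qed.

Lemma nneseries_le (a : nat -> \bar R) (B : \bar R) : (forall i, (0 <= a i)%E) ->
  (forall N, (\sum_(0 <= i < N) a i <= B)%E) -> (\sum_(0 <= i <oo) a i <= B)%E.
Proof.
move=> a0 h; apply: lime_le; first exact: is_cvg_nneseries.
by apply: nearW => N; exact: h.
Qed.

(** * Riesz-Fischer for sequences with geometric increments *)

Section completeness.
Variables (u : nat -> L2class) (C q : R).
Hypotheses (q0 : 0 <= q) (q1 : q < 1).
Hypothesis hu : forall i, ipnorm L2ip (u i.+1 - u i) <= C * q ^+ i.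

Let C0 : 0 <= C.
Proof. by have := hu 0; rewrite expr0 mulr1; apply: le_trans; exact: ipnorm_ge0. Qed.

Let q1' : 0 < 1 - q. Proof. by rewrite subr_gt0. Qed.

(** A rate with [q <= p < 1]. Weighting the squared increments by [p^-i] keeps the sum of their
    integrals below [C^2] times the sum of the [q^i], while a finite weighted sum at [x] forces the
    increments at [x] to decay like powers of [sqrt p]. *)
Let p : R := (1 + q) / 2.
Let p0 : 0 < p. Proof. by rewrite /p; move: q0 q1; lra. Qed.
Let p1 : p < 1. Proof. by rewrite /p; move: q0 q1; lra. Qed.
Let qp : q <= p. Proof. by rewrite /p; move: q0 q1; lra. Qed.

Let tail i j : ipnorm L2ip (u i - u (i + j)%N) <= C * q ^+ i / (1 - q).
Proof.
pose r i := C * q ^+ i / (1 - q).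
have rE k : r k = C * q ^+ k + r k.+1 by rewrite /r exprS; field; rewrite gt_eqF.
have r0 k : 0 <= r k by rewrite divr_ge0 ?mulr_ge0 ?exprn_ge0 // ltW.
suff : ipnorm L2ip (u i - u (i + j)%N) + r (i + j)%N <= r i by have := r0 (i + j)%N; rewrite -/(r i); lra.
elim: j => [|j IH]; first by rewrite addn0 subrr ipnorm0 add0r.
apply: le_trans IH; rewrite addnS (rE (i + j)%N) addrA lerD2r.
rewrite -(subrKA (u (i + j)%N)); apply: le_trans (ipnormD _ _ _) _.
by rewrite lerD2l ipnormB.
Qed.

Let dd i x : R := p ^- i * (u i.+1 x - u i x) ^+ 2.

Let dd0 i x : 0 <= dd i x.
Proof. by rewrite mulr_ge0 ?sqr_ge0 // invr_ge0 exprn_ge0 // ltW. Qed.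

Let mdd i : measurable_fun setT (fun x => (dd i x)%:E).
Proof.
apply/measurable_EFinP/measurable_funM => //; apply: measurable_funX.
by apply: measurable_funB; exact: L2_measurable.
Qed.

Let int_dd i : (\int[Q]_x (dd i x)%:E = (p ^- i * ipnorm L2ip (u i.+1 - u i) ^+ 2)%:E)%E.
Proof.
rewrite EFinM -integral_sqr_class.
rewrite -ge0_integralZl //; last 3 first.
- by apply/measurable_EFinP/measurable_funX; exact: L2_measurable.
- by move=> x _; rewrite lee_fin sqr_ge0.
- by rewrite lee_fin invr_ge0 exprn_ge0 // ltW.
apply: ge0_ae_eq_integral => //.
- apply/measurable_EFinP/measurable_funM => //; apply: measurable_funX.
  exact: L2_measurable.
- by move=> x _; rewrite lee_fin dd0.
- by move=> x _; rewrite lee_fin mulr_ge0 ?sqr_ge0 // invr_ge0 exprn_ge0 // ltW.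
- by apply: filterS (L2class_subE (u i.+1) (u i)) => x -> _.
Qed.

Let geom N : \sum_(0 <= i < N) q ^+ i <= (1 - q)^-1.
Proof.
suff -> : \sum_(0 <= i < N) q ^+ i = (1 - q ^+ N) / (1 - q).
  rewrite ler_pdivrMr // mulVf ?gt_eqF // lerBlDr lerDl exprn_ge0 //.
elim: N => [|N IH]; first by rewrite big_nil expr0 subrr mul0r.
by rewrite big_nat_recr //= IH exprS; field; rewrite gt_eqF.
Qed.

Let sum_dd : (\int[Q]_x (\sum_(0 <= i <oo) (dd i x)%:E) < +oo)%E.
Proof.
rewrite integral_nneseries //; last by move=> i x _; rewrite lee_fin.
apply: (@le_lt_trans _ _ (C ^+ 2 / (1 - q))%:E); last exact: ltry.
apply: nneseries_le => [i|N]; first by apply: integral_ge0 => x _; rewrite lee_fin.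
under eq_bigr do rewrite int_dd.
rewrite sumEFin lee_fin; apply: le_trans (_ : \sum_(0 <= i < N) C ^+ 2 * q ^+ i <= _).
  apply: ler_sum => i _; rewrite ler_pdivrMl ?exprn_gt0 //.
  apply: le_trans (_ : (C * q ^+ i) ^+ 2 <= _).
    by rewrite lerXn2r ?nnegrE ?ipnorm_ge0 ?mulr_ge0 ?exprn_ge0.
  rewrite exprMn [leRHS]mulrCA ler_wpM2l ?sqr_ge0 // expr2.
  by rewrite ler_wpM2r ?exprn_ge0 // lerXn2r ?nnegrE // ltW.
by rewrite -mulr_sumr ler_wpM2l ?sqr_ge0.
Qed.

Let msum_dd : measurable_fun setT (fun x => \sum_(0 <= i <oo) (dd i x)%:E)%E.
Proof. by apply: ge0_emeasurable_sum => // i x _ _; rewrite lee_fin. Qed.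

Let ae_cauchy : {ae Q, forall x, exists l : R, u i x @[i --> \oo] --> l}.
Proof.
have fin : Q.-integrable setT (fun x => \sum_(0 <= i <oo) (dd i x)%:E)%E.
  apply/integrableP; split => //; apply: le_lt_trans sum_dd.
  rewrite le_eqVlt; apply/orP; left; apply/eqP; apply: eq_integral => x _.
  by rewrite gee0_abs //; apply: nneseries_ge0 => i _ _; rewrite lee_fin.
apply: filterS (integrable_ae measurableT fin) => x /(_ I) hx.
pose K := fine (\sum_(0 <= i <oo) (dd i x)%:E)%E.
have dK i : dd i x <= K.
  rewrite -lee_fin /K fineK //.
  apply: le_trans (nneseries_lim_ge i.+1 _); last by move=> k _ _; rewrite lee_fin.
  rewrite big_nat_recr //= leeDr // sumEFin lee_fin.
  by apply: sumr_ge0.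
have K0 : 0 <= K by exact: le_trans (dd0 0 x) (dK 0).
pose s := Num.sqrt p.
have s0 : 0 <= s by exact: sqrtr_ge0.
have s1 : s < 1 by rewrite -(sqrtr1 R) ltr_sqrt.
have hs i : `|u i.+1 x - u i x| <= Num.sqrt K * s ^+ i.
  rewrite -(@ler_pXn2r _ 2) ?nnegrE ?mulr_ge0 ?exprn_ge0 ?sqrtr_ge0 //.
  rewrite real_normK ?num_real // exprMn sqr_sqrtr // -exprM mulnC exprM sqr_sqrtr ?(ltW p0) //.
  have := dK i.
  by rewrite /dd ler_pdivrMl ?exprn_gt0 // mulrC; apply.
have [l hl] := geometric_cauchy_real s0 s1 hs; exists l.
apply/cvgrPdist_le => e e0.
have [N hN] := cvg_geometric_eps (Num.sqrt K / (1 - s)) s0 s1 e0.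
exists N => // i /= hi; rewrite distrC; apply: le_trans (hl i) _.
apply: le_trans (ltW hN); rewrite mulrAC ler_wpM2l //.
  by rewrite divr_ge0 ?sqrtr_ge0 // subr_ge0 ltW.
by apply: ler_wiXn2l; rewrite // ltW.
Qed.

(** The limit superior is measurable on the whole space and equals the limit wherever the latter
    exists. *)
Let f x : R := fine (limn_esup (fun i => (u i x)%:E)).

Let mf : measurable_fun setT f.
Proof.
apply: measurableT_comp => //; apply: measurable_fun_limn_esup => i.
by apply/measurable_EFinP; exact: L2_measurable.
Qed.

Let ae_cvg : {ae Q, forall x, u i x @[i --> \oo] --> f x}.
Proof.
apply: filterS ae_cauchy => x [l hl]; suff -> : f x = l by [].
rewrite /f (cvg_limn_einf_sup (l := l%:E)) //.
apply: cvg_EFin; [exact: nearW | exact: hl].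
Qed.

(** Fatou's lemma in [j] carries the bound on [u i - u (i + j)] to the limit, without a dominating
    function. *)
Let fatou_bound i : (\int[Q]_x ((u i x - f x) ^+ 2)%:E <= ((C * q ^+ i / (1 - q)) ^+ 2)%:E)%E.
Proof.
pose F j x := ((u i x - u (j + i)%N x) ^+ 2)%:E : \bar R.
have mF j : measurable_fun setT (F j).
  by apply/measurable_EFinP/measurable_funX/measurable_funB; exact: L2_measurable.
have F0 j x : setT x -> (0 <= F j x)%E by move=> _; rewrite lee_fin sqr_ge0.
have -> : (\int[Q]_x ((u i x - f x) ^+ 2)%:E = \int[Q]_x limn_einf (F ^~ x))%E.
  apply: ge0_ae_eq_integral => //.
  - by apply/measurable_EFinP/measurable_funX/measurable_funB => //; exact: L2_measurable.
  - apply: (@measurableT_comp _ _ _ _ _ _ oppe) => //.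
    by apply: measurable_fun_limn_esup => j; apply: measurableT_comp.
  - by move=> x _; rewrite lee_fin sqr_ge0.
  - move=> x _; rewrite limn_einf_lim; apply: lime_ge; first exact: is_cvg_einfs.
    by apply: nearW => j; apply: le_ereal_inf_tmp => _ [l _ <-]; exact: F0.
  apply: filterS ae_cvg => x hx _.
  rewrite (cvg_limn_einf_sup (l := ((u i x - f x) ^+ 2)%:E)) //.
  apply: cvg_EFin; first exact: nearW.
  apply: (@cvg_comp _ _ _ (fun j => u i x - u (j + i)%N x) (fun y => y ^+ 2)); last exact: exprn_continuous.
  apply: cvgB; first exact: cvg_cst.
  by rewrite (cvg_shiftn i (fun j => u j x)).
apply: le_trans (fatou Q measurableT mF F0) _.
have FB j : (\int[Q]_x F j x <= ((C * q ^+ i / (1 - q)) ^+ 2)%:E)%E.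
  have -> : (\int[Q]_x F j x = (ipnorm L2ip (u i - u (j + i)%N) ^+ 2)%:E)%E.
    rewrite -integral_sqr_class; apply: ge0_ae_eq_integral => //.
    - by apply/measurable_EFinP/measurable_funX; exact: L2_measurable.
    - by move=> x _; rewrite lee_fin sqr_ge0.
    - by move=> x _; rewrite lee_fin sqr_ge0.
    - by apply: filterS (L2class_subE (u i) (u (j + i)%N)) => x -> _.
  rewrite lee_fin lerXn2r ?nnegrE ?ipnorm_ge0 ?divr_ge0 ?mulr_ge0 ?exprn_ge0 ?(ltW q1') //.
  by rewrite addnC tail.
rewrite limn_einf_lim; apply: lime_le; first exact: is_cvg_einfs.
apply: nearW => j; apply: le_trans (FB j).
by apply: ereal_inf_lbound; exists j => /=.
Qed.

Theorem L2class_complete :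
  exists l : L2class, forall i, ipnorm L2ip (u i - l) <= C * q ^+ i / (1 - q).
Proof.
have hd i : L2 Q (fun x => u i x - f x).
  apply: L2P; last exact: le_lt_trans (fatou_bound i) (ltry _).
  by apply: measurable_funB => //; exact: L2_measurable.
have hf : L2 Q f.
  have := L2_subP (L2class_L2 (u 0)) (hd 0%N).
  by rewrite (_ : _ \- _ = f) //; apply/funext => x /=; rewrite opprB addrCA subrr addr0.
exists (cls f) => i.
rewrite -(@ler_pXn2r _ 2) ?nnegrE ?ipnorm_ge0 ?divr_ge0 ?mulr_ge0 ?exprn_ge0 ?(ltW q1') //.
rewrite -lee_fin -integral_sqr_class; apply: le_trans (fatou_bound i).
rewrite le_eqVlt; apply/orP; left; apply/eqP; apply: ge0_ae_eq_integral => //.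
- by apply/measurable_EFinP/measurable_funX; exact: L2_measurable.
- by apply/measurable_EFinP/measurable_funX; exact: L2_measurable.
- by move=> x _; rewrite lee_fin sqr_ge0.
- by move=> x _; rewrite lee_fin sqr_ge0.
- by apply: filterS2 (L2class_subE (u i) (cls f)) (clsP hf) => x -> /= -> _.
Qed.

End completeness.

End aeeq_theory.
Arguments L2class {d T R} Q.
Arguments cls {d T R} Q f.
Arguments L2ip {d T R} Q.
#[export] Hint Resolve L2class_L2 : core.

(** * The conditional expectation operator *)

Section const_kernel.
Context {d d' : measure_display} {S : measurableType d'} {T : measurableType d} {R : realType}.
Variable Q : probability T R.

Definition const_kernel (_ : S) : {measure set T -> \bar R} := Q.

Let measurable_const_kernel U : measurable U -> measurable_fun setT (const_kernel ^~ U).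
Proof. by move=> _; exact: measurable_cst. Qed.

HB.instance Definition _ := isKernel.Build _ _ _ _ _ const_kernel measurable_const_kernel.

Let const_kernel_prob x : const_kernel x setT = 1%E.
Proof. exact: probability_setT. Qed.

HB.instance Definition _ := Kernel_isProbability.Build _ _ _ _ _ const_kernel const_kernel_prob.

End const_kernel.

Section graph_kernel.
Context {d d' : measure_display} {S : measurableType d'} {T : measurableType d} {R : realType}.
Variable P1 : R.-pker T ~> T.

(** The law of [(x, Y)] with [Y] drawn from [P1 x]. Composed with the constant kernel [Q] it
    produces [Q(dx) P1(x, dy)] on pairs, so that integration against a composition of kernels yields
    Tonelli's formula. *)
Definition graph_kernel (u : S * T) : {measure set (T * T) -> \bar R} :=
  measure_function_pushforward__canonical__measure_function_Measure
    (P1 u.2) (pair1_measurable (T2 := T) u.2).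

Let measurable_graph_kernel U : measurable U -> measurable_fun setT (graph_kernel ^~ U).
Proof.
move=> mU.
have -> : (graph_kernel ^~ U) = (fun x => P1 x (xsection U x)) \o snd.
  by apply/funext => u; rewrite /graph_kernel /pushforward /= xsectionE.
apply: measurableT_comp => //.
by apply: measurable_fun_xsection_finite_kernel; rewrite inE.
Qed.

HB.instance Definition _ := isKernel.Build _ _ _ _ _ graph_kernel measurable_graph_kernel.

Let graph_kernel_prob x : graph_kernel x setT = 1%E.
Proof. by rewrite /graph_kernel /= /pushforward preimage_setT prob_kernel. Qed.

HB.instance Definition _ := Kernel_isProbability.Build _ _ _ _ _ graph_kernel graph_kernel_prob.

End graph_kernel.

(** [nu = Q(dx) P1(x, dy)], required on rectangles only, which is what the Markov property
    provides. *)
Definition pair_law {d} {T : measurableType d} {R : realType} (Q : probability T R)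
    (P1 : R.-pker T ~> T) (nu : probability (T * T)%type R) : Prop :=
  forall A B, measurable A -> measurable B ->
    nu (A `*` B) = (\int[Q]_(x in A) P1 x B)%E.

Section pair_law_theory.
Context {d : measure_display} {T : measurableType d} {R : realType}.
Variables (Q : probability T R) (P1 : R.-pker T ~> T) (nu : probability (T * T)%type R).
Hypothesis hnu : pair_law Q P1 nu.

Lemma pair_law_tonelli (F : T * T -> \bar R) : measurable_fun setT F ->
  (forall z, (0 <= F z)%E) ->
  (\int[nu]_z F z = \int[Q]_x \int[P1 x]_y F (x, y))%E.
Proof.
move=> mF F0.
pose l : R.-pker unit ~> T := const_kernel (S := unit) Q.
pose k : R.-pker (unit * T) ~> (T * T)%type := graph_kernel (S := unit) P1.
have E A : measurable A -> nu A = kcomp l k tt A.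
  pose C : set (set (T * T)) :=
    [set C | exists A, measurable A /\ exists B, measurable B /\ C = A `*` B].
  have CI : setI_closed C.
    move=> /= _ _ [X1 [mX1 [X2 [mX2 ->]]]] [Y1 [mY1 [Y2 [mY2 ->]]]].
    rewrite -setXI; exists (X1 `&` Y1); split; first exact: measurableI.
    by exists (X2 `&` Y2); split => //; exact: measurableI.
  move=> mA; apply: (@measure_unique _ _ _ C (fun=> setT) _ _ _ _ nu (mkcomp l k tt)) => //.
  - rewrite measurable_prod_measurableType //; congr (<<s _ >>).
    rewrite predeqE => X; split=> [[A1 mA1 [B1 mB1] <-]|[A1 [mA1 [B1 [mB1 ->]]]]].
      by exists A1; split => //; exists B1.
    by exists A1 => //; exists B1.
  - by move=> n; exists setT; split => //; exists setT; split => //; rewrite setXTT.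
  - by rewrite bigcup_const.
  - move=> _ [A1 [mA1 [B1 [mB1 ->]]]]; transitivity (\int[Q]_(x in A1) P1 x B1)%E; first exact: hnu.
    rewrite /mkcomp /= /kcomp /= /l /k /graph_kernel /const_kernel /= /pushforward /=.
    rewrite integral_mkcond; apply: eq_integral => x _; rewrite patchE.
    have -> : (fun y => (x, y)) @^-1` (A1 `*` B1) = if x \in A1 then B1 else set0.
      by apply/seteqP; split=> y /=; case: ifPn => //; rewrite ?inE ?notin_setE /setX /=; tauto.
    by case: ifP => //; rewrite measure0.
  - move=> _; apply: (@le_lt_trans _ _ 1%E); last exact: ltry.
    by rewrite le_eqVlt; apply/orP; left; apply/eqP; exact: probability_setT.
transitivity (\int[mkcomp l k tt]_z F z)%E.
  by apply: eq_measure_integral => A mA _; exact: E.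
rewrite [LHS](@integral_kcomp _ _ _ _ _ _ R l k tt F) //.
apply: eq_integral => x _; rewrite /k /graph_kernel /=.
by rewrite ge0_integral_pushforward.
Qed.

Lemma pair_law_fst (f : T -> \bar R) : measurable_fun setT f -> (forall x, (0 <= f x)%E) ->
  (\int[nu]_z f z.1 = \int[Q]_x f x)%E.
Proof.
move=> mf f0; rewrite pair_law_tonelli //; last exact: measurableT_comp.
by apply: eq_integral => x _ /=; rewrite integral_cst // prob_kernel mule1.
Qed.

Lemma integral_sectionE (F : T * T -> R) x :
  (\int[P1 x]_y (F (x, y))%:E =
   \int[P1 x]_y ((EFin \o F)^\+ (x, y)) - \int[P1 x]_y ((EFin \o F)^\- (x, y)))%E.
Proof.
rewrite integralE; congr (_ - _)%E; apply: eq_integral => y _.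
  by rewrite !funeposE.
by rewrite !funenegE.
Qed.

Lemma measurable_Mop (F : T * T -> R) : measurable_fun setT F ->
  measurable_fun setT (fun x => \int[P1 x]_y F (x, y)).
Proof.
move=> mF; apply: measurableT_comp => //.
under eq_fun do rewrite integral_sectionE.
have mp : measurable_fun setT ((EFin \o F)^\+)%E.
  by apply: measurable_funepos; exact/measurable_EFinP.
have mn : measurable_fun setT ((EFin \o F)^\-)%E.
  by apply: measurable_funeneg; exact/measurable_EFinP.
apply: emeasurable_funB.
  exact: (measurable_fun_integral_finite_kernel _ P1 (funepos_ge0 (EFin \o F)) mp).
exact: (measurable_fun_integral_finite_kernel _ P1 (funeneg_ge0 (EFin \o F)) mn).
Qed.

Lemma pair_law_fubini (F : T * T -> R) : nu.-integrable setT (EFin \o F) ->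
  [/\ {ae Q, forall x, (P1 x).-integrable setT (fun y => (F (x, y))%:E)},
    Q.-integrable setT (fun x => (\int[P1 x]_y F (x, y))%:E) &
    \int[nu]_z F z = \int[Q]_x \int[P1 x]_y F (x, y)].
Proof.
move=> iF; have /integrableP[/measurable_EFinP mF fF] := iF.
have mFx x : measurable_fun setT (fun y => F (x, y)).
  exact: (measurableT_comp mF (pair1_measurable x)).
pose Fa z := `|(F z)%:E|%E; pose Fp := ((EFin \o F)^\+)%E; pose Fn := ((EFin \o F)^\-)%E.
have mFa : measurable_fun setT Fa by apply: measurableT_comp => //; exact/measurable_EFinP.
have mFp : measurable_fun setT Fp by apply: measurable_funepos; exact/measurable_EFinP.
have mFn : measurable_fun setT Fn by apply: measurable_funeneg; exact/measurable_EFinP.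
have Fa0 z : (0 <= Fa z)%E by exact: abse_ge0.
have Fp0 z : (0 <= Fp z)%E by exact: funepos_ge0.
have Fn0 z : (0 <= Fn z)%E by exact: funeneg_ge0.
have FaE z : (Fa z = Fp z + Fn z)%E by rewrite /Fa -[LHS]/((abse \o (EFin \o F)) z) fune_abse.
have Fpa z : (Fp z <= Fa z)%E by rewrite FaE leeDl.
have Fna z : (Fn z <= Fa z)%E by rewrite FaE leeDr.
pose I (G : T * T -> \bar R) x := (\int[P1 x]_y G (x, y))%E.
have mI G : measurable_fun setT G -> (forall z, (0 <= G z)%E) -> measurable_fun setT (I G).
  by move=> mG G0; exact: (measurable_fun_integral_finite_kernel G P1).
have I0 G x : (forall z, (0 <= G z)%E) -> (0 <= I G x)%E.
  by move=> G0; apply: integral_ge0.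
have iI G : measurable_fun setT G -> (forall z, (0 <= G z)%E) -> (forall z, (G z <= Fa z)%E) ->
    Q.-integrable setT (I G).
  move=> mG G0 Ga; apply/integrableP; split; first exact: mI.
  apply: le_lt_trans fF.
  have -> : (\int[Q]_x `|I G x| = \int[Q]_x I G x)%E.
    by apply: eq_integral => x _; rewrite gee0_abs ?I0.
  rewrite -pair_law_tonelli //.
  by apply: ge0_le_integral => // z _; exact: Ga.
have iFx x : I Fa x \is a fin_num -> (P1 x).-integrable setT (fun y => (F (x, y))%:E).
  move=> h; apply/integrableP; split; first exact/measurable_EFinP.
  by rewrite -[ltLHS]/(I Fa x) -ge0_fin_numE // I0.
have faefin := integrable_ae measurableT (iI Fa mFa Fa0 (fun z => lexx _)).
have aefin : {ae Q, forall x, (P1 x).-integrable setT (fun y => (F (x, y))%:E)}.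
  by apply: filterS faefin => x /(_ Logic.I); exact: iFx.
have mR : measurable_fun setT (fun x => (\int[P1 x]_y F (x, y))%:E).
  by apply/measurable_EFinP; exact: measurable_Mop.
have iR : Q.-integrable setT (fun x => (\int[P1 x]_y F (x, y))%:E).
  apply: (le_integrable measurableT mR _ (iI Fa mFa Fa0 (fun z => lexx _))) => x _.
  rewrite /= [leRHS]gee0_abs ?I0 //.
  have [h|] := boolP (I Fa x \is a fin_num); last first.
    by rewrite ge0_fin_numE ?I0 // -leNgt leye_eq => /eqP ->; exact: leey.
  have h2 := iFx _ h.
  have := le_normr_Rintegral measurableT h2; rewrite -lee_fin => /le_trans; apply.
  by rewrite /Rintegral fineK.
split => //.
rewrite {1}/Rintegral [in LHS]integralE -/Fp -/Fn !pair_law_tonelli //.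
have -> : (\int[Q]_x \int[P1 x]_y Fp (x, y) - \int[Q]_x \int[P1 x]_y Fn (x, y) =
    \int[Q]_x (I Fp x - I Fn x))%E.
  by apply/esym; exact: (integralB measurableT (iI Fp mFp Fp0 Fpa) (iI Fn mFn Fn0 Fna)).
congr fine; apply: ae_eq_integral => //.
  by apply: emeasurable_funB; exact: mI.
apply: filterS aefin => x hx _; rewrite /Rintegral fineK; last exact: integrable_fin_num.
by rewrite integral_sectionE.
Qed.

End pair_law_theory.

Section opnorm_theory.
Context {d : measure_display} {T : measurableType d} {R : realType}.
Variable Q : probability T R.
Local Notation nrm f := (ipnorm (L2ip Q) (cls Q f)).

Lemma opnorm_ge0 (A : (T -> R) -> T -> R) : (0 <= opnorm Q A)%E.
Proof.
apply: ereal_sup_ge; exists (L2norm Q (A (cst 0))); last exact: Lnorm_ge0.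
exists (cst 0) => //; split; first exact: L2_cst0.
by rewrite (L2norm_cls (L2_cst0 _)) cls0 ipnorm0 lee_fin.
Qed.

(** [opnorm] only sees the unit ball. Homogeneity extends the bound to all of [L^2]; operators on
    functions have it only almost everywhere, hence the detour through classes. *)
Lemma opnorm_bound (A : (T -> R) -> T -> R) (B : R) :
  (forall f, L2 Q f -> L2 Q (A f)) ->
  (forall c f, L2 Q f -> aeeq Q (A (fun x => c * f x)) (fun x => c * A f x)) ->
  (opnorm Q A <= B%:E)%E ->
  forall f, L2 Q f -> nrm (A f) <= B * nrm f.
Proof.
move=> AL2 AZ hB.
have key (c : R) f : L2 Q f -> 0 <= c -> c * nrm f <= 1 -> c * nrm (A f) <= B.
  move=> hf c0 hc; have hcf : L2 Q (fun x => c * f x) by exact: L2_scaleP.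
  have : (L2norm Q (A (fun x => (c * f x)%R)) <= B%:E)%E.
    apply: le_trans hB; apply: ereal_sup_ubound; exists (fun x => c * f x)%R => //; split => //.
    by rewrite L2norm_cls // clsZ // ipnormZ ger0_norm.
  rewrite L2norm_cls; last exact: AL2.
  rewrite (cls_eq (AL2 _ hcf) (L2_scaleP c (AL2 _ hf)) (AZ c f hf)) clsZ; last exact: AL2.
  by rewrite ipnormZ ger0_norm.
move=> f hf; have [z|z] := eqVneq (nrm f) 0.
  rewrite z mulr0 leNgt; apply/negP => p.
  have B0 : 0 <= B by have := key 0 f hf (lexx 0); rewrite !mul0r ler01; exact.
  (* A null [f] can be scaled at will inside the unit ball; with this factor its image would have
     norm [B + 1]. *)
  have q : 0 <= (B + 1) / nrm (A f) by rewrite divr_ge0 ?addr_ge0 // ltW.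
  have := key ((B + 1) / nrm (A f)) f hf q.
  by rewrite z mulr0 ler01 divfK ?gt_eqF // => /(_ isT); lra.
have p : 0 < nrm f by rewrite lt_neqAle eq_sym z ipnorm_ge0.
have := key (nrm f)^-1 f hf; rewrite invr_ge0 mulVf // lexx (ltW p) => /(_ isT isT).
by rewrite ler_pdivrMl // mulrC.
Qed.

Lemma L2_ae_le (f g : T -> R) : measurable_fun setT f -> L2 Q g ->
  {ae Q, forall x, `|f x| <= `|g x|} -> L2 Q f.
Proof.
move=> mf hg fg; apply: L2P => //.
have /integrableP[mg2] := L2_sqr_integrable hg; apply: le_lt_trans.
apply: ae_ge0_le_integral => //.
- by move=> x _; rewrite lee_fin sqr_ge0.
- by apply/measurable_EFinP; exact: measurable_funX.
- exact: measurableT_comp.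
- apply: filterS fg => x fgx _; rewrite /= lee_fin [leRHS]ger0_norm ?sqr_ge0 //.
  rewrite -(real_normK (num_real (f x))) -(real_normK (num_real (g x))).
  by rewrite lerXn2r ?nnegrE.
Qed.

Lemma nrm_ae_le (f g : T -> R) : L2 Q f -> L2 Q g -> {ae Q, forall x, `|f x| <= `|g x|} ->
  nrm f <= nrm g.
Proof.
move=> hf hg fg; rewrite /ipnorm ler_sqrt ?ip_ge0 // !L2ip_cls //.
apply: fine_le; try by apply: integrable_fin_num => //; exact: L2_mul_integrable.
apply: ae_ge0_le_integral => //.
- by move=> x _; rewrite lee_fin -expr2 sqr_ge0.
- by have /integrableP[] := L2_mul_integrable hf hf.
- by move=> x _; rewrite lee_fin -expr2 sqr_ge0.
- by have /integrableP[] := L2_mul_integrable hg hg.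
- apply: filterS fg => x fgx _; rewrite lee_fin -!expr2.
  rewrite -(real_normK (num_real (f x))) -(real_normK (num_real (g x))).
  by rewrite lerXn2r ?nnegrE.
Qed.

Lemma nrm_abs (f : T -> R) : L2 Q f -> nrm (fun x => `|f x|) = nrm f.
Proof.
move=> hf; apply/le_anti/andP; split.
  by apply: nrm_ae_le => //; [exact: L2_normP|apply: nearW => x; rewrite normr_id].
by apply: nrm_ae_le => //; [exact: L2_normP|apply: nearW => x; rewrite normr_id].
Qed.

Lemma inner_ae_le (f f' g : T -> R) : L2 Q f -> L2 Q f' -> L2 Q g ->
  {ae Q, forall x, f x * g x <= f' x * g x} -> inner Q f g <= inner Q f' g.
Proof.
move=> hf hf' hg h; rewrite -subr_ge0.
have -> : inner Q f' g - inner Q f g = inner Q (f' \- f) g.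
  by rewrite -!L2ip_cls ?clsB ?ipBl //; exact: L2_subP.
have hd : L2 Q (f' \- f) by exact: L2_subP.
rewrite /inner /Rintegral.
have -> : (\int[Q]_x ((f' \- f) x * g x)%:E = \int[Q]_x (`|(f' \- f) x * g x|)%:E)%E.
  apply: ae_eq_integral => //.
  - by have /integrableP[] := L2_mul_integrable hd hg.
  - apply/measurable_EFinP; apply: measurableT_comp => //.
    by have /integrableP[/measurable_EFinP] := L2_mul_integrable hd hg.
  - apply: filterS h => x hx _; rewrite ger0_norm //= mulrBl subr_ge0.
    exact: hx.
by apply: fine_ge0; apply: integral_ge0 => x _; rewrite lee_fin.
Qed.

End opnorm_theory.

(** * Operators whose weight is dominated by [m] *)

Section transition_operator.
Context {d : measure_display} {T : measurableType d} {R : realType}.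
Variables (Q : probability T R) (P1 : R.-pker T ~> T) (nu : probability (T * T)%type R).
Hypothesis hnu : pair_law Q P1 nu.
Hypothesis hsnd : forall B, measurable B -> nu (setT `*` B) = Q B.
Variable m : T * T -> R.
Hypotheses (m_meas : measurable_fun setT m) (m_pos : forall z, 0 < m z).
Hypothesis mb : Mbounded Q P1 m.
Local Notation nrm f := (ipnorm (L2ip Q) (cls Q f)).

(** By stationarity [Q N] is the [Q]-integral of [P1 x N], so a [Q]-null set is [P1 x]-null for
    almost every [x]. This is what lets the operators act on classes. *)
Lemma ae_transition (p : T -> Prop) : {ae Q, forall x, p x} ->
  {ae Q, forall x, {ae P1 x, forall y, p y}}.
Proof.
move=> [N [mN QN sub]].
have mPN : measurable_fun setT (fun x => P1 x N) by exact: measurable_kernel.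
have : (\int[Q]_x `|P1 x N| = 0)%E.
  rewrite -QN -hsnd // hnu //; apply: eq_integral => x _.
  by rewrite gee0_abs.
move=> /(ae_eq_integral_abs Q measurableT mPN); apply: filterS => x /(_ Logic.I) hx.
by exists N; split.
Qed.

(** Covers [m], the weights of the submodels and their differences with [m]. As [m] is positive,
    [Mop w f] is at most [C] times [M |f|], so integrability, stability of [L^2] and norm bounds all
    pass from [m] to [w]. *)
Definition dominated_by (C : R) (w : T * T -> R) : Prop :=
  [/\ measurable_fun setT w, 0 <= C & forall z, `|w z| <= C * m z].

Lemma dominated_self : dominated_by 1 m.
Proof. by split => // z; rewrite mul1r ger0_norm // ltW. Qed.

Lemma dominated_abs C w : dominated_by C w -> dominated_by C (fun z => `|w z|).
Proof.
move=> [mw C0 h]; split => // [|z]; first exact: measurableT_comp.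
by rewrite normr_id.
Qed.

Section dominated.
Variables (C : R) (w : T * T -> R).
Hypothesis hw : dominated_by C w.

Let mw : measurable_fun setT w. Proof. by case: hw. Qed.
Let C0 : 0 <= C. Proof. by case: hw. Qed.
Let wm z : `|w z| <= C * m z. Proof. by case: hw. Qed.

Lemma measurable_section (v : T * T -> R) f x : measurable_fun setT v ->
  measurable_fun setT f -> measurable_fun setT (fun y => (v (x, y) * f y)%:E).
Proof.
move=> mv mf; apply/measurable_EFinP; apply: measurable_funM => //.
exact: (measurableT_comp mv (pair1_measurable x)).
Qed.

Lemma measurable_integrand (v : T * T -> R) f : measurable_fun setT v ->
  measurable_fun setT f -> measurable_fun setT (fun z => v z * f z.2).
Proof. by move=> mv mf; apply: measurable_funM => //; exact: measurableT_comp. Qed.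

Lemma integrable_dominated f : L2 Q f ->
  {ae Q, forall x, (P1 x).-integrable setT (fun y => (w (x, y) * f y)%:E)}.
Proof.
move=> hf; have [h1 _ _] := mb; apply: filterS (h1 _ hf) => x hx.
have hx' : (P1 x).-integrable setT (fun y => C%:E * (m (x, y) * f y)%:E)%E.
  exact: integrableZl.
apply: (le_integrable measurableT _ _ hx').
  by apply: measurable_section => //; exact: L2_measurable hf.
move=> y _; rewrite -EFinM /= lee_fin !normrM mulrA ler_wpM2r //.
apply: le_trans (wm _) _; rewrite (ger0_norm C0) ger0_norm // ltW //.
Qed.

Lemma Mop_dominated f : L2 Q f ->
  {ae Q, forall x, `|Mop P1 w f x| <= C * Mop P1 m (fun y => `|f y|) x}.
Proof.
move=> hf; have [h1 _ _] := mb.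
apply: filterS2 (integrable_dominated hf) (h1 _ (L2_normP hf)) => x hx1 hx2.
apply: le_trans (le_normr_Rintegral measurableT hx1) _.
rewrite /Mop -RintegralZl //; apply: le_Rintegral => //.
- have := integrable_abse hx1; by apply: eq_integrable => // y _.
- by have := integrableZl measurableT C hx2; apply: eq_integrable => // y _.
- by move=> y _; rewrite normrM mulrA ler_wpM2r.
Qed.

Lemma measurable_Mop_L2 f : L2 Q f -> measurable_fun setT (Mop P1 w f).
Proof.
move=> hf; apply: (measurable_Mop P1 (F := fun z => w z * f z.2)).
by apply: measurable_integrand => //; exact: L2_measurable hf.
Qed.

Lemma L2_Mop f : L2 Q f -> L2 Q (Mop P1 w f).
Proof.
move=> hf; have [_ h2 _] := mb.
apply: (@L2_ae_le _ _ _ Q _ (fun x => C * Mop P1 m (fun y => `|f y|) x)).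
- exact: measurable_Mop_L2.
- by apply: L2_scaleP; apply: h2; exact: L2_normP.
- by apply: filterS (Mop_dominated hf) => x hx; apply: le_trans hx (ler_norm _).
Qed.

Lemma Mop_ae f g : L2 Q f -> L2 Q g -> aeeq Q f g -> aeeq Q (Mop P1 w f) (Mop P1 w g).
Proof.
move=> hf hg /ae_transition; apply: filterS => x hx; rewrite /Mop /Rintegral.
congr fine; apply: ae_eq_integral => //.
- by apply: measurable_section => //; exact: L2_measurable hf.
- by apply: measurable_section => //; exact: L2_measurable hg.
- by apply: filterS hx => y -> _.
Qed.

Lemma Mop_additive f g : L2 Q f -> L2 Q g ->
  aeeq Q (Mop P1 w (f \+ g)) (Mop P1 w f \+ Mop P1 w g).
Proof.
move=> hf hg; apply: filterS2 (integrable_dominated hf) (integrable_dominated hg) => x h1 h2.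
rewrite /Mop /= -RintegralD //.
by apply: eq_Rintegral => y _ /=; rewrite mulrDr.
Qed.

Lemma Mop_homogeneous c f : L2 Q f ->
  aeeq Q (Mop P1 w (fun x => c * f x)) (fun x => c * Mop P1 w f x).
Proof.
move=> hf; apply: filterS (integrable_dominated hf) => x h1.
rewrite /Mop /= -RintegralZl //.
by apply: eq_Rintegral => y _ /=; rewrite mulrCA.
Qed.

Definition class_op (v : T * T -> R) (u : L2class Q) : L2class Q := cls Q (Mop P1 v u).

Lemma class_op_cls f : L2 Q f -> class_op w (cls Q f) = cls Q (Mop P1 w f).
Proof.
move=> hf; apply: cls_eq; try exact: L2_Mop.
by apply: Mop_ae => //; exact: clsP.
Qed.

Lemma class_op_linear : linear (class_op w).
Proof.
move=> c u v.
have h1 : L2 Q (fun x => c * u x) by exact: L2_scaleP.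
have -> : c *: u + v = cls Q ((fun x => c * u x) \+ v).
  by rewrite clsD // clsZ // !cls_rep.
rewrite class_op_cls; last exact: L2_addP.
rewrite (cls_eq _ _ (Mop_additive h1 (L2class_L2 v))); last 2 first.
- by apply: L2_Mop; exact: L2_addP.
- by apply: L2_addP; exact: L2_Mop.
rewrite clsD; try exact: L2_Mop.
congr (_ + _); rewrite -clsZ; last exact: L2_Mop.
by apply: cls_eq; [exact: L2_Mop | apply: L2_scaleP; exact: L2_Mop | exact: Mop_homogeneous].
Qed.

End dominated.

Definition op_bound : R := fine (opnorm Q (Mop P1 m)).

Lemma op_bound_ge0 : 0 <= op_bound.
Proof. apply: fine_ge0; exact: opnorm_ge0. Qed.

Lemma Mop_bounded f : L2 Q f -> nrm (Mop P1 m f) <= op_bound * nrm f.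
Proof.
have [h1 h2 h3] := mb; apply: opnorm_bound => //.
  by move=> c g hg; exact: (Mop_homogeneous dominated_self).
rewrite /op_bound fineK // ge0_fin_numE //; exact: opnorm_ge0.
Qed.

Lemma Mop_dominated_bounded C w f : dominated_by C w -> L2 Q f ->
  nrm (Mop P1 w f) <= C * op_bound * nrm f.
Proof.
move=> hw hf; have [mw C0 wm] := hw; have [_ h2 _] := mb.
have h := L2_normP hf.
apply: le_trans (nrm_ae_le (g := fun x => C * Mop P1 m (fun y => `|f y|) x) _ _ _) _.
- exact: (L2_Mop hw).
- by apply: L2_scaleP; exact: h2.
- by apply: filterS (Mop_dominated hw hf) => x hx; apply: le_trans hx (ler_norm _).
rewrite clsZ; last exact: h2.
rewrite ipnormZ ger0_norm // -mulrA ler_wpM2l // -(nrm_abs hf); exact: Mop_bounded.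
Qed.

Lemma integrable_pair C w h f : dominated_by C w -> L2 Q h -> L2 Q f ->
  nu.-integrable setT (fun z => (h z.1 * w z * f z.2)%:E).
Proof.
move=> hw hh hf; have [mw C0 wm] := hw.
have mF : measurable_fun setT (fun z : T * T => h z.1 * w z * f z.2).
  apply: measurable_funM; last by apply: measurableT_comp => //; exact: L2_measurable hf.
  by apply: measurable_funM => //; apply: measurableT_comp => //; exact: L2_measurable hh.
apply/integrableP; split; first exact/measurable_EFinP.
rewrite (pair_law_tonelli hnu); last 2 first.
- by apply: measurableT_comp => //; exact/measurable_EFinP.
- by move=> z; exact: abse_ge0.
have hw' := dominated_abs hw.
have hh' := L2_normP hh; have hf' := L2_normP hf.
have -> : (\int[Q]_x \int[P1 x]_y `|(h (x, y).1 * w (x, y) * f (x, y).2)%:E| =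
   \int[Q]_x (`|h x| * Mop P1 (fun z => `|w z|) (fun y => `|f y|) x)%:E)%E.
  apply: ae_eq_integral => //.
  - apply: (measurable_fun_integral_finite_kernel (fun z => `|(h z.1 * w z * f z.2)%:E|)%E P1) => //.
    by apply: measurableT_comp => //; exact/measurable_EFinP.
  - by have /integrableP[] := L2_mul_integrable hh' (L2_Mop hw' hf').
  apply: filterS (integrable_dominated hw' hf') => x hx _ /=.
  rewrite /Mop -RintegralZl // /Rintegral fineK; last first.
    apply: integrable_fin_num => //.
    by have := integrableZl measurableT `|h x| hx; apply: eq_integrable => // y _.
  by apply: eq_integral => y _; rewrite !normrM mulrA.
have /integrableP[_] := L2_mul_integrable hh' (L2_Mop hw' hf').
apply: le_lt_trans; rewrite le_eqVlt; apply/orP; left; apply/eqP.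
apply: eq_integral => x _; rewrite gee0_abs // lee_fin mulr_ge0 //.
by apply: Rintegral_ge0 => y _; rewrite mulr_ge0.
Qed.

Lemma integral_pair C w h f : dominated_by C w -> L2 Q h -> L2 Q f ->
  \int[nu]_z (h z.1 * w z * f z.2) = inner Q h (Mop P1 w f).
Proof.
move=> hw hh hf; have [h1 h2 ->] := pair_law_fubini hnu (integrable_pair hw hh hf).
congr fine; apply: ae_eq_integral => //.
- by have /integrableP[] := h2.
- by have /integrableP[] := L2_mul_integrable hh (L2_Mop hw hf).
apply: filterS (integrable_dominated hw hf) => x hx _; congr EFin.
rewrite /Mop -RintegralZl //; apply: eq_Rintegral => y _ /=.
by rewrite mulrA.
Qed.

Lemma integral_pair_abs C w h f : dominated_by C w -> L2 Q h -> L2 Q f ->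
  \int[nu]_z `|h z.1 * w z * f z.2| <= C * op_bound * nrm h * nrm f.
Proof.
move=> hw hh hf; have hh' := L2_normP hh; have hf' := L2_normP hf.
have hw' := dominated_abs hw.
under eq_Rintegral do rewrite !normrM.
rewrite (integral_pair hw' hh' hf') -L2ip_cls //; last exact: (L2_Mop hw').
apply: le_trans (ler_norm _) _; apply: le_trans (ip_cauchy_schwarz _ _ _) _.
rewrite nrm_abs // [leRHS]mulrAC [leRHS]mulrC ler_wpM2l ?ipnorm_ge0 //.
by rewrite -(nrm_abs hf); exact: Mop_dominated_bounded.
Qed.

End transition_operator.

(** * Uniform decay off the dominant eigenvector *)

Section spectral_gap.
Context {d : measure_display} {T : measurableType d} {R : realType}.
Variable Q : probability T R.
Local Notation H := (L2class Q).
Local Notation b := (L2ip Q).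
Local Notation n := (ipnorm (L2ip Q)).

Lemma L2_cst1 : L2 Q (cst 1).
Proof.
apply: L2P => //; under eq_integral do rewrite /= expr1n.
by rewrite integral_cst // mul1e -ge0_fin_numE // fin_num_measure.
Qed.

Lemma damped_integral (c : nat -> T -> R) (g : T -> R) (e : R) :
  (forall i, measurable_fun setT (c i)) -> (forall i x, 0 <= c i x <= 1) ->
  {ae Q, forall x, c i x @[i --> \oo] --> (0 : R)} ->
  Q.-integrable setT (EFin \o g) -> 0 < e ->
  exists N, forall i, (N <= i)%N -> \int[Q]_x (c i x * g x) <= e.
Proof.
move=> mc c01 c0 ig e0; have /integrableP[/measurable_EFinP mg _] := ig.
have mcg i : measurable_fun setT (fun x => (c i x * g x)%:E).
  by apply/measurable_EFinP; exact: measurable_funM.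
have [||||| _ _] := @dominated_convergence _ _ _ Q setT measurableT
    (fun i x => (c i x * g x)%:E) (cst 0%E) (fun x => `|g x|%:E).
- exact: mcg.
- exact: measurable_cst.
- apply: filterS c0 => x hx _; apply: cvg_EFin; first exact: nearW.
  rewrite -[X in _ --> X](mul0r (g x)); apply: cvgMr_tmp; exact: hx.
- exact: integrable_abse ig.
- apply: aeW => x i _; rewrite lee_fin normrM ler_piMl //.
  by have /andP[h1 h2] := c01 i x; rewrite ger0_norm.
rewrite /= integral0 => /fine_cvgP[_].
move=> /cvgr0_norm_lt /(_ _ e0)[N _ hN]; exists N => i hi.
apply: le_trans (ler_norm _) _; apply: ltW; exact: hN.
Qed.

Variables (op : {linear H -> H}) (phi phis : H) (B : R).
(** Throughout the section [op] stands for [M / rho]. This norm is controlled by the [L^2] norm, see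
    [weak_le]. *)
Definition weak_norm (u : H) : R := inner Q (fun x => `|u x|) phis.
Local Notation weak := weak_norm.

Hypothesis weak_contraction : forall u, weak (op u) <= weak u.
Hypotheses (B0 : 0 <= B) (op_bounded : forall u, n (op u) <= B * n u).
Hypothesis op_limit : forall u, b u phis = 0 ->
  {ae Q, forall x, iter i op u x @[i --> \oo] --> (0 : R)}.
Hypothesis op_finite_rank : forall e : R, 0 < e -> exists k (f : 'I_k -> H),
  (forall j, n (f j) <= 1) /\
  forall u, n (op u - \sum_j b (op u) (f j) *: f j) <= e * n u.
Hypotheses (op_phis : forall u, b (op u) phis = b u phis) (phi_phis : b phi phis = 1).
Hypothesis phis_pos : {ae Q, forall x, 0 < phis x}.

Lemma weakE u : weak u = b (cls Q (fun x => `|u x|)) phis.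
Proof.
by rewrite -[in RHS](cls_rep phis) L2ip_cls //; exact: L2_normP.
Qed.

Lemma weak_le u : weak u <= n u * n phis.
Proof.
rewrite weakE; apply: le_trans (ler_norm _) _; apply: le_trans (ip_cauchy_schwarz _ _ _) _.
by rewrite nrm_abs // cls_rep.
Qed.

Lemma weak_ge0 u : 0 <= weak u.
Proof.
have h0 : inner Q (cst 0) phis = 0.
  by rewrite /inner; under eq_Rintegral do rewrite mul0r; rewrite Rintegral_cst // mul0r.
rewrite -h0 /weak; apply: inner_ae_le => //; [exact: L2_cst0|exact: L2_normP|].
by apply: filterS phis_pos => x hx; rewrite mul0r mulr_ge0 // ltW.
Qed.

(** Split [f] at the level [N phis]. The part where [|f| > N phis] has norm at most [e] for large
    [N], because [phis > 0] makes these sets shrink to a null set; the rest is bounded by [N phis]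
    and pairs with [u] to at most [N weak u]. *)
Lemma ip_weak_bound (f : H) (e : R) : 0 < e ->
  exists2 K, 0 <= K & forall u, `|b u f| <= e * n u + K * weak u.
Proof.
move=> e0.
pose c i x : R := if i%:R * phis x < `|f x| then 1 else 0.
have mphis := L2_measurable (L2class_L2 phis).
have mf := L2_measurable (L2class_L2 f).
have mc i : measurable_fun setT (c i).
  apply: measurable_fun_ifT => //; apply: measurable_fun_ltr => //.
    by apply: measurable_funM.
  exact: measurableT_comp.
have c01 i x : 0 <= c i x <= 1 by rewrite /c; case: ifP; rewrite lexx ler01.
have cc i x : c i x ^+ 2 = c i x by rewrite /c; case: ifP; rewrite ?expr1n ?expr0n.
have c0 : {ae Q, forall x, c i x @[i --> \oo] --> (0 : R)}.
  apply: filterS phis_pos => x hx.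
  apply: cvg_near_cst; pose N := Num.bound (`|f x| / phis x).
  exists N => // i /= hi; rewrite /c ifF //; apply/negbTE; rewrite -leNgt.
  rewrite -ler_pdivrMr //; apply: le_trans (ltW (archi_boundP _)) _.
    by rewrite divr_ge0 // ltW.
  by rewrite ler_nat.
have e2 : 0 < e ^+ 2 by rewrite exprn_gt0.
have [N hN] := damped_integral mc c01 c0 (L2_sqr_integrable (L2class_L2 f)) e2.
pose f1 x := c N x * f x; pose f2 x := (1 - c N x) * f x.
have Lf1 : L2 Q f1.
  apply: (L2_le _ (L2class_L2 f)) => [|x]; first exact: measurable_funM.
  by rewrite normrM ler_piMl //; have /andP[h1 h2] := c01 N x; rewrite ger0_norm.
have Lf2 : L2 Q f2.
  apply: (L2_le _ (L2class_L2 f)) => [|x].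
    by apply: measurable_funM => //; exact: measurable_funB.
  rewrite normrM ler_piMl //; have /andP[h1 h2] := c01 N x.
  by rewrite ger0_norm ?subr_ge0 // lerBlDr lerDl.
have fE : f = cls Q f1 + cls Q f2.
  rewrite -clsD // -[LHS]cls_rep; congr cls; apply/funext => x.
  by rewrite /f1 /f2 /= -mulrDl addrC subrK mul1r.
have nf1 : n (cls Q f1) <= e.
  rewrite -(@ler_pXn2r _ 2) ?nnegrE ?ipnorm_ge0 ?(ltW e0) // sqr_ipnorm L2ip_cls //.
  apply: le_trans (hN N (leqnn N)); rewrite le_eqVlt; apply/orP; left; apply/eqP.
  by apply: eq_Rintegral => x _; rewrite /f1 -expr2 exprMn cc.
exists N%:R => // u; rewrite fE ipDr; apply: le_trans (ler_normD _ _) _; apply: lerD.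
  by apply: le_trans (ip_cauchy_schwarz _ _ _) _; rewrite mulrC ler_wpM2r ?ipnorm_ge0.
rewrite -[u in b u]cls_rep L2ip_cls //.
apply: le_trans (le_normr_Rintegral measurableT (L2_mul_integrable (L2class_L2 u) Lf2)) _.
have hu := L2_normP (L2class_L2 u).
have -> : \int[Q]_x `|u x * f2 x| = inner Q (fun x => `|f2 x|) (fun x => `|u x|).
  by apply: eq_Rintegral => x _; rewrite normrM mulrC.
have -> : N%:R * weak u = inner Q (fun x => N%:R * phis x) (fun x => `|u x|).
  by rewrite innerZl // /weak innerC.
apply: inner_ae_le => //; [exact: L2_normP | exact: L2_scaleP |].
apply: filterS phis_pos => x hx; rewrite ler_wpM2r // /f2 /c.
by case: ltP => h; rewrite ?subrr ?mul0r ?normr0 ?subr0 ?mul1r // mulr_ge0 // ltW.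
Qed.

(** Up to [e / 2] times the norm of [u], [op u] is recovered from finitely many of its inner
    products, and [ip_weak_bound] controls each of them; [weak (op u)] is then replaced by
    [weak u]. *)
Lemma ehrling (e : R) : 0 < e ->
  exists2 K, 0 <= K & forall u, n (op u) <= e * n u + K * weak u.
Proof.
move=> e0; have e2 : 0 < e / 2 by rewrite divr_gt0.
have [k [f [nf hf]]] := op_finite_rank e2.
(* With this [e'] the [k] inner products cost [e / 2] in all, after the factor [B] lost in passing
   to [op u]; [k + 1] and [B + 1] avoid a division by 0. *)
pose e' := e / 2 / (k.+1%:R * (B + 1)).
have B1 : 0 < B + 1 by rewrite ltr_wpDl.
have e'0 : 0 < e' by rewrite !divr_gt0 // mulr_gt0.
have /choice[K hK] : forall j, exists K, 0 <= K /\ forall u, `|b u (f j)| <= e' * n u + K * weak u.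
  by move=> j; have [K K0 hK] := ip_weak_bound (f j) e'0; exists K.
exists (\sum_j K j) => [|u]; first by apply: sumr_ge0 => j _; have [] := hK j.
have h1 : n (op u) <= e / 2 * n u + \sum_j `|b (op u) (f j)|.
  rewrite -(subrK (\sum_j b (op u) (f j) *: f j) (op u)).
  apply: le_trans (ipnormD _ _ _) _; rewrite subrK; apply: lerD; first exact: hf.
  apply: le_trans (ipnorm_sum _ _ _ _) _; apply: ler_sum => j _.
  by rewrite ipnormZ ler_piMr.
have h2 : \sum_j `|b (op u) (f j)| <= \sum_(j < k) (e' * (B * n u) + K j * weak u).
  apply: ler_sum => j _; have [K0 h] := hK j; apply: le_trans (h _) _.
  by apply: lerD; [rewrite ler_wpM2l // ltW | rewrite ler_wpM2l].
have h3 : \sum_(j < k) (e' * (B * n u) + K j * weak u) <= e / 2 * n u + (\sum_j K j) * weak u.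
  have eK : \sum_j K j * weak u = (\sum_j K j) * weak u by rewrite mulr_suml.
  rewrite big_split /= eK lerD2r sumr_const card_ord -[_ *+ k]mulr_natl mulrA mulrA.
  rewrite ler_wpM2r ?ipnorm_ge0 //.
  apply: le_trans (_ : k.+1%:R * e' * (B + 1) <= _); last first.
    by rewrite mulrAC mulrC divfK // mulf_neq0 // gt_eqF.
  have ke0 : 0 <= k%:R * e' by rewrite mulr_ge0 // ltW.
  by apply: ler_pM => //; [rewrite ler_wpM2r ?ler_nat // ltW | rewrite lerDl].
by apply: le_trans h1 _; move: h2 h3; lra.
Qed.

Lemma weak_iter i u : weak (iter i op u) <= weak u.
Proof. by elim: i => //= i IH; apply: le_trans IH. Qed.

(** [ehrling] with [e = 1/2] gives [|op^(i+1) u| <= |op^i u| / 2 + K weak u], a recursion that stays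
    below [|u| + 2 K weak u]. *)
Lemma power_bounded : exists2 D, 0 <= D & forall i u, n (iter i op u) <= D * n u.
Proof.
have h2 : 0 < 2^-1 :> R by rewrite invr_gt0.
have [K K0 hK] := ehrling h2.
exists (1 + 2 * K * n phis) => [|i u]; first by rewrite addr_ge0 // !mulr_ge0 ?ipnorm_ge0.
apply: le_trans (_ : n u + 2 * K * weak u <= _); last first.
  rewrite [leRHS]mulrDl mul1r lerD2l -!mulrA ler_wpM2l // ler_wpM2l // mulrC; exact: weak_le.
elim: i => [|i IH] /=; first by rewrite lerDl !mulr_ge0 ?weak_ge0.
have := hK (iter i op u); have : K * weak (iter i op u) <= K * weak u by rewrite ler_wpM2l // weak_iter.
by have := ipnorm_ge0 b u; lra.
Qed.

(** The iterates [v] converge almost everywhere but have no common majorant. With [c = min(|v|, 1)]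
    one has [|v| <= c + |v| c]: the first term is dominated, and the second integrates against
    [phis] to at most the norm of [v], bounded by [power_bounded], times the norm of [c phis], which
    tends to 0. *)
Lemma weak_iter_cvg0 u (e : R) : b u phis = 0 -> 0 < e ->
  exists N, forall i, (N <= i)%N -> weak (iter i op u) <= e.
Proof.
move=> hu e0; have [D D0 hD] := power_bounded.
pose v i := iter i op u.
pose c i x : R := Num.min `|v i x| 1.
have mphis := L2_measurable (L2class_L2 phis).
have mc i : measurable_fun setT (c i).
  apply: measurable_minr => //; apply: measurableT_comp => //.
  exact: L2_measurable (L2class_L2 (v i)).
have c01 i x : 0 <= c i x <= 1 by rewrite /c le_min normr_ge0 ler01 ge_min lexx orbT.
have c0 : {ae Q, forall x, c i x @[i --> \oo] --> (0 : R)}.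
  apply: filterS (op_limit hu) => x hx.
  apply/cvgr0Pnorm_lt => t t0; move/cvgr0Pnorm_lt : hx => /(_ _ t0)[N _ hN].
  exists N => // i /= hi; apply: le_lt_trans (hN i hi).
  by have /andP[h _] := c01 i x; rewrite ger0_norm // /c ge_min lexx.
have iphis : Q.-integrable setT (EFin \o phis).
  have := L2_mul_integrable L2_cst1 (L2class_L2 phis).
  by apply: eq_integrable => // x _; rewrite /= mul1r.
pose t := e / 2 / (1 + D * n u).
have D1 : 0 < 1 + D * n u by rewrite ltr_pwDl // mulr_ge0 // ipnorm_ge0.
have t0 : 0 < t by rewrite !divr_gt0.
have e2 : 0 < e / 2 by rewrite divr_gt0.
have t2 : 0 < t ^+ 2 by rewrite exprn_gt0.
have [N1 h1] := damped_integral mc c01 c0 iphis e2.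
have [N2 h2] := damped_integral mc c01 c0 (L2_sqr_integrable (L2class_L2 phis)) t2.
exists (maxn N1 N2) => i; rewrite geq_max => /andP[i1 i2].
have Lc : L2 Q (fun x => c i x * phis x).
  apply: (L2_le _ (L2class_L2 phis)) => [|x]; first exact: measurable_funM.
  by rewrite normrM ler_piMl //; have /andP[z1 z2] := c01 i x; rewrite ger0_norm.
have Lv := L2_normP (L2class_L2 (v i)).
have h3 : inner Q (fun x => `|v i x|) (fun x => c i x * phis x) <= e / 2.
  rewrite -L2ip_cls //; apply: le_trans (ler_norm _) _.
  apply: le_trans (ip_cauchy_schwarz _ _ _) _; rewrite nrm_abs // cls_rep.
  apply: le_trans (_ : (D * n u) * t <= _).
    apply: ler_pM; rewrite ?ipnorm_ge0 //; first exact: hD.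
    rewrite -(@ler_pXn2r _ 2) ?nnegrE ?ipnorm_ge0 ?(ltW t0) // sqr_ipnorm L2ip_cls //.
    apply: le_trans (h2 i i2); apply: le_Rintegral => //.
    - exact: L2_mul_integrable.
    - apply: (le_integrable measurableT _ _ (L2_sqr_integrable (L2class_L2 phis))).
        by apply/measurable_EFinP/measurable_funM => //; exact: measurable_funX.
      move=> x _; rewrite /= lee_fin normrM ler_piMl //.
      by have /andP[z1 z2] := c01 i x; rewrite ger0_norm.
    - move=> x _; rewrite -expr2 exprMn ler_wpM2r ?sqr_ge0 // expr2.
      by have /andP[z1 z2] := c01 i x; rewrite ler_piMl.
  apply: le_trans (_ : (1 + D * n u) * t <= _).
    by rewrite ler_wpM2r ?(ltW t0) // lerDr.
  by rewrite mulrC divfK // gt_eqF.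
have h4 := h1 i i1.
have Lci : L2 Q (c i).
  apply: (L2_le _ L2_cst1) => // x; rewrite normr1; have /andP[z1 z2] := c01 i x.
  by rewrite ger0_norm.
have Lvc : L2 Q (fun x => `|v i x| * c i x).
  apply: (L2_le _ Lv) => [|x].
    by apply: measurable_funM => //; exact: L2_measurable Lv.
  by rewrite normrM ler_piMr //; have /andP[z1 z2] := c01 i x; rewrite ger0_norm.
have h5 : weak (v i) <= inner Q (c i \+ (fun x => `|v i x| * c i x)) phis.
  apply: inner_ae_le => //; first exact: L2_addP.
  apply: filterS phis_pos => x hx /=; rewrite ler_wpM2r ?(ltW hx) // /c.
  have [h|h] := leP `|v i x| 1; first by rewrite lerDl mulr_ge0.
  by rewrite mulr1 lerDr.
apply: le_trans h5 _; rewrite innerDl //.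
have -> : inner Q (fun x => `|v i x| * c i x) phis = inner Q (fun x => `|v i x|) (fun x => c i x * phis x).
  by apply: eq_Rintegral => x _; rewrite mulrA.
by move: h3 h4; rewrite /inner; lra.
Qed.

(** One more application of [op] and [ehrling] turn weak decay into norm decay: the strong term is
    small because the iterates are bounded, the weak one because it tends to 0. *)
Lemma iter_cvg0 u (e : R) : b u phis = 0 -> 0 < e ->
  exists N, forall i, (N <= i)%N -> n (iter i op u) <= e.
Proof.
move=> hu e0; have [D D0 hD] := power_bounded.
pose e1 := e / 2 / (1 + D * n u).
have D1 : 0 < 1 + D * n u by rewrite ltr_pwDl // mulr_ge0 // ipnorm_ge0.
have e10 : 0 < e1 by rewrite !divr_gt0.
have [K K0 hK] := ehrling e10.
have K1 : 0 < 1 + K by rewrite ltr_pwDl.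
have e20 : 0 < e / 2 / (1 + K) by rewrite !divr_gt0.
have [N hN] := weak_iter_cvg0 hu e20.
exists N.+1 => -[//|i] hi; rewrite iterS; apply: le_trans (hK _) _.
have h1 : e1 * n (iter i op u) <= e / 2.
  apply: le_trans (_ : e1 * (1 + D * n u) <= _); last by rewrite divfK // gt_eqF.
  by rewrite ler_wpM2l ?(ltW e10) //; apply: le_trans (hD i u) _; rewrite lerDr.
have h2 : K * weak (iter i op u) <= e / 2.
  apply: le_trans (_ : (1 + K) * (e / 2 / (1 + K)) <= _); last by rewrite mulrC divfK // gt_eqF.
  apply: ler_pM => //; [exact: weak_ge0 | by rewrite lerDr | exact: hN].
by move: h1 h2; lra.
Qed.

(** Up to a small multiple of the norm of [u], [op u] is a combination of the finitely many [f j],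
    so the decay of their projections, known vector by vector, becomes uniform in [u]. With [e] and
    [eta] as chosen, the remainder and the finite sum each contribute at most a quarter. *)
Lemma uniform_decay : exists2 J, (0 < J)%N &
  forall u, b u phis = 0 -> n (iter J op u) <= 2^-1 * n u.
Proof.
have [D D0 hD] := power_bounded.
pose q := 1 + n phis * n phi.
have q0 : 0 < q by rewrite ltr_pwDl // mulr_ge0 ?ipnorm_ge0.
pose e := (4 * (1 + D) * q)^-1.
have D1 : 0 < 1 + D by rewrite ltr_pwDl.
have e0 : 0 < e by rewrite invr_gt0 !mulr_gt0.
have [k [f [nf hf]]] := op_finite_rank e0.
pose eta := (4 * k.+1%:R * (1 + B))^-1.
have B1 : 0 < 1 + B by rewrite ltr_pwDl.
have eta0 : 0 < eta by rewrite invr_gt0 !mulr_gt0.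
pose proj u := u - b u phis *: phi.
have projK u : b (proj u) phis = 0 by rewrite /proj ipBl ipZl phi_phis mulr1 subrr.
have nproj u : n (proj u) <= q * n u.
  apply: le_trans (ipnorm_triangleB _ _ _) _; rewrite ipnormZ mulrDl mul1r lerD2l.
  by rewrite mulrAC ler_wpM2r ?ipnorm_ge0 // mulrC ip_cauchy_schwarz.
have projD u v : proj (u + v) = proj u + proj v.
  by rewrite /proj ipDl scalerDl opprD addrACA.
have projZ c u : proj (c *: u) = c *: proj u by rewrite /proj ipZl scalerBr scalerA.
have proj_sum (F : 'I_k -> H) : proj (\sum_j F j) = \sum_j proj (F j).
  apply: (big_morph proj projD); rewrite /proj ip0l scale0r subrr //.
have /choice[N hN] : forall j, exists N, forall i, (N <= i)%N -> n (iter i op (proj (f j))) <= eta.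
  by move=> j; exact: iter_cvg0.
pose M := (\max_j N j)%N.
have iter_sum (F : 'I_k -> H) : iter M op (\sum_j F j) = \sum_j iter M op (F j).
  apply: (big_morph _ (iter_linearD op M)); elim: M => //= i ->; exact: linear0.
exists M.+1 => // u hu.
pose g := \sum_j b (op u) (f j) *: f j.
(* [op u] is its own projection, being annihilated by [phis]; splitting the projection keeps the
   finite combination in the complement, where iterates decay. *)
have hTu : op u = proj g + proj (op u - g).
  by rewrite -projD addrC subrK /proj op_phis hu scale0r subr0.
rewrite iterSr hTu iter_linearD; apply: le_trans (ipnormD _ _ _) _.
have h2 : n (iter M op (proj (op u - g))) <= 4^-1 * n u.
  apply: le_trans (hD _ _) _; apply: le_trans (_ : (1 + D) * (q * (e * n u)) <= _).
    apply: ler_pM; rewrite ?ipnorm_ge0 ?lerDr //.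
    by apply: le_trans (nproj _) _; rewrite ler_wpM2l ?(ltW q0) //; exact: hf.
  have -> : (1 + D) * (q * (e * n u)) = 4^-1 * n u.
    by rewrite /e; field; rewrite !gt_eqF.
  by [].
have h1 : n (iter M op (proj g)) <= 4^-1 * n u.
  rewrite /g proj_sum iter_sum; apply: le_trans (ipnorm_sum _ _ _ _) _.
  apply: le_trans (_ : \sum_(j < k) (B * n u) * eta <= _).
    apply: ler_sum => j _; rewrite projZ iter_linearZ ipnormZ.
    apply: ler_pM; rewrite ?ipnorm_ge0 //.
      apply: le_trans (ip_cauchy_schwarz _ _ _) _.
      by apply: le_trans (_ : n (op u) <= _); rewrite ?ler_piMr ?ipnorm_ge0.
    by apply: hN; rewrite /M (leq_bigmax j).
  rewrite sumr_const card_ord -[_ *+ k]mulr_natl.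
  apply: le_trans (_ : k.+1%:R * ((1 + B) * n u * eta) <= _).
    apply: ler_pM; rewrite ?ler_nat ?mulr_ge0 ?ipnorm_ge0 ?(ltW eta0) //.
    by rewrite ler_wpM2r ?(ltW eta0) // ler_wpM2r ?ipnorm_ge0 // lerDr.
  rewrite le_eqVlt; apply/orP; left; apply/eqP.
  by rewrite /eta; field; rewrite !gt_eqF.
apply: le_trans (lerD h1 h2) _; rewrite -mulrDl (_ : 4^-1 + 4^-1 = 2^-1) //; by field.
Qed.

End spectral_gap.

(** * The spectral gap *)

Lemma bernoulli_inequality (R : realFieldType) (x : R) (j : nat) :
  0 <= x -> x <= 1 -> 1 - j%:R * x <= (1 - x) ^+ j.
Proof.
move=> x0 x1; elim: j => [|j IH]; first by rewrite mul0r subr0 expr0.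
rewrite exprS; apply: le_trans (_ : (1 - x) * (1 - j%:R * x) <= _); last first.
  by rewrite ler_wpM2l // subr_ge0.
have : 0 <= j%:R * x ^+ 2 by rewrite mulr_ge0 // sqr_ge0.
rewrite -natr1 expr2; lra.
Qed.

Section adapted_norm.
Context {d : measure_display} {T : measurableType d} {R : realType}.
Variables (Q : probability T R) (P1 : R.-pker T ~> T) (nu : probability (T * T)%type R).
Hypothesis hnu : pair_law Q P1 nu.
Hypothesis hsnd : forall B, measurable B -> nu (setT `*` B) = Q B.
Variable m : T * T -> R.
Hypotheses (m_meas : measurable_fun setT m) (m_pos : forall z, 0 < m z).
Variables (rho : R) (phi phis : T -> R).
Hypothesis A1 : principal_eigenpair Q P1 m rho phi phis.
Hypothesis phi_phis : inner Q phi phis = 1.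

Local Notation H := (L2class Q).
Local Notation b := (L2ip Q).
Local Notation n := (ipnorm (L2ip Q)).
Local Notation phiH := (cls Q phi).
Local Notation phisH := (cls Q phis).

Let mb : Mbounded Q P1 m := pe_bounded A1.
Let dm : dominated_by m 1 m := dominated_self m_meas m_pos.
Let rho0 : 0 < rho := pe_rho A1.
Let Lphi : L2 Q phi := pe_phi_L2 A1.
Let Lphis : L2 Q phis := pe_phis_L2 A1.

Definition pack_linear (E F : lmodType R) (f : E -> F) (lf : linear f) : {linear E -> F} :=
  HB.pack f (GRing.isLinear.Build R E F *:%R f lf).

Definition transition_class : {linear H -> H} :=
  pack_linear (class_op_linear hnu hsnd m_pos mb dm).
Local Notation M := transition_class.

Lemma transition_classE u : M u = class_op P1 m u.
Proof. by []. Qed.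

Lemma transition_class_bounded u : n (M u) <= op_bound Q P1 m * n u.
Proof.
rewrite transition_classE -[X in class_op _ _ X]cls_rep (class_op_cls hnu hsnd m_pos mb dm) //.
by rewrite -{2}(cls_rep u); exact: (Mop_bounded m_meas m_pos mb).
Qed.

Lemma transition_class_phi : M phiH = rho *: phiH.
Proof.
rewrite transition_classE (class_op_cls hnu hsnd m_pos mb dm) // -clsZ //.
apply: cls_eq; [exact: (L2_Mop m_pos mb dm) | exact: L2_scaleP | exact: pe_phi_eigen A1].
Qed.

Lemma transition_class_phis u : b (M u) phisH = rho * b u phisH.
Proof.
have [h1 h2] := pe_phis_eigen A1.
have LMu : L2 Q (Mop P1 m u) by exact: (L2_Mop m_pos mb dm).
rewrite transition_classE /class_op L2ip_cls // h2 //.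
by rewrite -[in RHS](cls_rep u) L2ip_cls // innerC innerZl // innerC.
Qed.

Lemma ip_phi_phis : b phiH phisH = 1.
Proof. by rewrite L2ip_cls. Qed.

Hypothesis finite_rank : forall e : R, 0 < e -> exists k (f : 'I_k -> H),
  (forall j, n (f j) <= 1) /\
  forall u, n (M u - \sum_j b (M u) (f j) *: f j) <= e * n u.

Let op_fun (u : H) : H := rho^-1 *: M u.
Let op_linear : linear op_fun.
Proof. by move=> c u v; rewrite /op_fun linearD linearZ /= scalerDr !scalerA mulrC. Qed.
Let op : {linear H -> H} := pack_linear op_linear.

Let opE u : op u = rho^-1 *: M u. Proof. by []. Qed.

Let iter_opE i u : iter i op u = rho ^- i *: iter i M u.
Proof.
elim: i => [|i IH]; first by rewrite /= expr0 invr1 scale1r.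
by rewrite iterS IH opE iterS linearZ /= scalerA -invfM -exprS.
Qed.

Let ae_phis : {ae Q, forall x, 0 < phisH x}.
Proof. by apply: filterS2 (clsP Lphis) (pe_phis_pos A1) => x ->. Qed.

Let abs_op u : {ae Q, forall x, `|M u x| <= Mop P1 m (fun y => `|u y|) x}.
Proof.
have LMu : L2 Q (Mop P1 m u) by exact: (L2_Mop m_pos mb dm).
apply: filterS2 (clsP LMu) (Mop_dominated m_pos mb dm (L2class_L2 u)) => x.
by rewrite transition_classE /class_op => -> h; rewrite mul1r in h.
Qed.

Let weak_contraction u : weak_norm phisH (op u) <= weak_norm phisH u.
Proof.
have [h1 h2] := pe_phis_eigen A1.
have hu := L2_normP (L2class_L2 u).
have LMu : L2 Q (Mop P1 m (fun y => `|u y|)) by exact: (L2_Mop m_pos mb dm).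
have -> : weak_norm phisH u = rho^-1 * inner Q (Mop P1 m (fun y => `|u y|)) phisH.
  rewrite /weak_norm.
  rewrite (inner_ae LMu (L2class_L2 phisH) LMu Lphis (aeeq_refl _ _) (clsP Lphis)).
  rewrite h2 // [inner Q _ (fun x => rho * phis x)]innerC innerZl // [inner Q phis _]innerC mulKf ?gt_eqF //.
  exact: (inner_ae hu (L2class_L2 phisH) hu Lphis (aeeq_refl _ _) (clsP Lphis)).
rewrite -innerZl // /weak_norm; apply: inner_ae_le => //.
- exact: L2_normP.
- exact: L2_scaleP.
apply: filterS3 (L2class_scaleE rho^-1 (M u)) (abs_op u) ae_phis => x e1 e2 e3.
rewrite ler_wpM2r ?(ltW e3) // opE e1 normrM ger0_norm ?invr_ge0 ?(ltW rho0) //.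
by rewrite ler_wpM2l // invr_ge0 ltW.
Qed.

Let op_limit u : b u phisH = 0 -> {ae Q, forall x, iter i op u x @[i --> \oo] --> (0 : R)}.
Proof.
move=> hu.
have LM i : L2 Q (iter i (Mop P1 m) u) by elim: i => //= i; exact: (L2_Mop m_pos mb dm).
have e i : iter i M u = cls Q (iter i (Mop P1 m) u).
  elim: i => [|i IH]; first by rewrite /= cls_rep.
  by rewrite iterS IH transition_classE (class_op_cls hnu hsnd m_pos mb dm).
have ae i : aeeq Q (iter i op u) (fun x => rho ^- i * iter i (Mop P1 m) u x).
  rewrite iter_opE e -clsZ //; apply: clsP; exact: L2_scaleP.
have := pe_limit A1 ltr01 ltr01.
have -> : inner Q (1 \*o phi) (1 \*o phis) = 1.
  by rewrite -[RHS]phi_phis; apply: eq_Rintegral => x _; rewrite /= !mul1r.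
move=> /(_ erefl _ (L2class_L2 u)) hlim.
have /ae_foralln hall := ae.
apply: filterS2 hlim hall => x h1 h2.
have -> : (fun i => iter i op u x) = (fun i => rho ^- i * iter i (Mop P1 m) u x).
  by apply/funext => i; exact: h2.
suff e0 : inner Q u (1 \*o phis) = 0 by move: h1; rewrite e0 mul0r.
rewrite -[RHS]hu -[in RHS](cls_rep u) L2ip_cls //.
by apply: eq_Rintegral => y _; rewrite /= mul1r.
Qed.

Theorem adapted_norm_exists : exists (a : semi_ip H) (kap K : R),
  [/\ 0 <= kap /\ kap < rho, 0 <= K, forall u, n u <= ipnorm a u,
    forall u, ipnorm a u <= K * n u &
    forall u, b u phisH = 0 -> ipnorm a (M u) <= kap * ipnorm a u].
Proof.
have ri0 : 0 <= rho^-1 by rewrite invr_ge0 ltW.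
have B0 := op_bound_ge0 Q P1 m.
have [||||J J0 hJ] := @uniform_decay _ _ _ Q op phiH phisH (rho^-1 * op_bound Q P1 m)
   weak_contraction _ _ op_limit _ _ ip_phi_phis ae_phis.
- exact: mulr_ge0.
- move=> u; rewrite opE ipnormZ ger0_norm // -mulrA ler_wpM2l //.
  exact: transition_class_bounded.
- move=> e e0; have [k [f [nf hf]]] := finite_rank (mulr_gt0 rho0 e0).
  exists k, f; split => // u.
  have -> : op u - \sum_j b (op u) (f j) *: f j =
      rho^-1 *: (M u - \sum_j b (M u) (f j) *: f j).
    rewrite scalerBr scaler_sumr; congr (_ - _); apply: eq_bigr => j _.
    by rewrite opE ipZl scalerA.
  rewrite ipnormZ ger0_norm // ler_pdivrMl // mulrA; exact: hf.
- by move=> u; rewrite opE ipZl transition_class_phis mulKf // gt_eqF.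
have JR : 0 < J%:R :> R by rewrite ltr0n.
(* By Bernoulli's inequality [(1 - x)^J >= 1 - J x = 1/2], so a halving after [J] steps is a
   contraction by at most [kap^J] with [kap = rho (1 - x)], and no root has to be extracted. *)
pose x : R := (2 * J%:R)^-1.
have x0 : 0 < x by rewrite invr_gt0 mulr_gt0.
have x1 : x <= 2^-1.
  rewrite /x invfM ler_piMr ?invr_ge0 // invf_le1 // ler1n //.
pose kap := rho * (1 - x).
have kap0 : 0 < kap by rewrite mulr_gt0 // subr_gt0; apply: le_lt_trans x1 _; rewrite invf_lt1 // ltr1n.
have kap1 : kap < rho by rewrite /kap gtr_pMr // gtrBl.
have hk u : b u phisH = 0 -> n (iter J M u) <= kap ^+ J * n u.
  move=> hu; have := hJ u hu; rewrite iter_opE ipnormZ.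
  rewrite ger0_norm ?invr_ge0 ?exprn_ge0 ?(ltW rho0) // ler_pdivrMl ?exprn_gt0 //.
  move=> h; apply: le_trans h _; rewrite mulrA ler_wpM2r ?ipnorm_ge0 // /kap exprMn.
  rewrite ler_wpM2l ?exprn_ge0 ?(ltW rho0) //.
  apply: le_trans (bernoulli_inequality J (ltW x0) _); last first.
    by apply: le_trans x1 _; rewrite invf_le1 // ler1n.
  rewrite /x; have -> : 1 - J%:R * (2 * J%:R)^-1 = 2^-1 :> R by field; rewrite gt_eqF.
  by [].
have [a ha] := adapted_ip_axioms b M J kap0.
have [K K0 hK] := adapted_ip_upper J kap0 transition_class_bounded B0.
exists a, kap, K; split => //.
- by split => //; exact: ltW.
- by move=> u; rewrite /ipnorm ler_sqrt ?ip_ge0 // ha; exact: adapted_ip_lower.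
- move=> u; rewrite -(@ler_pXn2r _ 2) ?nnegrE ?mulr_ge0 ?ipnorm_ge0 //.
  by rewrite exprMn !sqr_ipnorm ha.
- move=> u hu; rewrite -(@ler_pXn2r _ 2) ?nnegrE ?ipnorm_ge0 //; last first.
    by apply: mulr_ge0; [exact: ltW | exact: ipnorm_ge0].
  rewrite exprMn !sqr_ipnorm !ha; apply: adapted_ip_contraction => //; exact: hk.
Qed.

End adapted_norm.

(** * Exponential submodels *)

Section exp_bounds.
Variable R : realType.
Implicit Types (s x : R).

Lemma expR_sub1_le s : `|expR s - 1| <= `|s| * expR `|s|.
Proof.
have h1 : s <= expR s - 1 by rewrite lerBrDl expR_ge1Dx.
have h2 : expR s - 1 <= s * expR s.
  have := expR_ge1Dx (- s); rewrite -(ler_pM2r (expR_gt0 s)) mulrDl mul1r.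
  by rewrite mulNr -expRD addNr expR0; lra.
have e1 : 1 <= expR `|s| by rewrite -expR0 ler_expR.
have e2 : expR s <= expR `|s| by rewrite ler_expR ler_norm.
have [s0|s0] := leP 0 s.
  rewrite ger0_norm ?subr_ge0; last by rewrite -expR0 ler_expR.
  by apply: le_trans h2 _; rewrite (ger0_norm s0).
rewrite ler0_norm; last by rewrite subr_le0 -expR0 ler_expR ltW.
apply: le_trans (_ : `|s| * 1 <= _); last by rewrite ler_wpM2l.
by rewrite mulr1 (ltr0_norm s0) lerN2.
Qed.

Lemma expR_sub1_sub_le s : `|expR s - 1 - s| <= s ^+ 2 * expR `|s|.
Proof.
have h1 : 0 <= expR s - 1 - s by rewrite subr_ge0 lerBrDl expR_ge1Dx.
have h2 : expR s - 1 - s <= s * (expR s - 1).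
  have := expR_ge1Dx (- s); rewrite -(ler_pM2r (expR_gt0 s)) mulrDl mul1r.
  by rewrite mulNr -expRD addNr expR0; lra.
rewrite ger0_norm //; apply: le_trans h2 _; apply: le_trans (ler_norm _) _.
rewrite normrM -real_normK ?num_real // expr2 -mulrA ler_wpM2l //.
exact: expR_sub1_le.
Qed.

End exp_bounds.

Section prob_integral.
Context {d : measure_display} {T : measurableType d} {R : realType}.
Variable mu : {measure set T -> \bar R}.
Hypothesis mu1 : mu setT = 1%E.

Lemma bounded_integrable (h : T -> R) K : measurable_fun setT h ->
  (forall y, `|h y| <= K) -> mu.-integrable setT (EFin \o h).
Proof.
move=> mh hK; apply/integrableP; split; first exact/measurable_EFinP.
apply: (@le_lt_trans _ _ (\int[mu]_y (cst K%:E) y)%E).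
  apply: ge0_le_integral => //; first by apply: measurableT_comp => //; exact/measurable_EFinP.
  by move=> y _; rewrite lee_fin.
by rewrite integral_cst // mu1 mule1 ltry.
Qed.

Lemma prob_integral_close (h : T -> R) (a e : R) : measurable_fun setT h ->
  (forall y, `|h y - a| <= e) -> `|\int[mu]_y h y - a| <= e.
Proof.
move=> mh he.
have ih : mu.-integrable setT (EFin \o h).
  apply: (@bounded_integrable _ (`|a| + e)) => // y.
  rewrite -(subrK a (h y)) addrC; apply: le_trans (ler_normD _ _) _.
  by rewrite lerD2l.
have ia : mu.-integrable setT (EFin \o (cst a : T -> R)) by exact: (@bounded_integrable _ `|a|).
have -> : \int[mu]_y h y - a = \int[mu]_y (h y - a).
  by rewrite RintegralB // Rintegral_cst // mu1 mulr1.
have id : mu.-integrable setT (EFin \o (fun y => h y - a)).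
  by apply: (@bounded_integrable _ e) => //; exact: measurable_funB.
apply: le_trans (le_normr_Rintegral measurableT id) _.
have -> : e = \int[mu]_(y in setT) e by rewrite Rintegral_cst // mu1 mulr1.
apply: le_Rintegral => //.
- by have := integrable_abse id; apply: eq_integrable => // y _.
- by apply: (@bounded_integrable (cst e) `|e|).
Qed.

(** Jensen's inequality, from the tangent of the square at the mean [c]: [2 c h - c^2 <= h^2]. The
    right side may be infinite, hence the extended reals. *)
Lemma prob_integral_sqr_le (h : T -> R) : mu.-integrable setT (EFin \o h) ->
  (((\int[mu]_y h y) ^+ 2)%:E <= \int[mu]_y (h y ^+ 2)%:E)%E.
Proof.
move=> ih; have /integrableP[/measurable_EFinP mh _] := ih.
set c := \int[mu]_y h y.
have mh2 : measurable_fun setT (fun y => (h y ^+ 2)%:E).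
  by apply/measurable_EFinP; exact: measurable_funX.
have [f|] := boolP ((\int[mu]_y (h y ^+ 2)%:E)%E \is a fin_num); last first.
  rewrite ge0_fin_numE; last by apply: integral_ge0 => y _; rewrite lee_fin sqr_ge0.
  by rewrite -leNgt leye_eq => /eqP ->; exact: leey.
have ih2 : mu.-integrable setT (EFin \o (fun y => h y ^+ 2)).
  apply/integrableP; split => //.
  have -> : (\int[mu]_y `|(EFin \o (fun y => (h y ^+ 2)%R)) y| = \int[mu]_y (h y ^+ 2)%:E)%E.
    by apply: eq_integral => y _; rewrite /= ger0_norm // sqr_ge0.
  by rewrite -ge0_fin_numE //; apply: integral_ge0 => y _; rewrite lee_fin sqr_ge0.
rewrite -(fineK f) lee_fin -[leRHS]/(\int[mu]_y (h y ^+ 2)).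
have ic : mu.-integrable setT (EFin \o (cst (c ^+ 2) : T -> R)).
  exact: (@bounded_integrable _ `|c ^+ 2|).
have i2 : mu.-integrable setT (EFin \o (fun y => 2 * c * h y)).
  by have := integrableZl measurableT (2 * c) ih; apply: eq_integrable => // y _.
have -> : c ^+ 2 = \int[mu]_y (2 * c * h y - c ^+ 2).
  by rewrite RintegralB // RintegralZl // Rintegral_cst // mu1 mulr1 -/c; ring.
apply: le_Rintegral => //.
- have := integrableB measurableT i2 ic; by apply: eq_integrable => // y _.
- by move=> y _; have := sqr_ge0 (h y - c); rewrite !expr2; lra.
Qed.

End prob_integral.

Section submodel_density_bounds.
Context {d : measure_display} {T : measurableType d} {R : realType}.
Variables (P1 : R.-pker T ~> T) (g : T * T -> R) (C : R).
Hypotheses (mg : measurable_fun setT g) (gC : forall z, `|g z| <= C).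

Let C0 : 0 <= C. Proof. exact: le_trans (gC (point, point)). Qed.
Let L : R := expR C.
Let L1 : 1 <= L. Proof. by rewrite /L -expR0 ler_expR. Qed.
Let L0 : 0 < L. Proof. exact: expR_gt0. Qed.

Variable tau : R.
Hypothesis tau1 : `|tau| <= 1.

(** The normalising constant of the submodel at [x], that is the exponential of [log_mgf]. It stays
    above [L^-1], so its logarithm and its inverse are under control. *)
Let I x := \int[P1 x]_y expR (tau * g (x, y)).

Let tgC z : `|tau * g z| <= C.
Proof. by rewrite normrM -[leRHS]mul1r ler_pM. Qed.

Let eL z : expR `|tau * g z| <= L. Proof. by rewrite ler_expR. Qed.

Let e1 z : `|expR (tau * g z) - 1| <= `|tau| * (C * L).
Proof.
apply: le_trans (expR_sub1_le _) _; rewrite mulrA; apply: ler_pM => //.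
by rewrite normrM ler_wpM2l.
Qed.

Let e2 z : `|expR (tau * g z) - 1 - tau * g z| <= tau ^+ 2 * (C ^+ 2 * L).
Proof.
apply: le_trans (expR_sub1_sub_le _) _; rewrite mulrA; apply: ler_pM => //.
  exact: sqr_ge0.
rewrite -real_normK ?num_real // normrM exprMn real_normK ?num_real //.
by rewrite ler_wpM2l ?sqr_ge0 // lerXn2r ?nnegrE.
Qed.

Let mgx x : measurable_fun setT (fun y => g (x, y)).
Proof. exact: (measurableT_comp mg (pair1_measurable x)). Qed.

Let mex x : measurable_fun setT (fun y => expR (tau * g (x, y))).
Proof. by apply: measurableT_comp => //; apply: measurable_funM. Qed.

Let I_close x : `|I x - 1| <= `|tau| * (C * L).
Proof. exact: (prob_integral_close (prob_kernel x) (mex x)). Qed.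

Let I_ge x : L^-1 <= I x.
Proof.
have i1 : (P1 x).-integrable setT (EFin \o (cst L^-1 : T -> R)).
  exact: (bounded_integrable (K := `|L^-1|) (prob_kernel x)).
have -> : L^-1 = \int[P1 x]_(y in setT) L^-1.
  by rewrite Rintegral_cst // prob_kernel mulr1.
apply: le_Rintegral => //.
  apply: (bounded_integrable (K := L) (prob_kernel x)) => // y.
  by rewrite ger0_norm ?expR_ge0 // ler_expR (le_trans (ler_norm _)).
move=> y _; rewrite /L -expRN ler_expR lerNl; apply: le_trans (tgC (x, y)).
by rewrite -normrN ler_norm.
Qed.

Let I_gt0 x : 0 < I x. Proof. by apply: lt_le_trans (I_ge x); rewrite invr_gt0. Qed.

Let IL x : (I x)^-1 <= L.
Proof. by rewrite -[leRHS]invrK lef_pV2 ?posrE ?invr_gt0. Qed.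

Lemma submodel_densityE z : submodel_density P1 g tau z = expR (tau * g z) / I z.1.
Proof.
rewrite /submodel_density expRD expRN /log_mgf lnK // posrE; exact: I_gt0.
Qed.

Lemma measurable_submodel_density : measurable_fun setT (submodel_density P1 g tau).
Proof.
have -> : submodel_density P1 g tau = (fun z => expR (tau * g z) * (I z.1)^-1).
  by apply/funext => z; exact: submodel_densityE.
apply: measurable_funM.
  by apply: measurableT_comp => //; apply: measurable_funM.
have -> : (fun z : T * T => (I z.1)^-1) = (fun z => expR (- ln (I z.1))).
  by apply/funext => z; rewrite expRN lnK ?posrE.
apply: measurableT_comp => //; apply: measurableT_comp => //.
apply: measurableT_comp; first exact: measurable_ln.
apply: (@measurableT_comp _ _ _ _ _ _ I) => //.
apply: (measurable_Mop P1 (F := fun z => expR (tau * g z))).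
by apply: measurableT_comp => //; apply: measurable_funM.
Qed.

Lemma submodel_density_near1 z :
  `|submodel_density P1 g tau z - 1| <= `|tau| * (2 * C * L ^+ 2).
Proof.
rewrite submodel_densityE; case: z => x y /=.
have -> : expR (tau * g (x, y)) / I x - 1 = (expR (tau * g (x, y)) - 1 - (I x - 1)) / I x.
  by field; rewrite gt_eqF.
rewrite normrM [X in _ * X]ger0_norm ?invr_ge0 ?(ltW (I_gt0 x)) //.
apply: le_trans (_ : (`|tau| * (C * L) + `|tau| * (C * L)) * L <= _).
  apply: ler_pM => //; first by rewrite invr_ge0 ltW.
  by apply: le_trans (ler_normB _ _) _; apply: lerD.
by rewrite le_eqVlt; apply/orP; left; apply/eqP; ring.
Qed.

(** The conditional mean zero of [g] removes the linear term from the normalising constant, which is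
    therefore [1 + O(tau^2)]. Unlike [submodel_density_near1], the bound is tied to those [x] at
    which this mean vanishes. *)
Lemma submodel_density_expansion x y : \int[P1 x]_y g (x, y) = 0 ->
  `|submodel_density P1 g tau (x, y) - 1 - tau * g (x, y)|
    <= tau ^+ 2 * (C ^+ 2 * L ^+ 2 * (2 + C)).
Proof.
move=> g0; rewrite submodel_densityE /=.
have ig : (P1 x).-integrable setT (EFin \o (fun y => g (x, y))).
  exact: (bounded_integrable (K := C) (prob_kernel x)).
have ie : (P1 x).-integrable setT (EFin \o (fun y => expR (tau * g (x, y)))).
  apply: (bounded_integrable (K := L) (prob_kernel x)) => // t.
  by rewrite ger0_norm ?expR_ge0 // ler_expR (le_trans (ler_norm _)).
have itg : (P1 x).-integrable setT (EFin \o (fun y => tau * g (x, y))).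
  by have := integrableZl measurableT tau ig; apply: eq_integrable => // t _.
have I2 : `|I x - 1| <= tau ^+ 2 * (C ^+ 2 * L).
  have -> : I x = \int[P1 x]_y (expR (tau * g (x, y)) - tau * g (x, y)).
    by rewrite RintegralB // RintegralZl // g0 mulr0 subr0.
  apply: (prob_integral_close (prob_kernel x)).
    by apply: measurable_funB => //; apply: measurable_funM.
  by move=> t; rewrite addrAC; exact: e2.
have -> : expR (tau * g (x, y)) / I x - 1 - tau * g (x, y) =
  ((expR (tau * g (x, y)) - 1 - tau * g (x, y)) - (I x - 1) * (1 + tau * g (x, y))) / I x.
  by field; rewrite gt_eqF.
rewrite normrM [X in _ * X]ger0_norm ?invr_ge0 ?(ltW (I_gt0 x)) //.
apply: le_trans (_ : (tau ^+ 2 * (C ^+ 2 * L) + tau ^+ 2 * (C ^+ 2 * L) * (1 + C)) * L <= _).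
  apply: ler_pM => //; first by rewrite invr_ge0 ltW.
  apply: le_trans (ler_normB _ _) _; apply: lerD => //.
  rewrite normrM; apply: ler_pM => //.
  by apply: le_trans (ler_normD _ _) _; rewrite normr1 lerD2l.
by rewrite le_eqVlt; apply/orP; left; apply/eqP; ring.
Qed.

End submodel_density_bounds.

Lemma quadratic_is_derive (R : realType) (f : R -> R) (D c t0 : R) : 0 < t0 -> 0 <= c ->
  (forall t, `|t| <= t0 -> `|f t - f 0 - t * D| <= c * t ^+ 2) ->
  is_derive (0 : R) (1 : R) f D.
Proof.
move=> t00 c0 hf.
suff h : h^-1 *: ((f \o shift 0) (h *: (1 : R)) - f 0) @[h --> 0^'] --> D.
  have hd : derivable f 0 1 by apply/cvg_ex; exists D.
  by apply: DeriveDef => //; apply: cvg_lim.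
apply/cvgrPdist_le => e e0.
  pose del := Num.min t0 (e / (c + 1)).
  have c1 : 0 < c + 1 by rewrite ltr_wpDl.
  have del0 : 0 < del by rewrite lt_min t00 divr_gt0.
  near=> t.
  have tn0 : t != 0 by near: t; exact: nbhs_dnbhs_neq.
  have td : `|t| < del.
    by near: t; apply: nbhs_dnbhs; exact: (@nbhs0_lt R R).
  move: td; rewrite /del lt_min => /andP[td1 td2].
  have := hf t (ltW td1).
  rewrite /= /shift /= addr0 [t *: 1]mulr1 -[_ *: _]/(t^-1 * _) => ht.
  rewrite distrC.
  have -> : t^-1 * (f t - f 0) - D = t^-1 * (f t - f 0 - t * D).
    by rewrite [RHS]mulrBr mulKf.
  rewrite normrM normfV ler_pdivrMl ?normr_gt0 //; apply: le_trans ht _.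
  rewrite -real_normK ?num_real // expr2 mulrA mulrC ler_wpM2l //.
  apply: le_trans (_ : (c + 1) * `|t| <= _); first by rewrite ler_wpM2r // lerDl.
  by rewrite mulrC -ler_pdivlMr // ltW.
Unshelve. all: by end_near. Qed.

(** * Pathwise derivative of the largest eigenvalue *)

(** A largest eigenvalue bounds the modulus of every other eigenvalue; two of them bound each other
    and coincide. *)
Lemma rho_submodel_eq {d} {T : measurableType d} {R : realType}
    (Q : probability T R) (P1 : R.-pker T ~> T) (m g : T * T -> R) (tau r : R) :
  largest_eigenvalue Q (submodel_op P1 m g tau) r -> rho_submodel Q P1 m g tau = r.
Proof.
move=> hr; rewrite /rho_submodel; set S := [set r | _].
have := xgetPex 0 (ex_intro S r hr); set r' := xget 0 S => hr'.
have le s s' : largest_eigenvalue Q (submodel_op P1 m g tau) s ->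
    largest_eigenvalue Q (submodel_op P1 m g tau) s' -> `|s| <= s'.
  by move=> [hs _] [_ hs']; have := hs' _ _ hs; rewrite expr0n addr0 sqrtr_sqr.
apply/le_anti/andP; split; apply: le_trans (ler_norm _) _; exact: le.
Qed.

Section pathwise_derivative.
Context {d : measure_display} {T : measurableType d} {R : realType}.
Variables (Q : probability T R) (P1 : R.-pker T ~> T) (nu : probability (T * T)%type R).
Hypothesis hnu : pair_law Q P1 nu.
Hypothesis hsnd : forall B, measurable B -> nu (setT `*` B) = Q B.
Variable m : T * T -> R.
Hypotheses (m_meas : measurable_fun setT m) (m_pos : forall z, 0 < m z).

Section class_op_theory.
Hypothesis mb : Mbounded Q P1 m.

Lemma Mop_kernelB C C' w w' f : dominated_by m C w -> dominated_by m C' w' -> L2 Q f ->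
  aeeq Q (Mop P1 (w \- w') f) (Mop P1 w f \- Mop P1 w' f).
Proof.
move=> hw hw' hf.
apply: filterS2 (integrable_dominated m_pos mb hw hf) (integrable_dominated m_pos mb hw' hf) => x h1 h2.
rewrite /Mop /= -RintegralB //.
by apply: eq_Rintegral => y _ /=; rewrite mulrBl.
Qed.

Lemma dominatedB C C' w w' : dominated_by m C w -> dominated_by m C' w' ->
  dominated_by m (C + C') (w \- w').
Proof.
move=> [mw C0 hw] [mw' C'0 hw']; split; [exact: measurable_funB|exact: addr_ge0|].
by move=> z; rewrite mulrDl; apply: le_trans (ler_normB _ _) _; apply: lerD.
Qed.

Lemma class_opB C C' w w' (u : L2class Q) : dominated_by m C w -> dominated_by m C' w' ->
  class_op P1 (w \- w') u = class_op P1 w u - class_op P1 w' u.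
Proof.
move=> hw hw'; have Lw := L2_Mop m_pos mb hw (L2class_L2 u).
have Lw' := L2_Mop m_pos mb hw' (L2class_L2 u).
rewrite /class_op -clsB //; apply: cls_eq.
- exact: (L2_Mop m_pos mb (dominatedB hw hw')).
- exact: L2_subP.
- exact: Mop_kernelB hw hw' _.
Qed.

Lemma class_op_bounded C w (u : L2class Q) : dominated_by m C w ->
  ipnorm (L2ip Q) (class_op P1 w u) <= C * op_bound Q P1 m * ipnorm (L2ip Q) u.
Proof.
by move=> hw; rewrite -[in leRHS](cls_rep u); exact: (Mop_dominated_bounded m_meas m_pos mb hw).
Qed.

Lemma L2eigenvalue_class_op C w (x y : R) : dominated_by m C w ->
  L2eigenvalue Q (Mop P1 w) x y <->
  exists u v : L2class Q, [/\ ~ (u = 0 /\ v = 0),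
    class_op P1 w u = x *: u - y *: v & class_op P1 w v = y *: u + x *: v].
Proof.
move=> hw; have LM f (hf : L2 Q f) := L2_Mop m_pos mb hw hf.
have Lc (a c : R) f g : L2 Q f -> L2 Q g ->
    L2 Q (fun x => a * f x - c * g x) /\ L2 Q (fun x => a * f x + c * g x).
  by move=> hf hg; split; [apply: L2_subP|apply: L2_addP]; exact: L2_scaleP.
have cB (a c : R) f g : L2 Q f -> L2 Q g ->
    cls Q (fun x => a * f x - c * g x) = a *: cls Q f - c *: cls Q g.
  by move=> hf hg; rewrite -!clsZ // -clsB //; exact: L2_scaleP.
have cD (a c : R) f g : L2 Q f -> L2 Q g ->
    cls Q (fun x => a * f x + c * g x) = a *: cls Q f + c *: cls Q g.
  by move=> hf hg; rewrite -!clsZ // -clsD //; exact: L2_scaleP.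
split.
- move=> [u [v [Lu Lv nz eu ev]]]; exists (cls Q u), (cls Q v).
  have [L1 _] := Lc x y _ _ Lu Lv; have [_ L4] := Lc y x _ _ Lu Lv.
  rewrite !(class_op_cls hnu hsnd m_pos mb hw) // -cB // -cD //; split.
  + move=> [u0 v0]; apply: nz; split.
      by apply: aeeq_trans (aeeq_sym (clsP Lu)) _; rewrite u0; exact: L2class_0E.
    by apply: aeeq_trans (aeeq_sym (clsP Lv)) _; rewrite v0; exact: L2class_0E.
  + by apply: cls_eq => //; exact: LM.
  + by apply: cls_eq => //; exact: LM.
- move=> [u [v [nz eu ev]]]; exists u, v; split; [exact: L2class_L2|exact: L2class_L2| | |].
  + move=> [u0 v0]; apply: nz; split; apply: L2class_inj.
      by apply: aeeq_trans u0 (aeeq_sym (L2class_0E _)).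
    by apply: aeeq_trans v0 (aeeq_sym (L2class_0E _)).
  + apply: aeeq_trans (aeeq_sym (clsP (LM _ (L2class_L2 u)))) _.
    rewrite -/(class_op P1 w u) eu -[u in X in aeeq _ X]cls_rep -[v in X in aeeq _ X]cls_rep -cB; try exact: L2class_L2.
    by apply: clsP; have [] := Lc x y _ _ (L2class_L2 u) (L2class_L2 v).
  + apply: aeeq_trans (aeeq_sym (clsP (LM _ (L2class_L2 v)))) _.
    rewrite -/(class_op P1 w v) ev -[u in X in aeeq _ X]cls_rep -[v in X in aeeq _ X]cls_rep -cD; try exact: L2class_L2.
    by apply: clsP; have [] := Lc y x _ _ (L2class_L2 u) (L2class_L2 v).
Qed.

End class_op_theory.

Variables (rho : R) (phi phis : T -> R).
Hypothesis A1 : principal_eigenpair Q P1 m rho phi phis.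
Hypothesis phi_phis : inner Q phi phis = 1.
Local Notation b := (L2ip Q).
Local Notation n := (ipnorm (L2ip Q)).
Local Notation phiH := (cls Q phi).
Local Notation phisH := (cls Q phis).
Let mb : Mbounded Q P1 m := pe_bounded A1.
Let dm : dominated_by m 1 m := dominated_self m_meas m_pos.
Let Lphi : L2 Q phi := pe_phi_L2 A1.
Let Lphis : L2 Q phis := pe_phis_L2 A1.
Local Notation M := (transition_class hnu hsnd m_meas m_pos A1).
Local Notation B := (op_bound Q P1 m).

Hypothesis finite_rank : forall e : R, 0 < e -> exists k (f : 'I_k -> L2class Q),
  (forall j, n (f j) <= 1) /\
  forall u, n (M u - \sum_j b (M u) (f j) *: f j) <= e * n u.

(** [r - rho = <(A - M) f, phis>] exactly, and replacing [f] by [phi] costs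
    [<(A - M) (f - phi), phis>], in which both [A - M] and [f - phi] are of order [e]. The pair [s]
    holds the admissible radius and the constant of the remainder, both independent of [w]. *)
Lemma largest_eigenvalue_perturbed : exists2 s : R * R, 0 < s.1 /\ 0 <= s.2 &
  forall (w : T * T -> R) (C e : R), dominated_by m C w -> 0 <= e -> e <= s.1 ->
    dominated_by m e (w \- m) ->
    exists2 r, largest_eigenvalue Q (Mop P1 w) r &
      `|r - rho - inner Q (Mop P1 (w \- m) phi) phis| <= s.2 * e ^+ 2.
Proof.
have [a [kap [K [[kap0 kap_rho] K0 h1 h2 h3]]]] := adapted_norm_exists phi_phis finite_rank.
have B0 := op_bound_ge0 Q P1 m.
set pc := perturbation_const b phiH phisH K.
set dc := deviation_const b phiH phisH rho kap K.
have F0 : 0 <= n phiH := ipnorm_ge0 _ _.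
have S0 : 0 <= n phisH := ipnorm_ge0 _ _.
have gap0 : 0 < rho - kap by rewrite subr_gt0.
have pc0 : 0 <= pc.
  by rewrite /pc /perturbation_const !(addr_ge0, mulr_ge0).
have dc0 : 0 <= dc.
  by rewrite /dc /deviation_const !(addr_ge0, mulr_ge0) // invr_ge0 ltW.
(* A change of weight bounded by [e m] moves the operator by at most [e B], so [e <= t0] is the
   smallness condition of [perturbed_eigenpair]. *)
pose t0 := (rho - kap) / (4 * (pc * B) + 1).
pose c2 := B * (dc * (B * (n phiH + 1))) * n phisH.
have p0 : 0 < 4 * (pc * B) + 1 by rewrite ltr_wpDl // !mulr_ge0.
exists (t0, c2) => /=.
  split; first by rewrite divr_gt0.
  by rewrite /c2; do ![apply: mulr_ge0 => //]; apply: addr_ge0.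
move=> w C e hw e0 et0 hE.
pose A : {linear L2class Q -> L2class Q} :=
  pack_linear (class_op_linear hnu hsnd m_pos mb hw).
have AM u : A u - M u = class_op P1 (w \- m) u by rewrite (class_opB mb _ hw dm).
have small : 4 * (pc * (e * B)) <= rho - kap.
  rewrite -(divfK (lt0r_neq0 p0) (rho - kap)) -/t0.
  apply: le_trans (_ : e * (4 * (pc * B) + 1) <= _); last by rewrite ler_wpM2r // ltW.
  by rewrite mulrDr mulr1 [pc * _]mulrCA [4 * _]mulrCA lerDl.
have [f [r [[f1 fn] Af [er r0] fdev hr]]] := perturbed_eigenpair (@L2ip_def _ _ _ Q) kap0
  kap_rho h1 h2 K0 (transition_class_phi hnu hsnd m_meas m_pos A1)
  (transition_class_phis hnu hsnd m_meas m_pos A1) (ip_phi_phis A1 phi_phis) h3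
  (V := L2class Q) (iota := idfun) (A := A) (eps := e * B)
  (fun v h => h) (@L2class_complete _ _ _ Q) (mulr_ge0 e0 B0) small
  (fun u => eq_ind_r (fun z => n z <= _) (class_op_bounded mb u hE) (AM u))
  (v0 := phiH) (ip_phi_phis A1 phi_phis)
  (eq_ind_r (fun z => K * n z <= 1)
    (eq_ind_r (fun z => K * z <= 1) (eq_ind_r (fun z => z <= 1) ler01 (mulr0 K)) (ipnorm0 b))
    (subrr phiH)).
change (b f phisH = 1) in f1; change (is_true (n f <= n phiH + 1)) in fn.
change (r = rho + b (A f - M f) phisH) in er.
change (is_true (n (f - phiH) <= dc * n (A f - M f))) in fdev.
exists r.
- split.
    apply/(L2eigenvalue_class_op mb _ _ hw); exists f, 0; split.
    + move=> [f0 _]; move: f1; rewrite f0 ip0l => /eqP; by rewrite eq_sym oner_eq0.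
    + by rewrite -[class_op _ _ _]/(A f) Af scaler0 subr0.
    + by rewrite -[class_op _ _ _]/(A 0) linear0 scale0r scaler0 addr0.
  move=> x y /(L2eigenvalue_class_op mb _ _ hw) [u [v [nz eu ev]]].
  exact: (hr x y u v).
have -> : r - rho = b (class_op P1 (w \- m) f) phisH by rewrite er AM addrC addKr.
have LE := L2_Mop m_pos mb hE Lphi.
rewrite -(L2ip_cls LE Lphis) -(class_op_cls hnu hsnd m_pos mb hE Lphi) -ipBl.
have -> : class_op P1 (w \- m) f - class_op P1 (w \- m) phiH = class_op P1 (w \- m) (f - phiH).
  pose EL : {linear L2class Q -> L2class Q} :=
    pack_linear (class_op_linear hnu hsnd m_pos mb hE).
  exact: esym (linearB EL f phiH).
apply: le_trans (ip_cauchy_schwarz _ _ _) _.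
rewrite /c2 [leRHS]mulrAC ler_wpM2r //.
apply: le_trans (class_op_bounded mb _ hE) _.
have -> : B * (dc * (B * (n phiH + 1))) * e ^+ 2 = e * B * (dc * (e * B * (n phiH + 1))) by ring.
rewrite ler_wpM2l ?mulr_ge0 //; apply: le_trans fdev _; rewrite -/dc ler_wpM2l // AM.
apply: le_trans (class_op_bounded mb _ hE) _.
by rewrite ler_wpM2l ?mulr_ge0.
Qed.

Variables (g : T * T -> R) (Cg : R).
Hypotheses (mg : measurable_fun setT g) (gC : forall z, `|g z| <= Cg).
Hypothesis g0 : {ae Q, forall x, \int[P1 x]_y g (x, y) = 0}.

Let dmg : dominated_by m Cg (fun z => m z * g z).
Proof.
split; [exact: measurable_funM|exact: le_trans (gC (point, point))|move=> z].
by rewrite normrM (ger0_norm (ltW (m_pos z))) mulrC ler_wpM2r // ltW.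
Qed.

(** At almost every [x] the expansion of the density bounds the difference of the two images of
    [phi] by [k] times [M |phi|], and the norm of the latter is controlled by that of [phi]. *)
Lemma submodel_first_order (tau : R) : `|tau| <= 1 ->
  `|inner Q (Mop P1 ((fun z => m z * submodel_density P1 g tau z) \- m) phi) phis -
    tau * inner Q (Mop P1 (fun z => m z * g z) phi) phis| <=
  tau ^+ 2 * (Cg ^+ 2 * expR Cg ^+ 2 * (2 + Cg)) * B * n phiH * n phisH.
Proof.
move=> tau1; set k := tau ^+ 2 * _.
have C0 : 0 <= Cg := le_trans (normr_ge0 _) (gC (point, point)).
have k0 : 0 <= k.
  by apply: mulr_ge0; rewrite ?sqr_ge0 // !mulr_ge0 ?expR_ge0 ?addr_ge0.
set D := submodel_density P1 g tau.
have mD : measurable_fun setT D := measurable_submodel_density P1 mg gC tau1.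
have D1 : dominated_by m (`|tau| * (2 * Cg * expR Cg ^+ 2)) ((fun z => m z * D z) \- m).
  split; [|by rewrite !mulr_ge0 ?sqr_ge0|].
    by apply: measurable_funB => //; exact: measurable_funM.
  move=> z /=; rewrite -{2}[m z]mulr1 -mulrBr normrM (ger0_norm (ltW (m_pos z))) mulrC.
  by rewrite ler_wpM2r ?(ltW (m_pos z)) //; exact: submodel_density_near1.
set E := _ \- m in D1 *.
have L1 := L2_Mop m_pos mb D1 Lphi; have L2' := L2_Mop m_pos mb dmg Lphi.
have LA := L2_Mop m_pos mb dm (L2_normP Lphi).
have L3 : L2 Q (fun x => tau * Mop P1 (fun z => m z * g z) phi x) by exact: L2_scaleP.
rewrite -innerZl // -(L2ip_cls L1 Lphis) -(L2ip_cls L3 Lphis) -ipBl -clsB //.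
apply: le_trans (ip_cauchy_schwarz _ _ _) _; rewrite ler_wpM2r ?ipnorm_ge0 //.
apply: le_trans (nrm_ae_le (g := fun x => k * Mop P1 m (fun y => `|phi y|) x) _ _ _) _.
- exact: L2_subP.
- exact: L2_scaleP.
- have [h1 _ _] := mb.
  apply: filterS2 g0 (filterI (h1 _ (L2_normP Lphi)) (filterI
    (integrable_dominated m_pos mb D1 Lphi) (integrable_dominated m_pos mb dmg Lphi))).
  move=> x gx [i1 [i2 i3]].
  have i3' : (P1 x).-integrable setT (fun y => (tau * (m (x, y) * g (x, y) * phi y))%:E).
    by have := integrableZl measurableT tau i3; apply: eq_integrable => // y _.
  apply: le_trans (ler_norm _); rewrite /Mop /= -RintegralZl // -RintegralB // -RintegralZl //.
  have i4 : (P1 x).-integrable setT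
      (fun y => (E (x, y) * phi y - tau * (m (x, y) * g (x, y) * phi y))%:E).
    by have := integrableB measurableT i2 i3'; apply: eq_integrable => // y _.
  apply: le_trans (le_normr_Rintegral measurableT i4) _.
  apply: le_Rintegral => //.
  - by have := integrable_abse i4; apply: eq_integrable => // y _.
  - by have := integrableZl measurableT k i1; apply: eq_integrable => // y _.
  move=> y _.
  have -> : E (x, y) * phi y - tau * (m (x, y) * g (x, y) * phi y) =
      m (x, y) * phi y * (D (x, y) - 1 - tau * g (x, y)) by rewrite /E /=; ring.
  rewrite normrM normrM (ger0_norm (ltW (m_pos _))) mulrC ler_wpM2r //.
    by rewrite mulr_ge0 // ltW.
  exact: submodel_density_expansion.
- rewrite clsZ // ipnormZ ger0_norm // -mulrA ler_wpM2l //.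
  rewrite -(nrm_abs Lphi); exact: (Mop_bounded m_meas m_pos mb (L2_normP Lphi)).
Qed.

Theorem rho_submodel_derive :
  is_derive (0 : R) (1 : R) (rho_submodel Q P1 m g) (\int[nu]_z (phis z.1 * (m z * g z) * phi z.2)).
Proof.
rewrite (integral_pair hnu m_pos mb dmg Lphis Lphi) innerC.
have C0 : 0 <= Cg := le_trans (normr_ge0 _) (gC (point, point)).
have B0 := op_bound_ge0 Q P1 m.
have [[s1 s2] [/= s10 s20] hs] := largest_eigenvalue_perturbed.
set L := expR Cg; pose c1 := 2 * Cg * L ^+ 2.
have c10 : 0 <= c1 by rewrite /c1 !mulr_ge0 // expR_ge0.
pose c3 := Cg ^+ 2 * L ^+ 2 * (2 + Cg) * B * n phiH * n phisH.
have c30 : 0 <= c3.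
  by rewrite /c3 !mulr_ge0 ?expR_ge0 ?ipnorm_ge0 // addr_ge0.
have hsub tau : `|tau| <= 1 -> `|tau| * c1 <= s1 ->
    `|rho_submodel Q P1 m g tau - rho - tau * inner Q (Mop P1 (fun z => m z * g z) phi) phis|
      <= (s2 * c1 ^+ 2 + c3) * tau ^+ 2.
  move=> tau1 taus; set D := submodel_density P1 g tau.
  have mD : measurable_fun setT D := measurable_submodel_density P1 mg gC tau1.
  have D1 z : `|D z - 1| <= `|tau| * c1 by exact: submodel_density_near1.
  have dw : dominated_by m (1 + `|tau| * c1) (fun z => m z * D z).
    split; [exact: measurable_funM|by rewrite addr_ge0 // mulr_ge0|move=> z].
    rewrite normrM (ger0_norm (ltW (m_pos z))) mulrC ler_wpM2r ?(ltW (m_pos z)) //.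
    rewrite -(subrK 1 (D z)) addrC; apply: le_trans (ler_normD _ _) _.
    by rewrite normr1 lerD2l.
  have dE : dominated_by m (`|tau| * c1) ((fun z => m z * D z) \- m).
    split; [|by rewrite mulr_ge0|].
      by apply: measurable_funB => //; exact: measurable_funM.
    move=> z /=; rewrite -{2}[m z]mulr1 -mulrBr normrM (ger0_norm (ltW (m_pos z))) mulrC.
    by rewrite ler_wpM2r ?(ltW (m_pos z)).
  have [r hr hb] := hs _ _ _ dw (mulr_ge0 (normr_ge0 _) c10) taus dE.
  rewrite (rho_submodel_eq hr).
  set I := inner _ _ _ in hb; have h2 := submodel_first_order tau1; rewrite -/I in h2.
  set J := inner _ _ _ in h2 *.
  have -> : r - rho - tau * J = (r - rho - I) + (I - tau * J) by ring.
  apply: le_trans (ler_normD _ _) _; rewrite mulrDl; apply: lerD.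
    by move: hb; rewrite exprMn real_normK ?num_real // mulrA mulrAC.
  apply: le_trans h2 _; rewrite le_eqVlt; apply/orP; left; apply/eqP.
  by rewrite /c3 -/L; ring.
(* The estimate at [tau = 0] identifies the value of the unperturbed model. *)
have e0 : rho_submodel Q P1 m g 0 = rho.
  have := hsub 0; rewrite normr0 mul0r mul0r expr0n mulr0 subr0 => h.
  by apply/eqP; rewrite -subr_eq0 -normr_le0; apply: h => //; exact: ltW.
pose t0 := Num.min 1 (s1 / (c1 + 1)).
have c11 : 0 < c1 + 1 by rewrite ltr_wpDl.
apply: (@quadratic_is_derive _ _ _ (s2 * c1 ^+ 2 + c3) t0).
- by rewrite lt_min ltr01 divr_gt0.
- by rewrite addr_ge0 // mulr_ge0 // sqr_ge0.
move=> t; rewrite /t0 le_min => /andP[t1 t2]; rewrite e0; apply: hsub => //.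
move: t2; rewrite ler_pdivlMr // => h; apply: le_trans h.
by rewrite ler_wpM2l // lerDl.
Qed.

End pathwise_derivative.

(** * The efficient influence function *)

Section stationary_pairs.
Context {dO : measure_display} {Om : measurableType dO}.
Context {d : measure_display} {T : measurableType d} {R : realType}.
Variables (P : probability Om R) (X : nat -> {mfun Om >-> T}).
Variables (Q : probability T R) (P1 : R.-pker T ~> T).
Hypothesis hX : stationary_ergodic_markov P X Q P1.

Definition step_at (t : nat) (w : Om) : T * T := (X t w, X t.+1 w).

Lemma measurable_step_at t : measurable_fun setT (step_at t).
Proof. by apply: measurable_fun_pair; exact: measurable_funPT. Qed.

HB.instance Definition _ t :=
  isMeasurableFun.Build _ _ _ _ (step_at t) (measurable_step_at t).

Definition step_law t := distribution P (step_at t).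

HB.instance Definition _ t := Probability.on (step_law t).

Lemma integral_state t (f : T -> \bar R) : measurable_fun setT f -> (forall x, (0 <= f x)%E) ->
  (\int[P]_w f (X t w) = \int[Q]_x f x)%E.
Proof.
move=> mf f0; rewrite -[LHS](ge0_integral_distribution (X t) mf f0).
by apply: eq_measure_integral => A mA _; exact: sem_law hX _ _ mA.
Qed.

Lemma pair_law_step t : pair_law Q P1 (step_law t).
Proof.
move=> A B mA mB.
change (P ((X t @^-1` A) `&` (X t.+1 @^-1` B)) = (\int[Q]_(x in A) P1 x B)%E).
rewrite (sem_markov hX) //; last first.
  by apply: sub_sigma_algebra; exists t, A.
have mP : measurable_fun setT (fun x => P1 x B) by exact: measurable_kernel.
rewrite -(@ge0_integral_pushforward _ _ _ _ _ (X t) _ P A (fun x => P1 x B)) //; last first.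
  exact: measurable_funTS.
by apply: eq_measure_integral => C mC _; exact: sem_law hX _ _ mC.
Qed.

Lemma step_law_snd t B : measurable B -> step_law t (setT `*` B) = Q B.
Proof.
move=> mB; have <- := sem_law hX t.+1 mB.
by congr (P _); apply/seteqP; split => w /=; [case|].
Qed.

(** The laws of the pairs at times [t] and 0 satisfy [pair_law] with the same [Q] and [P1], so both
    integrals reduce to the same iterated one. *)
Lemma integral_step t (F : T * T -> \bar R) : measurable_fun setT F ->
  (forall z, (0 <= F z)%E) ->
  (\int[P]_w F (X t w, X t.+1 w) = \int[Q2 P X]_z F z)%E.
Proof.
move=> mF F0; rewrite -[LHS](ge0_integral_distribution (step_at t) mF F0).
rewrite -/(step_law t) (pair_law_tonelli (pair_law_step t) mF F0).
by rewrite -(pair_law_tonelli (pair_law_step 0) mF F0).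
Qed.

End stationary_pairs.

Section influence_function.
Context {d : measure_display} {T : measurableType d} {R : realType}.
Variables (Q : probability T R) (P1 : R.-pker T ~> T) (nu : probability (T * T)%type R).
Hypothesis hnu : pair_law Q P1 nu.
Variable m : T * T -> R.
Hypotheses (m_meas : measurable_fun setT m) (m_pos : forall z, 0 < m z).
Variables (rho : R) (phi phis : T -> R).
Hypothesis A1 : principal_eigenpair Q P1 m rho phi phis.
Hypothesis A4c : (\int[nu]_z ((phis z.1 * m z * phi z.2) ^+ 2)%:E < +oo)%E.
Let mb : Mbounded Q P1 m := pe_bounded A1.
Let dm : dominated_by m 1 m := dominated_self m_meas m_pos.
Let Lphi : L2 Q phi := pe_phi_L2 A1.
Let Lphis : L2 Q phis := pe_phis_L2 A1.

Let G (z : T * T) := phis z.1 * m z * phi z.2.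
Let K (z : T * T) := rho * phis z.1 * phi z.1.
Local Notation psi := (psi_rho m rho phi phis).

Let mphi1 : measurable_fun setT (fun z : T * T => phi z.1).
Proof. by apply: measurableT_comp => //; exact: L2_measurable Lphi. Qed.
Let mphi2 : measurable_fun setT (fun z : T * T => phi z.2).
Proof. by apply: measurableT_comp => //; exact: L2_measurable Lphi. Qed.
Let mphis : measurable_fun setT (fun z : T * T => phis z.1).
Proof. by apply: measurableT_comp => //; exact: L2_measurable Lphis. Qed.
Let mG : measurable_fun setT G.
Proof. by do ! apply: measurable_funM. Qed.
Let mK : measurable_fun setT K.
Proof. by do ! apply: measurable_funM. Qed.

Lemma psi_rho_sectionP : {ae Q, forall x,
  (P1 x).-integrable setT (fun y => (phis x * m (x, y) * phi y)%:E) /\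
  \int[P1 x]_y (phis x * m (x, y) * phi y) = rho * phis x * phi x}.
Proof.
apply: filterS2 (integrable_dominated m_pos mb dm Lphi) (pe_phi_eigen A1) => x hx ex.
have h : (P1 x).-integrable setT (fun y => (phis x * m (x, y) * phi y)%:E).
  have := integrableZl measurableT (phis x) hx; apply: eq_integrable => // y _.
  by rewrite -EFinM mulrA.
split => //; rewrite -mulrA mulrCA -ex /Mop -RintegralZl //.
by apply: eq_Rintegral => y _; rewrite mulrA.
Qed.

Let L2G : L2 nu G. Proof. exact: L2P. Qed.

(** The product [phis phi] of two [L^2] functions need not be square integrable. But [K] is the
    conditional mean of [G] given the first coordinate, so Jensen's inequality bounds its second
    moment by that of [G]. *)
Let L2K : L2 nu K.
Proof.
apply: L2P => //; apply: le_lt_trans A4c.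
have m2 : measurable_fun setT (fun z => (K z ^+ 2)%:E).
  by apply/measurable_EFinP; exact: measurable_funX.
have m3 : measurable_fun setT (fun z => (G z ^+ 2)%:E).
  by apply/measurable_EFinP; exact: measurable_funX.
have p2 z : (0 <= (K z ^+ 2)%:E)%E by rewrite lee_fin sqr_ge0.
have p3 z : (0 <= (G z ^+ 2)%:E)%E by rewrite lee_fin sqr_ge0.
rewrite (pair_law_tonelli hnu m2 p2) (pair_law_tonelli hnu m3 p3).
apply: ae_ge0_le_integral => //.
- by move=> x _; exact: integral_ge0.
- exact: (measurable_fun_integral_finite_kernel (fun z => (K z ^+ 2)%:E) P1).
- by move=> x _; exact: integral_ge0.
- exact: (measurable_fun_integral_finite_kernel (fun z => (G z ^+ 2)%:E) P1).
apply: filterS psi_rho_sectionP => x [hx ex] _.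
have -> : (\int[P1 x]_y (K (x, y) ^+ 2)%:E)%E = ((K (x, x) ^+ 2)%:E)%E.
  by rewrite /K /= integral_cst // [P1 x setT]prob_kernel mule1.
rewrite /K /= -ex; exact: (prob_integral_sqr_le (prob_kernel x) hx).
Qed.

Lemma L2_psi_rho : L2 nu psi.
Proof. exact: (L2_subP L2G L2K). Qed.

Lemma psi_rho_conditional_mean : {ae Q, forall x, (\int[P1 x]_y (psi (x, y))%:E)%E = 0%E}.
Proof.
apply: filterS psi_rho_sectionP => x [hx ex].
have hK : (P1 x).-integrable setT (EFin \o (cst (rho * phis x * phi x) : T -> R)).
  exact: (bounded_integrable (K := `|rho * phis x * phi x|) (prob_kernel x)).
rewrite -(fineK (integrable_fin_num measurableT (integrableB measurableT hx hK))).
rewrite -[fine _]/(\int[P1 x]_y (phis x * m (x, y) * phi y - rho * phis x * phi x)).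
by rewrite RintegralB // ex Rintegral_cst // [X in fine X]prob_kernel mulr1 subrr.
Qed.

(** The term [K] depends on the first coordinate alone and is therefore orthogonal to every [g] of
    conditional mean zero. *)
Lemma inner_psi_rho g : L2 nu g -> {ae Q, forall x, \int[P1 x]_y g (x, y) = 0} ->
  inner nu psi g = \int[nu]_z (phis z.1 * (m z * g z) * phi z.2).
Proof.
move=> Lg g0.
have -> : inner nu psi g = inner nu G g - inner nu K g.
  rewrite -[inner nu K g]mul1r -mulNr -innerZl // -innerDl //; last exact: L2_scaleP.
  by apply: eq_Rintegral => z _; rewrite /psi_rho /G /K /=; ring.
have -> : inner nu K g = 0.
  rewrite /inner; have [i1 i2 ->] := pair_law_fubini hnu (L2_mul_integrable L2K Lg).
  have ig : nu.-integrable setT (EFin \o g).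
    have := L2_mul_integrable Lg (L2P (measurable_cst (1 : R)) _).
    have -> : (fun z => (g z * cst 1 z)%:E) = EFin \o g.
      by apply/funext => z; rewrite /= mulr1.
    apply; rewrite (_ : (fun=> _) = cst 1%E); last by apply/funext => z /=; rewrite expr1n.
    by rewrite integral_cst // mul1e -ge0_fin_numE //; exact: fin_num_measure.
  have [j1 _ _] := pair_law_fubini hnu ig.
  rewrite /Rintegral [X in fine X](_ : _ = 0%E) //.
  have -> : (0%E : \bar R) = (\int[Q]_x (cst 0%E x))%E by rewrite integral_cst // mul0e.
  apply: ae_eq_integral => //; first by have /integrableP[] := i2.
  apply: filterS2 g0 j1 => x gx jx _; congr EFin.
  rewrite -[LHS]/(\int[P1 x]_y (rho * phis x * phi x * g (x, y))).
  by rewrite RintegralZl // gx mulr0.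
by rewrite subr0; apply: eq_Rintegral => z _; rewrite /G; ring.
Qed.

End influence_function.

Section efficient_influence.
Context {dO : measure_display} {Om : measurableType dO}.
Context {d : measure_display} {T : measurableType d} {R : realType}.
Variables (P : probability Om R) (X : nat -> {mfun Om >-> T}).
Variables (Q : probability T R) (P1 : R.-pker T ~> T) (m : T * T -> R).
Hypothesis hX : stationary_ergodic_markov P X Q P1.
Hypotheses (m_meas : measurable_fun setT m) (m_pos : forall z, 0 < m z).
Variables (rho : R) (phi phis : T -> R).
Hypothesis A1 : principal_eigenpair Q P1 m rho phi phis.
Hypothesis phi_phis : inner Q phi phis = 1.
Hypothesis A4c : (\int[P]_w ((phis (X 0%N w) * m (X 0%N w, X 1%N w) * phi (X 1%N w))
            ^+ 2)%:E < +oo)%E.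

Lemma pair_law_Q2 : pair_law Q P1 (Q2 P X).
Proof. exact: (pair_law_step hX 0). Qed.

Lemma Q2_snd B : measurable B -> Q2 P X (setT `*` B) = Q B.
Proof. exact: (step_law_snd hX 0). Qed.

Local Notation n := (ipnorm (L2ip Q)).
Local Notation M := (transition_class pair_law_Q2 Q2_snd m_meas m_pos A1).
Hypothesis finite_rank : forall e : R, 0 < e -> exists k (f : 'I_k -> L2class Q),
  (forall j, n (f j) <= 1) /\
  forall u, n (M u - \sum_j L2ip Q (M u) (f j) *: f j) <= e * n u.

Theorem psi_rho_efficient_influence :
  efficient_influence P X Q P1 m (psi_rho m rho phi phis).
Proof.
have mphi2 : measurable_fun setT (fun z : T * T => phi z.2).
  by apply: measurableT_comp => //; exact: L2_measurable (pe_phi_L2 A1).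
have mphis : measurable_fun setT (fun z : T * T => phis z.1).
  by apply: measurableT_comp => //; exact: L2_measurable (pe_phis_L2 A1).
have A4c' : (\int[Q2 P X]_z ((phis z.1 * m z * phi z.2) ^+ 2)%:E < +oo)%E.
  rewrite -(integral_step hX 0) //.
    by apply/measurable_EFinP; apply: measurable_funX; do ! apply: measurable_funM.
  by move=> z; rewrite lee_fin sqr_ge0.
have Lpsi := L2_psi_rho pair_law_Q2 m_meas m_pos A1 A4c'.
exists (psi_rho m rho phi phis).
  split => // g [[Lg g0] [C gC]].
  have g0' : {ae Q, forall x, \int[P1 x]_y g (x, y) = 0}.
    by apply: filterS g0 => x hx; rewrite /Rintegral hx.
  rewrite (inner_psi_rho pair_law_Q2 m_meas m_pos A1 A4c' Lg g0').
  exact: (rho_submodel_derive phi_phis finite_rank (L2_measurable Lg) gC g0').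
split; first by split => //; exact: psi_rho_conditional_mean.
move=> h _; rewrite /inner -[RHS](_ : \int[Q2 P X]_z (0 : R) = 0).
  by apply: eq_Rintegral => z _; rewrite /= subrr mul0r.
by rewrite Rintegral_cst // mul0r.
Qed.

Lemma V_rhoE : V_rho P X m rho phi phis =
  inner (Q2 P X) (psi_rho m rho phi phis) (psi_rho m rho phi phis).
Proof.
have mphi2 : measurable_fun setT (fun z : T * T => phi z.2).
  by apply: measurableT_comp => //; exact: L2_measurable (pe_phi_L2 A1).
have mphi1 : measurable_fun setT (fun z : T * T => phi z.1).
  by apply: measurableT_comp => //; exact: L2_measurable (pe_phi_L2 A1).
have mphis : measurable_fun setT (fun z : T * T => phis z.1).
  by apply: measurableT_comp => //; exact: L2_measurable (pe_phis_L2 A1).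
rewrite /V_rho /inner /Rintegral; congr fine.
rewrite (integral_step hX 0 (F := fun z => (psi_rho m rho phi phis z ^+ 2)%:E)) //.
by apply/measurable_EFinP; apply: measurable_funX; apply: measurable_funB;
  do ! apply: measurable_funM.
by move=> z; rewrite lee_fin sqr_ge0.
Qed.

End efficient_influence.

(** * Expansion of the largest generalized eigenvalue *)

(** Coordinatewise limits alone would cost a factor [k] in the bound. Passing first from [i] to
    [i + N] by telescoping keeps the right constant, and the lossy bound is used only at [i + N],
    where it is below any [e]. *)
Lemma col_geometric_complete (R : realType) (k : nat) (v : nat -> 'cV[R]_k) (C q : R) :
  0 <= q -> q < 1 -> (forall i, enorm (v i.+1 - v i) <= C * q ^+ i) ->
  exists l, forall i, enorm (v i - l) <= C * q ^+ i / (1 - q).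
Proof.
move=> q0 q1 hv; have q1' : 0 < 1 - q by rewrite subr_gt0.
have lim j : exists l, forall i, `|v i j 0 - l| <= C * q ^+ i / (1 - q).
  apply: geometric_cauchy_real => // i; apply: le_trans (hv i).
  by have := coord_le_enorm (v i.+1 - v i) j; rewrite !mxE.
have [l hl] := choice lim.
have C0 : 0 <= C.
  by have := hv 0; rewrite expr0 mulr1; apply: le_trans; rewrite enormE ipnorm_ge0.
pose r i := C * q ^+ i / (1 - q).
have rE i : r i = C * q ^+ i + r i.+1.
  by rewrite /r exprS; field; rewrite gt_eqF.
have tele i j : enorm (v i - v (i + j)%N) <= r i - r (i + j)%N.
  elim: j => [|j IH]; first by rewrite addn0 !subrr enormE ipnorm0.
  have -> : v i - v (i + j.+1)%N = (v i - v (i + j)%N) + (v (i + j)%N - v (i + j.+1)%N).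
    by rewrite addrA subrK.
  rewrite enormE; apply: le_trans (ipnormD _ _ _) _; rewrite -!enormE.
  have := hv (i + j)%N; rewrite enormE ipnormB -enormE addnS => h2.
  by have := rE (i + j)%N; lra.
pose lv : 'cV[R]_k := \col_j l j.
exists lv => i; apply/ler_addgt0Pr => e e0.
have [N hN] := cvg_geometric_eps (k%:R * C / (1 - q)) q0 q1 e0.
have -> : v i - lv = (v i - v (i + N)%N) + (v (i + N)%N - lv) by rewrite addrA subrK.
rewrite enormE; apply: le_trans (ipnormD _ _ _) _; rewrite -!enormE; apply: lerD.
  apply: le_trans (tele i N) _; rewrite lerBlDr lerDl /r divr_ge0 ?mulr_ge0 ?exprn_ge0 //.
  exact: ltW.
apply: le_trans (ltW hN).
have -> : v (i + N)%N - lv = \sum_j (v (i + N)%N - lv) j 0 *: delta_mx j 0.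
  by rewrite [LHS]matrix_sum_delta; apply: eq_bigr => j _; rewrite big_ord1.
rewrite enormE; apply: le_trans (ipnorm_sum _ _ _ _) _.
apply: le_trans (_ : \sum_(j < k) r N <= _).
  apply: ler_sum => j _; rewrite ipnormZ -enormE.
  rewrite enorm_delta_mx mulr1 !mxE; apply: le_trans (hl j _) _.
  rewrite /r ler_wpM2r ?invr_ge0 ?(ltW q1') // ler_wpM2l //.
  by rewrite ler_wiXn2l ?leq_addl // ltW.
rewrite sumr_const card_ord /r -[_ *+ k]mulr_natl le_eqVlt; apply/orP; left; apply/eqP.
ring.
Qed.

Section galerkin.
Variables (R : realType) (E : lmodType R) (b a : semi_ip E) (M : {linear E -> E}).
Variables (phi phis : E) (rho kap K B : R).
Local Notation n := (ipnorm b).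
Local Notation na := (ipnorm a).
Hypothesis b_def : forall u, n u = 0 -> u = 0.
Hypotheses (kap0 : 0 <= kap) (kap_rho : kap < rho).
Hypothesis n_na : forall u, n u <= na u.
Hypothesis na_n : forall u, na u <= K * n u.
Hypothesis K0 : 0 <= K.
Hypothesis M_phi : M phi = rho *: phi.
Hypothesis M_phis : forall u, b (M u) phis = rho * b u phis.
Hypothesis phi_phis : b phi phis = 1.
Hypothesis gap : forall u, b u phis = 0 -> na (M u) <= kap * na u.
Hypotheses (B0 : 0 <= B) (M_bounded : forall u, n (M u) <= B * n u).

Let F := n phi.
Let S := n phis.
Let pc := perturbation_const b phi phis K.
Let dc := deviation_const b phi phis rho kap K.
Let F0 : 0 <= F. Proof. exact: ipnorm_ge0. Qed.
Let S0 : 0 <= S. Proof. exact: ipnorm_ge0. Qed.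
Let gap0 : 0 < rho - kap. Proof. by rewrite subr_gt0. Qed.
Let rho0 : 0 < rho. Proof. exact: le_lt_trans kap_rho. Qed.
Let SF0 : 0 <= 1 + S * F. Proof. by rewrite addr_ge0 // mulr_ge0. Qed.
Let pc0 : 0 <= pc.
Proof. by rewrite /pc /perturbation_const !(addr_ge0, mulr_ge0). Qed.
Let dc0 : 0 <= dc.
Proof.
by rewrite /dc /deviation_const mulr_ge0 ?invr_ge0 ?(ltW gap0) // !mulr_ge0.
Qed.

(** With [x = delta + a1], the first constant bounds the distance of the eigenvector to [phi] by a
    multiple of [x], the second does so for the error of the operator at the eigenvector, and
    [galerkin_const] collects the three remainders of the expansion. *)
Definition galerkin_const1 : R := 2 * dc * (2 * (1 + B) * (F + 1) + rho).
Definition galerkin_const2 : R := 2 * (1 + B) * (F + 1) + rho + galerkin_const1.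
Definition galerkin_const : R :=
  S * galerkin_const2 * (S * (F + 1)) + S * (1 + rho) * (1 + galerkin_const1) +
  B * (1 + galerkin_const1).
Local Notation C1 := galerkin_const1.
Local Notation C2 := galerkin_const2.

Let C10 : 0 <= C1.
Proof.
rewrite /C1; apply: mulr_ge0; first by rewrite mulr_ge0.
by apply: addr_ge0; rewrite ?(ltW rho0) // !mulr_ge0 // addr_ge0.
Qed.

Let C20 : 0 <= C2.
Proof.
rewrite /C2; apply: addr_ge0 => //.
by apply: addr_ge0; rewrite ?(ltW rho0) // !mulr_ge0 // addr_ge0.
Qed.

Section matrices.
Variables (k : nat) (iota : {linear 'cV[R]_k -> E}) (Mo Gh Mh : 'M[R]_k).
Hypothesis iota_isom : forall u v, b (iota u) (iota v) = dot u v.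
Hypothesis MoE : forall u v, dot u (Mo *m v) = b (iota u) (M (iota v)).

Let iotaZ c v : iota (c *: v) = c *: iota v. Proof. exact: linearZ. Qed.
Let iotaB u v : iota (u - v) = iota u - iota v. Proof. exact: linearB. Qed.

(** The adjoint of [iota], see [dot_sieve_coord]; as [iota] is an isometry, [iota (sieve_coord u)]
    is the orthogonal projection of [u] on its range. *)
Definition sieve_coord (u : E) : 'cV[R]_k := \col_j b (iota (delta_mx j 0)) u.

Lemma dot_sieve_coord c u : dot c (sieve_coord u) = b (iota c) u.
Proof.
have -> : iota c = \sum_j c j 0 *: iota (delta_mx j 0).
  rewrite {1}[c]matrix_sum_delta raddf_sum; apply: eq_bigr => j _.
  by rewrite big_ord1; exact: iotaZ.
rewrite ip_suml dotE; apply: eq_bigr => j _.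
by rewrite ipZl mxE.
Qed.

Lemma ipnorm_iota c : n (iota c) = enorm c.
Proof. by rewrite /ipnorm iota_isom enormE. Qed.

Lemma enorm_sieve_coord u : enorm (sieve_coord u) <= n u.
Proof.
have [h|h] := eqVneq (enorm (sieve_coord u)) 0; first by rewrite h ipnorm_ge0.
have hp : 0 < enorm (sieve_coord u) by rewrite lt_neqAle eq_sym h enormE ipnorm_ge0.
rewrite -(ler_pM2l hp) -expr2 {1}enormE sqr_ipnorm /= dot_sieve_coord.
apply: le_trans (ler_norm _) _; apply: le_trans (ip_cauchy_schwarz _ _ _) _.
by rewrite ipnorm_iota.
Qed.

Lemma sieve_coord_op v : sieve_coord (M (iota v)) = Mo *m v.
Proof.
apply/colP => j; rewrite mxE -MoE /dot trmx_delta -rowE mxE.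
by [].
Qed.

Let p := sieve_coord phi.
Let ps := sieve_coord phis.
Let delta := mxopnorm (Gh - 1%:M) + mxopnorm (Mh - Mo).
Let a1 := n (iota p - phi).
Let a2 := n (iota ps - phis).
Variable eps : R.
Hypothesis eps0 : 0 <= eps.
Hypothesis eps_close : forall u, n (iota (sieve_coord (M u)) - M u) <= eps * n u.
Hypothesis delta_small : delta <= 2^-1.
Hypothesis pc_small : 4 * (pc * (2 * (1 + B) * delta + eps)) <= rho - kap.
Hypothesis a1_small : S * a1 <= 2^-1.
Hypothesis K_small : K * (2 * (1 + S * F) * a1) <= 1.
Hypotheses (eps1 : eps <= 1) (dc_small : dc * eps <= 2^-1).

Let Gd : mxopnorm (Gh - 1%:M) <= delta. Proof. by rewrite lerDl mxopnorm_ge0. Qed.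
Let Md : mxopnorm (Mh - Mo) <= delta. Proof. by rewrite lerDr mxopnorm_ge0. Qed.
Let delta0 : 0 <= delta. Proof. by rewrite addr_ge0 ?mxopnorm_ge0. Qed.
Let a10 : 0 <= a1. Proof. exact: ipnorm_ge0. Qed.
Let a20 : 0 <= a2. Proof. exact: ipnorm_ge0. Qed.
Let en0 (v : 'cV[R]_k) : 0 <= enorm v. Proof. by rewrite enormE ipnorm_ge0. Qed.

Let enormD (u v : 'cV[R]_k) : enorm (u + v) <= enorm u + enorm v.
Proof. rewrite !enormE; exact: ipnormD. Qed.

Let dot_le (u v : 'cV[R]_k) : `|dot u v| <= enorm u * enorm v.
Proof. rewrite !enormE; exact: (ip_cauchy_schwarz (dot_ip R k)). Qed.

(** [Gh] is within 1/2 of the identity, so its inverse has norm at most 2. *)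
Lemma enorm_le_gram v : enorm v <= 2 * enorm (Gh *m v).
Proof.
have h : enorm ((Gh - 1%:M) *m v) <= 2^-1 * enorm v.
  apply: le_trans (mxopnormP _ _) _; apply: ler_wpM2r => //; exact: le_trans Gd _.
have : enorm v <= enorm (Gh *m v) + enorm ((Gh - 1%:M) *m v).
  rewrite [enorm ((Gh - 1%:M) *m v)]enormE -ipnormN -enormE.
  apply: le_trans (enormD _ _); rewrite mulmxBl mul1mx opprB.
  by rewrite addrC subrK.
by lra.
Qed.

Lemma gram_unit : Gh \in unitmx.
Proof.
apply: unitmx_inj => v h; apply/colP => i; rewrite [RHS]mxE; apply/eqP.
rewrite -normr_le0; apply: le_trans (coord_le_enorm _ _) _.
by apply: le_trans (enorm_le_gram v) _; rewrite h enormE ipnorm0 mulr0.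
Qed.

Let Am := invmx Gh *m Mh.

Let mulAm_linear : linear (mulmx Am : 'cV[R]_k -> 'cV[R]_k).
Proof. by move=> c u v; rewrite mulmxDr -scalemxAr. Qed.

Let A : {linear 'cV[R]_k -> 'cV[R]_k} :=
  HB.pack (mulmx Am : 'cV[R]_k -> 'cV[R]_k)
    (GRing.isLinear.Build R 'cV[R]_k 'cV[R]_k *:%R _ mulAm_linear).

Let AE v : A v = Am *m v. Proof. by []. Qed.

Lemma enorm_Mo v : enorm (Mo *m v) <= B * enorm v.
Proof.
rewrite -sieve_coord_op; apply: le_trans (enorm_sieve_coord _) _.
by apply: le_trans (M_bounded _) _; rewrite ipnorm_iota.
Qed.

Let A_close_mx v : enorm (A v - Mo *m v) <= 2 * (1 + B) * delta * enorm v.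
Proof.
rewrite -!mulrA; apply: le_trans (enorm_le_gram _) _; apply: ler_wpM2l => //.
(* Multiplying by [Gh] removes the inverse hidden in [A] and leaves an expression linear in the two
   matrix errors. *)
have -> : Gh *m (A v - Mo *m v) = (Mh - Mo) *m v - (Gh - 1%:M) *m (Mo *m v).
  have e : Gh *m (A v) = Mh *m v by rewrite AE /Am mulmxA mulKVmx // gram_unit.
  rewrite mulmxBr e !mulmxBl mul1mx.
  by rewrite opprB addrA subrK.
apply: le_trans (enormD _ _) _; rewrite [enorm (- _)]enormE ipnormN -enormE.
rewrite mulrDl mul1r; apply: lerD.
  by apply: le_trans (mxopnormP _ _) _; apply: ler_wpM2r.
apply: le_trans (mxopnormP _ _) _; rewrite mulrCA; apply: ler_pM => //.
  exact: mxopnorm_ge0.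
exact: enorm_Mo.
Qed.

Let A_close v : n (iota (A v) - M (iota v)) <= (2 * (1 + B) * delta + eps) * n (iota v).
Proof.
have -> : iota (A v) - M (iota v) = iota (A v - Mo *m v) + (iota (Mo *m v) - M (iota v)).
  by rewrite (linearB iota) /= addrA subrK.
apply: le_trans (ipnormD _ _ _) _; rewrite mulrDl ipnorm_iota; apply: lerD.
  by rewrite ipnorm_iota; exact: A_close_mx.
by rewrite -sieve_coord_op; exact: eps_close.
Qed.

Let iota_inj v : iota v = 0 -> v = 0.
Proof.
move=> h; apply: dot_def; rewrite -iota_isom h; exact: ip0l.
Qed.

Let V_complete (v : nat -> 'cV[R]_k) (C q : R) : 0 <= q -> q < 1 ->
  (forall i, n (iota (v i.+1 - v i)) <= C * q ^+ i) ->
  exists l, forall i, n (iota (v i - l)) <= C * q ^+ i / (1 - q).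
Proof.
move=> q0 q1 h; have [|l hl] := col_geometric_complete q0 q1 (v := v) (C := C).
  by move=> i; rewrite -ipnorm_iota.
by exists l => i; rewrite ipnorm_iota.
Qed.

Let ell_p : `|b (iota p) phis - 1| <= S * a1.
Proof.
by rewrite -phi_phis -ipBl mulrC; exact: ip_cauchy_schwarz.
Qed.

Let s := b (iota p) phis.
Let s_ge : 2^-1 <= s.
Proof.
have := le_trans ell_p a1_small; rewrite ler_norml -/s => /andP[h _]; lra.
Qed.
Let s0 : 0 < s. Proof. by apply: lt_le_trans s_ge; rewrite invr_gt0. Qed.

(** The projection of [phi], rescaled to satisfy the normalisation [<v, phis> = 1]. As [s >= 1/2],
    rescaling costs at most the factor [2 (1 + S F)]. *)
Let v0 := s^-1 *: p.

Let v0_phis : b (iota v0) phis = 1.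
Proof. by rewrite /v0 linearZ /= ipZl mulVf // gt_eqF. Qed.

Let v0_close : K * n (iota v0 - phi) <= 1.
Proof.
apply: le_trans K_small; apply: ler_wpM2l => //.
have -> : iota v0 - phi = s^-1 *: ((iota p - phi) - (s - 1) *: phi).
  rewrite /v0 linearZ /= scalerBl scale1r opprB addrA subrK scalerBr scalerA.
  by rewrite mulVf ?gt_eqF // scale1r.
rewrite ipnormZ ger0_norm ?invr_ge0 ?(ltW s0) // -mulrA; apply: ler_pM.
- by rewrite invr_ge0 ltW.
- exact: ipnorm_ge0.
- by rewrite -[leRHS]invrK lef_pV2 ?posrE ?invr_gt0.
rewrite mulrDl mul1r; apply: le_trans (ipnorm_triangleB _ _ _) _; apply: lerD => //.
by rewrite ipnormZ mulrAC; apply: ler_wpM2r.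
Qed.

Theorem galerkin_expansion : exists2 r, largest_gen_eigenvalue Mh Gh r &
  `|r - rho - (dot ps (Mh *m p) - rho * dot ps (Gh *m p))|
    <= galerkin_const * ((delta + a1) * (delta + a2)).
Proof.
have e0 : 0 <= 2 * (1 + B) * delta + eps.
  by apply: addr_ge0 => //; rewrite !mulr_ge0 // addr_ge0.
have [f [r [[f1 fn] Af [er r0] fdev hr]]] := perturbed_eigenpair b_def kap0 kap_rho n_na na_n
  K0 M_phi M_phis phi_phis gap iota_inj V_complete e0 pc_small A_close v0_phis v0_close.
have Gu := gram_unit.
have Mf : Mh *m f = r *: (Gh *m f).
  by rewrite scalemxAr -Af AE /Am mulmxA mulKVmx.
have fe : enorm f <= F + 1 by rewrite -ipnorm_iota.
exists r.
  split.
    exists f => //; apply/eqP => fz; move: f1; rewrite fz linear0 ip0l => /eqP.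
    by rewrite eq_sym oner_eq0.
  move=> l [v vn0 hv].
  have Av : A v = l *: v by rewrite AE /Am -mulmxA hv -scalemxAr mulKmx.
  have := hr l 0 v 0; rewrite expr0n addr0 sqrtr_sqr => h.
  apply: le_trans (ler_norm _) _; apply: h.
  - by move=> [vz _]; rewrite vz eqxx in vn0.
  - by rewrite Av scaler0 subr0.
  - by rewrite scale0r scaler0 addr0 linear0.
set e := iota (A f) - M (iota f) in er fdev.
set h := iota f - phi in fdev.
set x := delta + a1.
have dx : delta <= x by rewrite lerDl.
have ax : a1 <= x by rewrite lerDr.
have x0 : 0 <= x by rewrite addr_ge0.
have c0 : 0 <= 2 * (1 + B) * (F + 1) by rewrite !mulr_ge0 // addr_ge0.
(* The bound [A_close] would contribute [eps] times the norm of [f], which is not of order [x].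
   Writing [f = phi + h] and using [M phi = rho phi], the projection error of [M] at [phi] becomes
   [rho] times that of [phi], and [eps] multiplies only the norm of [h]. *)
have ne : n e <= (2 * (1 + B) * (F + 1) + rho) * x + eps * n h.
  have -> : e = iota (A f - Mo *m f) + (rho *: (iota p - phi) +
      (iota (sieve_coord (M h)) - M h)).
    have -> : sieve_coord (M h) = Mo *m f - rho *: p.
      apply/colP => j; rewrite -sieve_coord_op !mxE /h (linearB M) /= M_phi ipBr ipZr.
      by [].
    rewrite /e /h (linearB M) /= M_phi !iotaB iotaZ /= scalerBr.
    rewrite [RHS]addrC !addrA.
    have -> (X Y Z W V : E) : X - Y + Z - X - (W - Y) + V - Z = V - W.
      rewrite opprB [X - Y + Z - X]addrAC [X - Y - X]addrAC subrr add0r.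
      by rewrite [- Y + Z + _]addrACA addNr add0r [LHS]addrAC [Z - W - Z]addrAC subrr add0r addrC.
    by [].
  apply: le_trans (ipnormD _ _ _) _; rewrite mulrDl -addrA; apply: lerD.
    rewrite ipnorm_iota; apply: le_trans (A_close_mx _) _.
    have -> : 2 * (1 + B) * (F + 1) * x = 2 * (1 + B) * (x * (F + 1)) by ring.
    rewrite -!mulrA; do 2 ![apply: ler_wpM2l => //]; first by rewrite addr_ge0.
    exact: ler_pM.
  apply: le_trans (ipnormD _ _ _) _; apply: lerD; last exact: eps_close.
  by rewrite ipnormZ (ger0_norm (ltW rho0)) ler_wpM2l // ltW.
(* Since [dc * eps <= 1/2], the term in the norm of [h] on the right is absorbed on the left, hence
   the factor 2 in [galerkin_const1]. *)
have nh : n h <= C1 * x.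
  have := le_trans fdev (ler_wpM2l dc0 ne); rewrite mulrDr mulrA [dc * (eps * _)]mulrA.
  have := ler_wpM2r (ipnorm_ge0 b h) dc_small; rewrite /C1 -/dc.
  set u := n h; set y := _ + rho; move=> h1 h2.
  have : 2 * dc * y * x = 2 * (dc * y * x) by ring.
  move: h1 h2; set z := dc * y * x; set t := dc * eps * u; lra.
have {}ne : n e <= C2 * x.
  apply: le_trans ne _; rewrite /C2 [leRHS]mulrDl; apply: lerD => //.
  by rewrite -[leRHS]mul1r; apply: ler_pM => //; exact: ipnorm_ge0.
have r_rho : `|r - rho| <= S * C2 * x.
  have -> : r - rho = b e phis by rewrite er addrC addKr.
  apply: le_trans (ip_cauchy_schwarz _ _ _) _; rewrite mulrC -mulrA ler_wpM2l //.
set g := p - f.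
have ng : enorm g <= (1 + C1) * x.
  have -> : enorm g = n ((iota p - phi) - h).
    by rewrite -ipnorm_iota /g (linearB iota) /= /h opprB addrA subrK.
  rewrite mulrDl mul1r; apply: le_trans (ipnorm_triangleB _ _ _) _; exact: lerD.
have nps : enorm ps <= S := enorm_sieve_coord _.
have bd v : b (iota v) phis = dot ps v by rewrite -dot_sieve_coord dotC.
pose t1 := (r - rho) * dot ps ((Gh - 1%:M) *m f).
pose t2 := dot ps ((Mh - Mo) *m g) - rho * dot ps ((Gh - 1%:M) *m g).
pose t3 := b (iota ps - phis) (M (iota g)).
(* Expand [dot ps ((Mh - r Gh) f) = 0] around [p]; the terms of first order in [g]
   only involve [Mo - rho], which [phis] annihilates up to [iota ps - phis]. *)
have key : r - rho - (dot ps (Mh *m p) - rho * dot ps (Gh *m p)) = - (t1 + t2 + t3).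
  have dB u v : dot ps (u - v) = dot ps u - dot ps v := ipBr (dot_ip R k) _ _ _.
  have dZ c v : dot ps (c *: v) = c * dot ps v := ipZr (dot_ip R k) _ _ _.
  have e3 : t3 = dot ps (Mo *m g) - rho * dot ps g.
    by rewrite /t3 ipBl -MoE [b phis _]ipC M_phis bd.
  have e4 : dot ps (Mh *m f) = r * dot ps (Gh *m f) by rewrite Mf dZ.
  have e5 : dot ps f = 1 by rewrite -bd.
  have gB N : dot ps (N *m g) = dot ps (N *m p) - dot ps (N *m f) by rewrite /g mulmxBr dB.
  have dBl N N' v : dot ps ((N - N') *m v) = dot ps (N *m v) - dot ps (N' *m v).
    by rewrite mulmxBl dB.
  have g1 : dot ps g = dot ps p - 1 by rewrite /g dB e5.
  by rewrite e3 /t1 /t2 !dBl !mul1mx !gB e4 e5 g1; ring.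
rewrite key normrN.
have k1 : `|t1| <= S * C2 * x * (S * (delta * (F + 1))).
  rewrite /t1 normrM; apply: ler_pM => //.
  apply: le_trans (dot_le _ _) _; apply: ler_pM => //.
  by apply: le_trans (mxopnormP _ _) _; apply: ler_pM => //; exact: mxopnorm_ge0.
have k2 : `|t2| <= S * (delta * ((1 + C1) * x)) + rho * (S * (delta * ((1 + C1) * x))).
  have part N : mxopnorm N <= delta -> `|dot ps (N *m g)| <= S * (delta * ((1 + C1) * x)).
    move=> hN; apply: le_trans (dot_le _ _) _; apply: ler_pM => //.
    by apply: le_trans (mxopnormP _ _) _; apply: ler_pM => //; exact: mxopnorm_ge0.
  apply: le_trans (ler_normB _ _) _; apply: lerD; first exact: part.
  by rewrite normrM (ger0_norm (ltW rho0)) ler_wpM2l ?(ltW rho0) // part.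
have k3 : `|t3| <= a2 * (B * ((1 + C1) * x)).
  apply: le_trans (ip_cauchy_schwarz _ _ _) _; rewrite -/a2 ler_wpM2l //.
  apply: le_trans (M_bounded _) _; rewrite ler_wpM2l // ipnorm_iota //.
apply: le_trans (ler_normD _ _) _.
apply: le_trans (lerD (le_trans (ler_normD _ _) (lerD k1 k2)) k3) _.
have C1' : 0 <= 1 + C1 by rewrite addr_ge0.
have F1 : 0 <= F + 1 by rewrite addr_ge0.
(* The product is the sum of the three bounds plus nonnegative terms. *)
have -> : galerkin_const * (x * (delta + a2)) =
  (S * C2 * x * (S * (delta * (F + 1))) + (S * (delta * ((1 + C1) * x)) +
    rho * (S * (delta * ((1 + C1) * x)))) + a2 * (B * ((1 + C1) * x))) +
  (S * C2 * (S * (F + 1)) * x * a2 + S * (1 + rho) * (1 + C1) * x * a2 + B * (1 + C1) * x * delta).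
  rewrite /galerkin_const; ring.
rewrite lerDl; apply: addr_ge0; first apply: addr_ge0.
- by rewrite !mulr_ge0.
- by rewrite !mulr_ge0 // addr_ge0 // ltW.
- by rewrite !mulr_ge0.
Qed.

End matrices.

(** The order of the quantifiers matters: [t0] and [C] are fixed before the dimension, the embedding
    and the matrices, and so serve along a growing sieve. *)
Theorem galerkin_uniform : exists t0 C : R, [/\ 0 < t0, 0 <= C &
  forall (k : nat) (iota : {linear 'cV[R]_k -> E}) (Mo Gh Mh : 'M[R]_k) (eps : R),
  (forall u v, b (iota u) (iota v) = dot u v) ->
  (forall u v, dot u (Mo *m v) = b (iota u) (M (iota v))) ->
  0 <= eps -> eps <= t0 ->
  (forall u, n (iota (sieve_coord iota (M u)) - M u) <= eps * n u) ->
  forall delta, mxopnorm (Gh - 1%:M) + mxopnorm (Mh - Mo) <= delta -> delta <= t0 ->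
  forall a1 a2, n (iota (sieve_coord iota phi) - phi) <= a1 -> a1 <= t0 ->
  n (iota (sieve_coord iota phis) - phis) <= a2 ->
  exists2 r, largest_gen_eigenvalue Mh Gh r &
  `|r - rho - (dot (sieve_coord iota phis) (Mh *m sieve_coord iota phi)
      - rho * dot (sieve_coord iota phis) (Gh *m sieve_coord iota phi))|
    <= C * ((delta + a1) * (delta + a2))].
Proof.
(* Each smallness condition of [galerkin_expansion] has the form [c y <= 1]; [big] is the sum of
   these factors [c], so [t0 = big^-1] meets all of them. *)
pose big := 2 + 4 * (pc * (2 * (1 + B) + 1)) / (rho - kap) + 2 * S
  + K * (2 * (1 + S * F)) + 2 * dc.
have p1 : 0 <= 4 * (pc * (2 * (1 + B) + 1)) / (rho - kap).
  by rewrite divr_ge0 ?(ltW gap0) // !(mulr_ge0, addr_ge0).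
have p2 : 0 <= 2 * S by rewrite mulr_ge0.
have p3 : 0 <= K * (2 * (1 + S * F)) by rewrite !mulr_ge0.
have p4 : 0 <= 2 * dc by rewrite mulr_ge0.
have big2 : 2 <= big by rewrite /big; lra.
have big0 : 0 < big by apply: lt_le_trans big2.
have tb (x y : R) : 0 <= x -> x <= big -> 0 <= y -> y <= big^-1 -> x * y <= 1.
  move=> x0 xb y0 yb; rewrite -(mulfV (lt0r_neq0 big0)).
  by apply: ler_pM.
have C0 : 0 <= galerkin_const.
  rewrite /galerkin_const; apply: addr_ge0; first apply: addr_ge0.
  - by rewrite !mulr_ge0 // addr_ge0.
  - by rewrite !mulr_ge0 // addr_ge0 // ltW.
  - by rewrite mulr_ge0 // addr_ge0.
exists big^-1, galerkin_const; split; [by rewrite invr_gt0|by []|].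
move=> k iota Mo Gh Mh eps h1 h2 eps0 epst h3 delta hd hdt a1 a2 ha1 ha1t ha2.
set dl := _ + _ in hd; set b1 := n _ in ha1; set b2 := n (_ - phis) in ha2.
have dl0 : 0 <= dl by rewrite addr_ge0 ?mxopnorm_ge0.
have b10 : 0 <= b1 by exact: ipnorm_ge0.
have b20 : 0 <= b2 by exact: ipnorm_ge0.
have dlt := le_trans hd hdt; have b1t := le_trans ha1 ha1t.
have [||||||r r1 r2] := galerkin_expansion (Gh := Gh) (Mh := Mh) h1 h2 eps0 h3; rewrite -/dl -/b1.
- have : 2 * dl <= 1 by apply: tb.
  lra.
- have h : 2 * (1 + B) * dl + eps <= (2 * (1 + B) + 1) * big^-1.
    rewrite [leRHS]mulrDl mul1r; apply: lerD => //; apply: ler_wpM2l => //.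
    by rewrite mulr_ge0 // addr_ge0.
  apply: le_trans (_ : 4 * (pc * ((2 * (1 + B) + 1) * big^-1)) <= _).
    by do 2 ![apply: ler_wpM2l => //].
  have : 4 * (pc * (2 * (1 + B) + 1)) / (rho - kap) * big^-1 <= 1.
    by apply: tb; rewrite ?invr_ge0 ?(ltW big0) // /big; lra.
  by rewrite mulrAC ler_pdivrMr // mul1r -!mulrA.
- have : 2 * S * b1 <= 1 by apply: tb => //; rewrite /big; lra.
  rewrite -mulrA; set y := S * b1; lra.
- have : K * (2 * (1 + S * F)) * b1 <= 1 by apply: tb => //; rewrite /big; lra.
  by rewrite !mulrA.
- have : 2 * eps <= 1 by apply: tb.
  lra.
- have : 2 * dc * eps <= 1 by apply: tb => //; rewrite /big; lra.
  rewrite -mulrA; set y := dc * eps; lra.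
exists r => //; apply: le_trans r2 _; rewrite -/dl -/b1 -/b2.
by apply: ler_wpM2l => //; apply: ler_pM;
  [exact: addr_ge0|exact: addr_ge0|exact: lerD|exact: lerD].
Qed.

End galerkin.

(** * The sieve space *)

Lemma unitmx_inj_col (R : realType) (k : nat) (A : 'M[R]_k) (v : 'cV[R]_k) :
  A \in unitmx -> A *m v = 0 -> v = 0.
Proof. by move=> Au h; rewrite -[v](mulKmx Au) h mulmx0. Qed.

(** Eigenvectors of the two pencils correspond under [W]. Thus [rhohat], defined from [Mhat] and
    [Ghat], can be studied in coordinates orthonormal for [G]. *)
Lemma gen_eigenvalue_congr (R : realType) (k : nat) (W A B : 'M[R]_k) (l : R) : W \in unitmx ->
  gen_eigenvalue (W *m A *m W) (W *m B *m W) l <-> gen_eigenvalue A B l.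
Proof.
move=> Wu; split=> [[v v0 h]|[v v0 h]].
- exists (W *m v); first by apply/eqP => /(unitmx_inj_col Wu) vz; rewrite vz eqxx in v0.
  move: h; rewrite -!mulmxA scalemxAr => /(congr1 (mulmx (invmx W))).
  by rewrite !mulKmx // => ->.
- exists (invmx W *m v).
    apply/eqP => /(congr1 (mulmx W)); rewrite mulKVmx // mulmx0 => vz.
    by rewrite vz eqxx in v0.
  by rewrite -!mulmxA mulKVmx // h -!scalemxAr.
Qed.

Lemma largest_gen_eigenvalue_congr (R : realType) (k : nat) (W A B : 'M[R]_k) (l : R) :
  W \in unitmx ->
  largest_gen_eigenvalue (W *m A *m W) (W *m B *m W) l -> largest_gen_eigenvalue A B l.
Proof.
move=> Wu [/(gen_eigenvalue_congr _ _ _ Wu) h1 h2]; split => // l' hl'.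
by apply: h2; apply/(gen_eigenvalue_congr _ _ _ Wu).
Qed.

Lemma rhohatE {dO} {Om : measurableType dO} {d} {T : measurableType d} {R : realType}
    (X : nat -> {mfun Om >-> T}) (m : T * T -> R) (k : nat) (b : 'I_k -> T -> R) n w r :
  largest_gen_eigenvalue (Mhat X m b n w) (Ghat X b n w) r -> rhohat X m b n w = r.
Proof.
move=> hr; rewrite /rhohat; set S := [set l | _].
have [g1 g2] := xgetPex 0 (ex_intro S r hr); have [h1 h2] := hr.
by apply/le_anti/andP; split; [exact: h2|exact: g2].
Qed.

Section transfer.
Context {dO : measure_display} {Om : measurableType dO}.
Context {d : measure_display} {T : measurableType d} {R : realType}.
Variables (P : probability Om R) (X : nat -> {mfun Om >-> T}).
Variables (Q : probability T R) (P1 : R.-pker T ~> T).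
Hypothesis hX : stationary_ergodic_markov P X Q P1.

Lemma Rintegral_state t (f : T -> R) : Q.-integrable setT (EFin \o f) ->
  \int[P]_w f (X t w) = \int[Q]_x f x.
Proof.
move=> /integrableP[mf hf]; rewrite /Rintegral; congr fine.
rewrite -[LHS](@integral_distribution _ _ _ _ _ P (X t) (EFin \o f) mf); last first.
  apply/integrableP; split; first exact: measurableT_comp.
  rewrite (integral_state hX t (f := fun x => `|(EFin \o f) x|%E)) //.
  exact: measurableT_comp.
by apply: eq_measure_integral => A mA _; exact: sem_law hX _ _ mA.
Qed.

Lemma Rintegral_step (F : T * T -> R) : (Q2 P X).-integrable setT (EFin \o F) ->
  \int[P]_w F (X 0%N w, X 1%N w) = \int[Q2 P X]_z F z.
Proof.
move=> /integrableP[mF hF]; rewrite /Rintegral; congr fine.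
rewrite -[LHS](@integral_distribution _ _ _ _ _ P (step X) (EFin \o F) mF) //.
apply/integrableP; split; first exact: measurableT_comp.
rewrite (integral_step hX 0 (F := fun x => `|(EFin \o F) x|%E)) //.
exact: measurableT_comp.
Qed.

End transfer.

Section sieve.
Context {dO : measure_display} {Om : measurableType dO}.
Context {d : measure_display} {T : measurableType d} {R : realType}.
Variables (P : probability Om R) (X : nat -> {mfun Om >-> T}).
Variables (Q : probability T R) (P1 : R.-pker T ~> T) (m : T * T -> R).
Hypothesis hX : stationary_ergodic_markov P X Q P1.
Hypotheses (m_meas : measurable_fun setT m) (m_pos : forall z, 0 < m z).
Variables (rho : R) (phi phis : T -> R).
Hypothesis A1 : principal_eigenpair Q P1 m rho phi phis.
Let mb : Mbounded Q P1 m := pe_bounded A1.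
Let dm : dominated_by m 1 m := dominated_self m_meas m_pos.
Local Notation H := (L2class Q).
Local Notation ip := (L2ip Q).
Local Notation n := (ipnorm (L2ip Q)).
Local Notation hnu := (pair_law_Q2 hX).
Local Notation hsnd := (Q2_snd hX).
Local Notation M := (transition_class hnu hsnd m_meas m_pos A1).

Variables (k : nat) (b : 'I_k -> T -> R).
Hypotheses (b_L2 : forall j, L2 Q (b j)) (b_indep : lin_indep Q b).

Local Notation G := (Gmx P X b).
Local Notation W := (mxinvsqrt G).

Lemma GmxE i j : G i j = inner Q (b i) (b j).
Proof.
rewrite mxE /inner -(Rintegral_state hX 0 (f := fun x => b i x * b j x)); last first.
  exact: L2_mul_integrable.
by apply: eq_Rintegral => w _; rewrite mxE big_ord1 !mxE.
Qed.

Lemma MmxE i j : Mmx P X m b i j = inner Q (b i) (Mop P1 m (b j)).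
Proof.
rewrite mxE -(integral_pair hnu m_pos mb dm (b_L2 i) (b_L2 j)).
rewrite -(Rintegral_step hX (F := fun z => b i z.1 * m z * b j z.2)); last first.
  exact: (integrable_pair hnu m_pos mb dm).
by apply: eq_Rintegral => w _; rewrite mxE mxE big_ord1 !mxE /=; ring.
Qed.

Definition span_fun (c : 'cV[R]_k) (x : T) : R := \sum_j c j 0 * b j x.

Lemma L2_span_fun c : L2 Q (span_fun c).
Proof.
apply: (@L2_sumP _ _ _ Q _ _ (fun j x => c j 0 * b j x)) => j; exact: L2_scaleP.
Qed.

Definition span_class (c : 'cV[R]_k) : H := \sum_j c j 0 *: cls Q (b j).

Lemma span_class_linear : linear span_class.
Proof.
move=> a u v; rewrite /span_class scaler_sumr -big_split /=; apply: eq_bigr => j _.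
by rewrite !mxE scalerDl scalerA.
Qed.

Lemma cls_span_fun c : cls Q (span_fun c) = span_class c.
Proof.
rewrite /span_class /span_fun.
rewrite (cls_sum (index_enum _) (F := fun j x => c j 0 * b j x)); last first.
  by move=> j; exact: L2_scaleP.
by apply: eq_bigr => j _; rewrite clsZ.
Qed.

Lemma ip_span_class u v : ip (span_class u) (span_class v) = dot u (G *m v).
Proof.
rewrite ip_suml dotE; apply: eq_bigr => i _; rewrite ipZl; congr (_ * _).
rewrite ip_sumr mxE; apply: eq_bigr => j _.
by rewrite ipZr L2ip_cls // GmxE mulrC.
Qed.

Let MZ c u : M (c *: u) = c *: M u. Proof. exact: linearZ. Qed.

Lemma ip_span_class_op u v :
  ip (span_class u) (M (span_class v)) = dot u (Mmx P X m b *m v).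
Proof.
rewrite ip_suml dotE; apply: eq_bigr => i _; rewrite ipZl; congr (_ * _).
rewrite /span_class raddf_sum ip_sumr mxE; apply: eq_bigr => j _.
transitivity (ip (cls Q (b i)) (v j 0 *: class_op P1 m (cls Q (b j)))).
  by congr (ip _ _); exact: MZ.
rewrite ipZr (class_op_cls hnu hsnd m_pos mb dm) //.
by rewrite MmxE [RHS]mulrC (L2ip_cls (b_L2 i) (L2_Mop m_pos mb dm (b_L2 j))).
Qed.

Lemma span_class_inj c : span_class c = 0 -> c = 0.
Proof.
rewrite -cls_span_fun => h.
have h0 : aeeq Q (span_fun c) (cst 0).
  apply: aeeq_trans (aeeq_sym (clsP (L2_span_fun c))) _; rewrite h; exact: L2class_0E.
by apply/colP => j; rewrite mxE; exact: (b_indep h0 j).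
Qed.

Lemma Gmx_sym : G^T = G.
Proof. by apply/matrixP => i j; rewrite mxE !GmxE innerC. Qed.

Lemma Gmx_ge0 v : 0 <= form_mx G v v.
Proof. by rewrite form_mxE -ip_span_class ip_ge0. Qed.

Lemma Gmx_unit : G \in unitmx.
Proof.
apply: unitmx_inj => v h; apply: span_class_inj; apply: (@L2ip_def _ _ _ Q).
by rewrite /ipnorm ip_span_class h -[dot _ _]/(dot_ip R k v 0) ip0r sqrtr0.
Qed.

Lemma mxinvsqrtP : [/\ W^T = W, W \in unitmx & W *m G *m W = 1%:M].
Proof.
have [h1 h2 h3] := posdef_mxsqrt Gmx_sym Gmx_ge0 Gmx_unit.
split; [by rewrite trmx_inv h1|by rewrite unitmx_inv|].
by rewrite -[X in W *m X]h2 mulmxA mulVmx // mul1mx mulmxV.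
Qed.

(** Coordinates in the basis orthonormalised by [G^(-1/2)]; [W G W = 1] makes the map an
    isometry. *)
Definition sieve_iota_fun (c : 'cV[R]_k) : H := span_class (W *m c).

Lemma sieve_iota_linear : linear sieve_iota_fun.
Proof.
by move=> a u v; rewrite /sieve_iota_fun mulmxDr -scalemxAr span_class_linear.
Qed.

Definition sieve_iota : {linear 'cV[R]_k -> H} := pack_linear sieve_iota_linear.
Local Notation iota := sieve_iota.

Lemma sieve_iotaE c : iota c = span_class (W *m c). Proof. by []. Qed.

Lemma sieve_iota_isom u v : ip (iota u) (iota v) = dot u v.
Proof.
have [h1 h2 h3] := mxinvsqrtP; rewrite !sieve_iotaE ip_span_class.
by rewrite -{1}h1 -dot_trmx !mulmxA h3 mul1mx.
Qed.

Lemma sieve_iota_op u v :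
  dot u (orthonormalized P X b (Mmx P X m b) *m v) = ip (iota u) (M (iota v)).
Proof.
have [h1 h2 h3] := mxinvsqrtP; rewrite !sieve_iotaE ip_span_class_op.
by rewrite /orthonormalized -{3}h1 -dot_trmx !mulmxA.
Qed.

Local Notation coord := (sieve_coord ip iota).

Lemma sieve_iota_coord_sum u : iota (coord u) = \sum_j ip u (iota (delta_mx j 0)) *: iota (delta_mx j 0).
Proof.
rewrite [X in iota X]matrix_sum_delta raddf_sum; apply: eq_bigr => j _.
by rewrite big_ord1 mxE [ip u _]ipC; exact: linearZ.
Qed.

(** [sieve_proj] is selected by orthogonality. The orthonormal coordinates of [f] provide one
    solution, and the difference with the selected one lies in the span and is orthogonal to it,
    hence is null. *)
Lemma sieve_projE f : L2 Q f -> L2 Q (sieve_proj Q b f) /\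
  cls Q (sieve_proj Q b f) = iota (coord (cls Q f)).
Proof.
move=> Lf; have [h1 h2 h3] := mxinvsqrtP.
have spanE q : sieve_span b q -> exists c, q = span_fun c.
  move=> [c ->]; exists (\col_j c j); apply/funext => x.
  by apply: eq_bigr => j _; rewrite mxE.
pose p := coord (cls Q f).
have ex : [set q | sieve_span b q /\ forall q', sieve_span b q' -> inner Q (f \- q) q' = 0]
    (span_fun (W *m p)).
  split; first by exists (fun j => (W *m p) j 0).
  move=> q' /spanE[c ->].
  have Lp := L2_span_fun (W *m p); have Lc := L2_span_fun c.
  rewrite -L2ip_cls //; last exact: L2_subP.
  rewrite clsB // !cls_span_fun ipBl -[c](mulKVmx h2) -!sieve_iotaE sieve_iota_isom.
  by rewrite [dot p _]dotC dot_sieve_coord ipC subrr.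
have := xgetPex (cst 0) (ex_intro _ _ ex); rewrite -/(sieve_proj Q b f).
set q1 := sieve_proj Q b f => -[/spanE[c1 e1] o1].
have Lc1 := L2_span_fun c1.
rewrite e1; split => //; rewrite cls_span_fun.
have o2 c : ip (cls Q f) (span_class c) = ip (span_class c1) (span_class c).
  have Lc := L2_span_fun c.
  have := o1 (span_fun c); rewrite e1 -L2ip_cls //; last exact: L2_subP.
  rewrite clsB // !cls_span_fun ipBl => h; apply/eqP; rewrite -subr_eq0; apply/eqP.
  by apply: h; exists (fun j => c j 0).
have e2 : c1 = W *m (invmx W *m c1) by rewrite mulKVmx.
apply/eqP; rewrite -subr_eq0; apply/eqP; apply: (@L2ip_def _ _ _ Q).
rewrite e2 -sieve_iotaE; set c := invmx W *m c1 - coord (cls Q f).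
have ec : iota (invmx W *m c1) - iota (coord (cls Q f)) = iota c by exact/esym/linearB.
apply/eqP; rewrite ec -sqrf_eq0 sqr_ipnorm -{1}ec ipBl; apply/eqP.
rewrite !sieve_iota_isom [dot (coord _) _]dotC dot_sieve_coord ipC.
have e4 : span_class c1 = iota (invmx W *m c1) by rewrite sieve_iotaE -e2.
by rewrite [iota c]sieve_iotaE o2 e4 -sieve_iotaE sieve_iota_isom subrr.
Qed.

Lemma sieve_proj_dist f : L2 Q f ->
  L2norm Q (sieve_proj Q b f \- f) = (n (iota (coord (cls Q f)) - cls Q f))%:E.
Proof.
move=> Lf; have [h1 h2] := sieve_projE Lf.
by rewrite L2norm_cls ?clsB ?h2 //; exact: L2_subP.
Qed.

Lemma sieve_op_close (eps : R) :
  (opnorm Q (fun psi => sieve_proj Q b (Mop P1 m psi) \- Mop P1 m psi)%R <= eps%:E)%E ->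
  forall u, n (iota (coord (M u)) - M u) <= eps * n u.
Proof.
move=> he u; pose A psi := sieve_proj Q b (Mop P1 m psi) \- Mop P1 m psi.
have LM f : L2 Q f -> L2 Q (Mop P1 m f) by exact: (L2_Mop m_pos mb dm).
have LA f : L2 Q f -> L2 Q (A f).
  by move=> Lf; have [h1 h2] := sieve_projE (LM _ Lf); apply: L2_subP => //; exact: LM.
have cA f : L2 Q f -> cls Q (A f) = iota (coord (M (cls Q f))) - M (cls Q f).
  move=> Lf; have [h1 h2] := sieve_projE (LM _ Lf).
  rewrite transition_classE (class_op_cls hnu hsnd m_pos mb dm) // -h2.
  exact: clsB (LM _ Lf).
have coordZ c v : coord (c *: v) = c *: coord v by apply/colP => j; rewrite !mxE ipZr.
have iotaZ c v : iota (c *: v) = c *: iota v by exact: linearZ.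
have hA c f : L2 Q f -> aeeq Q (A (fun x => c * f x)) (fun x => c * A f x).
  move=> Lf; have Lcf := L2_scaleP c Lf.
  apply: aeeq_trans (aeeq_sym (clsP (LA _ Lcf))) _.
  apply: aeeq_trans (clsP (L2_scaleP c (LA _ Lf))).
  rewrite cA // !clsZ //; last exact: LA.
  rewrite cA // MZ coordZ iotaZ -scalerBr; exact: aeeq_refl.
by have := opnorm_bound LA hA he (L2class_L2 u); rewrite (cA _ (L2class_L2 u)) cls_rep.
Qed.

Lemma sieve_finite_rank (eps : R) :
  (opnorm Q (fun psi => sieve_proj Q b (Mop P1 m psi) \- Mop P1 m psi)%R <= eps%:E)%E ->
  exists f : 'I_k -> H, (forall j, n (f j) <= 1) /\
  forall u, n (M u - \sum_j ip (M u) (f j) *: f j) <= eps * n u.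
Proof.
move=> he; exists (fun j => iota (delta_mx j 0)); split.
  by move=> j; rewrite /ipnorm sieve_iota_isom -[Num.sqrt _]/(ipnorm (dot_ip R k) _) -enormE enorm_delta_mx.
by move=> u; rewrite -sieve_iota_coord_sum ipnormB; exact: sieve_op_close.
Qed.

Variables (N : nat) (w : Om).
Local Notation p := (coord (cls Q phi)).
Local Notation ps := (coord (cls Q phis)).

Lemma dot_span_fun c x : dot c (bvec b x) = span_fun c x.
Proof. by rewrite dotE; apply: eq_bigr => j _; rewrite mxE. Qed.

Lemma dot_scaled_sum (u v : 'cV[R]_k) (A : nat -> 'M[R]_k) :
  dot u ((N%:R^-1 *: \sum_(t < N) A t) *m v) = N%:R^-1 * \sum_(t < N) dot u (A t *m v).
Proof.
rewrite -scalemxAl -[dot _ _]/(dot_ip R k _ _) ipZr mulmx_suml ip_sumr.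
by [].
Qed.

Lemma dot_outer (u v x y : 'cV[R]_k) : dot u (x *m y^T *m v) = dot u x * dot v y.
Proof.
rewrite -mulmxA; have -> : y^T *m v = (dot v y)%:M by rewrite [LHS]mx11_scalar dotC.
by rewrite mul_mx_scalar -[dot u (_ *: _)]/(dot_ip R k _ _) ipZr mulrC.
Qed.

Lemma dot_Ghat (u v : 'cV[R]_k) : dot u (orthonormalized P X b (Ghat X b N w) *m v) =
  N%:R^-1 * \sum_(t < N) span_fun (W *m u) (X t w) * span_fun (W *m v) (X t w).
Proof.
have [h1 h2 h3] := mxinvsqrtP.
rewrite /orthonormalized -!mulmxA dot_trmx h1 (dot_scaled_sum _ _ (fun t => Gterm X b t w)); congr (_ * _).
by apply: eq_bigr => t _; rewrite dot_outer !dot_span_fun.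
Qed.

Lemma dot_Mhat (u v : 'cV[R]_k) : dot u (orthonormalized P X b (Mhat X m b N w) *m v) =
  N%:R^-1 * \sum_(t < N) span_fun (W *m u) (X t w) * m (X t w, X t.+1 w) *
    span_fun (W *m v) (X t.+1 w).
Proof.
have [h1 h2 h3] := mxinvsqrtP.
rewrite /orthonormalized -!mulmxA dot_trmx h1 (dot_scaled_sum _ _ (fun t => Mterm X m b t w)); congr (_ * _).
apply: eq_bigr => t _; rewrite -scalemxAl -[dot _ _]/(dot_ip R k _ _) ipZr /= dot_outer.
by rewrite !dot_span_fun mulrA [_ * span_fun _ (X t w)]mulrC.
Qed.

End sieve.

(** * Asymptotic linearity *)

Section small_o.
Variable R : realType.

Lemma cvge0_near_le (f : nat -> \bar R) : (forall n, (0 <= f n)%E) ->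
  f @ \oo --> 0%E <-> forall e : R, 0 < e -> \forall n \near \oo, (f n <= e%:E)%E.
Proof.
move=> f0; split=> [/fine_cvgP[ffin fc] e e0|h].
  move: fc => /cvgr0_norm_lt /(_ e e0) fe; near=> n.
  have fn : f n \is a fin_num by near: n.
  rewrite -(fineK fn) lee_fin; apply: le_trans (ler_norm _) (ltW _).
  by near: n.
apply/fine_cvgP; split.
  apply: filterS (h 1 ltr01) => n hn.
  by rewrite ge0_fin_numE //; apply: le_lt_trans hn (ltry _).
apply/cvgrPdist_le => e e0; apply: filterS (h e e0) => n hn; rewrite /= sub0r normrN.
have fn : f n \is a fin_num by rewrite ge0_fin_numE //; apply: le_lt_trans hn (ltry _).
by rewrite ger0_norm ?fine_ge0 // -lee_fin fineK.
Unshelve. all: by end_near. Qed.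

Lemma sqrt_scaled_near_le (a : nat -> R) : (forall n, 0 <= a n) ->
  (fun n => (Num.sqrt n%:R)%:E * (a n)%:E)%E @ \oo --> 0%E ->
  forall e, 0 < e -> \forall n \near \oo, Num.sqrt n%:R * a n <= e.
Proof.
move=> a0 h e e0.
have /cvge0_near_le h' : forall n : nat, (0 <= (Num.sqrt n%:R)%:E * (a n)%:E)%E.
  by move=> n; rewrite -EFinM lee_fin mulr_ge0.
by move/h': h => /(_ e e0); apply: filterS => n; rewrite -EFinM lee_fin.
Qed.

(** The exponent [-1/4] is such that a product of two errors of this rate cancels the normalisation
    [sqrt n]. *)
Lemma rate_sqr (n : nat) : (0 < n)%N ->
  Num.sqrt n%:R * (n%:R `^ (- 4^-1) * n%:R `^ (- 4^-1)) = 1 :> R.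
Proof.
move=> n0; have nR : 0 < n%:R :> R by rewrite ltr0n.
have nz (b : bool) : b ==> (n%:R != 0 :> R) by rewrite gt_eqF // implybT.
rewrite -powRD // -[Num.sqrt _](powR12_sqrt (ltW nR)) -powRD //.
by rewrite (_ : 2^-1 + (- 4^-1 - 4^-1) = 0) ?powRr0 //; lra.
Qed.

Lemma rate_bounds (n : nat) : (0 < n)%N ->
  [/\ 0 < n%:R `^ (- 4^-1) :> R, n%:R `^ (- 4^-1) <= 1 :> R &
      (Num.sqrt n%:R)^-1 <= n%:R `^ (- 4^-1) :> R].
Proof.
move=> n0; have nR : 0 < n%:R :> R by rewrite ltr0n.
have n1 : 1 <= n%:R :> R by rewrite ler1n.
have p := powR_gt0 (- 4^-1) nR.
have le1 : n%:R `^ (- 4^-1) <= 1 :> R.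
  by rewrite powRN invf_le1 ?powR_gt0 // -[X in X <= _](powRr0 n%:R) ler_powR // invr_ge0.
split => //; have := rate_sqr n0; set y := _ `^ _ in p le1 * => h.
have s0 : 0 < Num.sqrt n%:R :> R by rewrite sqrtr_gt0.
rewrite -(ler_pM2l s0) mulfV ?gt_eqF // -{1}h; apply: ler_wpM2l; first exact: ltW.
by rewrite -[leRHS]mulr1 ler_wpM2l // ltW.
Qed.

End small_o.

Section estimator.
Context {dO : measure_display} {Om : measurableType dO}.
Context {d : measure_display} {T : measurableType d} {R : realType}.
Variables (P : probability Om R) (X : nat -> {mfun Om >-> T}).
Variables (Q : probability T R) (P1 : R.-pker T ~> T) (m : T * T -> R).
Hypothesis hX : stationary_ergodic_markov P X Q P1.
Hypotheses (m_meas : measurable_fun setT m) (m_pos : forall z, 0 < m z).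
Variables (rho : R) (phi phis : T -> R).
Hypothesis A1 : principal_eigenpair Q P1 m rho phi phis.
Hypothesis phi_phis : inner Q phi phis = 1.
Let mb : Mbounded Q P1 m := pe_bounded A1.
Let dm : dominated_by m 1 m := dominated_self m_meas m_pos.
Let Lphi : L2 Q phi := pe_phi_L2 A1.
Let Lphis : L2 Q phis := pe_phis_L2 A1.
Let rho0 : 0 < rho := pe_rho A1.
Local Notation H := (L2class Q).
Local Notation ip := (L2ip Q).
Local Notation n := (ipnorm (L2ip Q)).
Local Notation hnu := (pair_law_Q2 hX).
Local Notation hsnd := (Q2_snd hX).
Local Notation M := (transition_class hnu hsnd m_meas m_pos A1).
Local Notation phiH := (cls Q phi).
Local Notation phisH := (cls Q phis).

Definition sieve_op_err (k : nat) (b : 'I_k -> T -> R) : \bar R :=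
  opnorm Q (fun psi => sieve_proj Q b (Mop P1 m psi) \- Mop P1 m psi)%R.

(** A deterministic statement, valid at every [w] where the matrix errors are small. [f1] and [f2]
    are functions in the sieve space representing the projections of [phi] and [phis], and the
    bilinear forms of the matrices become sums along the path. *)
Theorem rhohat_expansion :
  (forall e : R, 0 < e -> exists k (f : 'I_k -> H), (forall j, n (f j) <= 1) /\
    forall u, n (M u - \sum_j ip (M u) (f j) *: f j) <= e * n u) ->
  exists t0 C : R, [/\ 0 < t0, 0 <= C &
  forall k (b : 'I_k -> T -> R) (a1 a2 : R), (forall j, L2 Q (b j)) -> lin_indep Q b ->
    (sieve_op_err b <= t0%:E)%E ->
    (L2norm Q (sieve_proj Q b phi \- phi)%R = a1%:E)%E -> a1 <= t0 ->
    (L2norm Q (sieve_proj Q b phis \- phis)%R = a2%:E)%E ->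
  exists f1 f2 : T -> R, [/\ L2 Q f1, L2 Q f2, n (cls Q f1 - phiH) = a1, n (cls Q f2 - phisH) = a2 &
  forall N w delta, Gerr P X b N w + Merr P X m b N w <= delta -> delta <= t0 ->
    `|rhohat X m b N w - rho -
      (N%:R^-1 * \sum_(t < N) f2 (X t w) * m (X t w, X t.+1 w) * f1 (X t.+1 w) -
       rho * (N%:R^-1 * \sum_(t < N) f2 (X t w) * f1 (X t w)))|
    <= C * ((delta + a1) * (delta + a2))]].
Proof.
move=> finite_rank.
have [a [kap [K [[kap0 kap_rho] K0 h1 h2 h3]]]] := adapted_norm_exists phi_phis finite_rank.
have [t0 [C [t00 C0 hC]]] := galerkin_uniform (@L2ip_def _ _ _ Q) kap0 kap_rho h1 h2 K0
  (transition_class_phi hnu hsnd m_meas m_pos A1)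
  (transition_class_phis hnu hsnd m_meas m_pos A1) (ip_phi_phis A1 phi_phis) h3
  (op_bound_ge0 Q P1 m) (transition_class_bounded hnu hsnd m_meas m_pos A1).
exists t0, C; split => // k b a1 a2 b_L2 b_indep hop ha1 a1t ha2.
set W := mxinvsqrt (Gmx P X b).
set iota := sieve_iota P X Q b.
pose p := sieve_coord ip iota phiH; pose ps := sieve_coord ip iota phisH.
have e1 : n (iota p - phiH) = a1.
  by move: ha1; rewrite (sieve_proj_dist hX b_L2 b_indep Lphi) => -[].
have e2 : n (iota ps - phisH) = a2.
  by move: ha2; rewrite (sieve_proj_dist hX b_L2 b_indep Lphis) => -[].
exists (span_fun b (W *m p)), (span_fun b (W *m ps)); split.
- exact: L2_span_fun.
- exact: L2_span_fun.
- by rewrite cls_span_fun.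
- by rewrite cls_span_fun.
move=> N w delta hd hdt.
have [Wt Wu WW] := mxinvsqrtP hX b_L2 b_indep.
have [r hr hb] := hC k iota _ (orthonormalized P X b (Ghat X b N w))
  (orthonormalized P X b (Mhat X m b N w)) t0
  (sieve_iota_isom hX b_L2 b_indep) (sieve_iota_op hX m_meas m_pos A1 b_L2 b_indep)
  (ltW t00) (lexx t0) (sieve_op_close hX m_meas m_pos A1 b_L2 b_indep hop)
  delta hd hdt a1 a2 (eq_ind_r (fun z => z <= a1) (lexx a1) e1) a1t
  (eq_ind_r (fun z => z <= a2) (lexx a2) e2).
rewrite (rhohatE (largest_gen_eigenvalue_congr Wu hr)).
by move: hb; rewrite (dot_Mhat m hX b_L2 b_indep) (dot_Ghat hX b_L2 b_indep).
Qed.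

(** The summand built on the projections [f1] and [f2], minus [psi_rho]. *)
Definition influence_err (f1 f2 : T -> R) (z : T * T) : R :=
  (f2 z.1 * m z * f1 z.2 - phis z.1 * m z * phi z.2) -
  rho * (f2 z.1 * f1 z.1 - phis z.1 * phi z.1).

Lemma measurable_influence_err f1 f2 : L2 Q f1 -> L2 Q f2 ->
  measurable_fun setT (influence_err f1 f2).
Proof.
move=> L1 L2'.
have m1 f : L2 Q f -> measurable_fun setT (fun z : T * T => f z.1).
  by move=> Lf; apply: measurableT_comp => //; exact: L2_measurable Lf.
have m2 f : L2 Q f -> measurable_fun setT (fun z : T * T => f z.2).
  by move=> Lf; apply: measurableT_comp => //; exact: L2_measurable Lf.
have := m1 _ L1; have := m1 _ L2'; have := m1 _ Lphi; have := m1 _ Lphis.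
have := m2 _ L1; have := m2 _ Lphi => n1 n2 n3 n4 n5 n6.
apply: measurable_funB.
  by apply: measurable_funB; do ! apply: measurable_funM.
by apply: measurable_funM => //; apply: measurable_funB; apply: measurable_funM.
Qed.

Lemma pair_abs_bound h f : L2 Q h -> L2 Q f ->
  (\int[Q2 P X]_z `|h z.1 * m z * f z.2|%:E <=
   (op_bound Q P1 m * n (cls Q h) * n (cls Q f))%:E)%E.
Proof.
move=> Lh Lf; have := integral_pair_abs hnu m_meas m_pos mb dm Lh Lf.
rewrite mul1r -lee_fin /Rintegral fineK //.
by have := integrable_fin_num measurableT (integrable_abse (integrable_pair hnu m_pos mb dm Lh Lf)).
Qed.

Lemma state_abs_bound h f : L2 Q h -> L2 Q f ->
  (\int[Q2 P X]_z `|h z.1 * f z.1|%:E <= (n (cls Q h) * n (cls Q f))%:E)%E.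
Proof.
move=> Lh Lf; have Lh' := L2_normP Lh; have Lf' := L2_normP Lf.
have i := L2_mul_integrable Lh' Lf'.
rewrite (pair_law_fst hnu (f := fun x => `|h x * f x|%:E)) //; last first.
  have /integrableP[/measurable_EFinP mi _] := i.
  apply/measurable_EFinP; apply: (eq_measurable_fun (fun x => `|h x| * `|f x|)) => // x _.
  by rewrite normrM.
have -> : (\int[Q]_x `|h x * f x|%:E = (inner Q (fun x => `|h x|) (fun x => `|f x|))%:E)%E.
  rewrite /inner /Rintegral fineK; last exact: integrable_fin_num.
  by apply: eq_integral => x _; rewrite normrM.
rewrite lee_fin -L2ip_cls // -(nrm_abs Lh) -(nrm_abs Lf).
by apply: le_trans (ler_norm _) _; exact: ip_cauchy_schwarz.
Qed.

Lemma influence_err_bound f1 f2 : L2 Q f1 -> L2 Q f2 -> n (cls Q f1 - phiH) <= 1 ->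
  (\int[Q2 P X]_z `|influence_err f1 f2 z|%:E <=
   ((op_bound Q P1 m + rho) * (n phiH + 1 + n phisH) *
    (n (cls Q f1 - phiH) + n (cls Q f2 - phisH)))%:E)%E.
Proof.
have alg (x y u v : R) : 0 <= u * (x + 1) -> 0 <= v * y ->
    v * (x + 1) + y * u <= (x + 1 + y) * (u + v) by lra.
move=> L1 L2' close1; have B0 := op_bound_ge0 Q P1 m; set B := op_bound Q P1 m in B0 *.
set a1 := n (cls Q f1 - phiH) in close1 *; set a2 := n (cls Q f2 - phisH).
have a10 : 0 <= a1 := ipnorm_ge0 _ _; have a20 : 0 <= a2 := ipnorm_ge0 _ _.
have F0 := ipnorm_ge0 ip phiH; have S0 := ipnorm_ge0 ip phisH.
have Ld1 : L2 Q (f1 \- phi) by exact: L2_subP.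
have Ld2 : L2 Q (f2 \- phis) by exact: L2_subP.
have nf1 : n (cls Q f1) <= n phiH + 1.
  rewrite -(subrK phiH (cls Q f1)) addrC; apply: le_trans (ipnormD _ _ _) _.
  by rewrite lerD2l.
have c1 : cls Q (f1 \- phi) = cls Q f1 - phiH := clsB L1 Lphi.
have c2 : cls Q (f2 \- phis) = cls Q f2 - phisH := clsB L2' Lphis.
have p1 := pair_abs_bound Ld2 L1; have p2 := pair_abs_bound Lphis Ld1.
have q1 := state_abs_bound Ld2 L1; have q2 := state_abs_bound Lphis Ld1.
rewrite c2 -/a2 -/B in p1; rewrite c1 -/a1 -/B in p2.
rewrite c2 -/a2 in q1; rewrite c1 -/a1 in q2.
pose g1 (z : T * T) := `|(f2 \- phis) z.1 * m z * f1 z.2|%:E.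
pose g2 (z : T * T) := `|phis z.1 * m z * (f1 \- phi) z.2|%:E.
pose g3 (z : T * T) := `|(f2 \- phis) z.1 * f1 z.1|%:E.
pose g4 (z : T * T) := `|phis z.1 * (f1 \- phi) z.1|%:E.
have m1 f : L2 Q f -> measurable_fun setT (fun z : T * T => f z.1).
  by move=> Lf; apply: measurableT_comp => //; exact: L2_measurable Lf.
have m2 f : L2 Q f -> measurable_fun setT (fun z : T * T => f z.2).
  by move=> Lf; apply: measurableT_comp => //; exact: L2_measurable Lf.
have mp h f : L2 Q h -> L2 Q f -> measurable_fun setT (fun z : T * T => `|h z.1 * m z * f z.2|%:E).
  move=> Lh Lf; apply/measurable_EFinP; apply: measurableT_comp => //.
  by apply: measurable_funM; [apply: measurable_funM => //; exact: m1|exact: m2].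
have mq h f : L2 Q h -> L2 Q f -> measurable_fun setT (fun z : T * T => `|h z.1 * f z.1|%:E).
  move=> Lh Lf; apply/measurable_EFinP; apply: measurableT_comp => //.
  by apply: measurable_funM; exact: m1.
have mg1 : measurable_fun setT g1 by exact: mp.
have mg2 : measurable_fun setT g2 by exact: mp.
have mg3 : measurable_fun setT g3 by exact: mq.
have mg4 : measurable_fun setT g4 by exact: mq.
have mr : measurable_fun setT (fun z => rho%:E * (g3 z + g4 z))%E.
  by apply: measurable_funeM; exact: emeasurable_funD.
have rE : (0 <= rho%:E)%E by rewrite lee_fin ltW.
have g0 z : [/\ (0 <= g1 z)%E, (0 <= g2 z)%E, (0 <= g3 z)%E & (0 <= g4 z)%E].
  by split; rewrite lee_fin.
apply: (@le_trans _ _ (\int[Q2 P X]_z ((g1 z + g2 z) + rho%:E * (g3 z + g4 z)))%E).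
  apply: ge0_le_integral => //.
  - apply/measurable_EFinP; apply: measurableT_comp => //; exact: measurable_influence_err.
  - by apply: emeasurable_funD => //; exact: emeasurable_funD.
  move=> z _; rewrite /g1 /g2 /g3 /g4 -!EFinD lee_fin /=.
  (* One factor is changed at a time: every product contains a single difference, and the final
     bound is linear in the projection errors. *)
  have -> : influence_err f1 f2 z =
    ((f2 z.1 - phis z.1) * m z * f1 z.2 + phis z.1 * m z * (f1 z.2 - phi z.2)) -
    rho * ((f2 z.1 - phis z.1) * f1 z.1 + phis z.1 * (f1 z.1 - phi z.1)).
    by rewrite /influence_err; ring.
  apply: le_trans (ler_normB _ _) _; apply: lerD; first exact: ler_normD.
  by rewrite normrM (ger0_norm (ltW rho0)) ler_wpM2l ?(ltW rho0) // ler_normD.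
have h0 z : (0 <= g3 z + g4 z)%E by have [? ? ? ?] := g0 z; exact: adde_ge0.
rewrite ge0_integralD //; last 3 first.
- by move=> z _; have [? ? ? ?] := g0 z; exact: adde_ge0.
- exact: emeasurable_funD.
- by move=> z _; exact: mule_ge0.
rewrite ge0_integralZl //; last exact: emeasurable_funD.
rewrite !ge0_integralD //; try by move=> z _; have [] := g0 z.
apply: (@le_trans _ _ ((B * a2 * n (cls Q f1))%:E + (B * n phisH * a1)%:E +
  rho%:E * ((a2 * n (cls Q f1))%:E + (n phisH * a1)%:E))%E).
  by apply: leeD; [apply: leeD|apply: lee_wpmul2l => //; apply: leeD].
rewrite -!EFinD lee_fin.
have -> : B * a2 * n (cls Q f1) + B * n phisH * a1 + rho * (a2 * n (cls Q f1) + n phisH * a1) =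
  (B + rho) * (a2 * n (cls Q f1) + n phisH * a1) by ring.
have Br0 : 0 <= B + rho := addr_ge0 B0 (ltW rho0).
rewrite -[leRHS]mulrA; apply: (ler_wpM2l Br0).
apply: le_trans (_ : a2 * (n phiH + 1) + n phisH * a1 <= _).
  by rewrite lerD2r ler_wpM2l.
exact: alg (mulr_ge0 a10 (addr_ge0 F0 ler01)) (mulr_ge0 a20 S0).
Qed.

(** By stationarity the sum of absolute values has mean [N] times the mean of one step, whatever the
    dependence between steps. A mean of order o(n^-1/2) thus gives a sum of order o_p(n^1/2). *)
Lemma sum_step_markov (D : T * T -> R) (N : nat) (c : R) (v : R) : measurable_fun setT D -> 0 < c ->
  (\int[Q2 P X]_z `|D z|%:E <= v%:E)%E ->
  measurable [set w | c <= \sum_(t < N) `|D (X t w, X t.+1 w)|] /\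
  (P [set w | (c <= \sum_(t < N) `|D (X t w, X t.+1 w)|)%R] <= (N%:R * v / c)%:E)%E.
Proof.
move=> mD c0 hv; pose Y w := \sum_(t < N) `|D (X t w, X t.+1 w)|.
have mt (t : nat) : measurable_fun setT (fun w => `|D (X t w, X t.+1 w)|).
  apply: measurableT_comp => //; exact: (measurableT_comp mD (measurable_step_at X t)).
have mY : measurable_fun setT Y by apply: measurable_sum => t.
have Y0 w : 0 <= Y w by apply: sumr_ge0.
have ms : measurable [set w | c <= Y w].
  rewrite -[X in measurable X]setTI; have := mY measurableT _ (measurable_itv `[c, +oo[).
  by congr (measurable (_ `&` _)); apply/seteqP; split => w /=; rewrite in_itv /= andbT.
split => //.
have := @le_integral_abse _ _ _ P setT measurableT (EFin \o Y) c _ c0.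
move=> /(_ (proj2 (measurable_EFinP _ _) mY)); rewrite setTI.
have -> : [set x | (c%:E <= `|(EFin \o Y) x|)%E] = [set w | c <= Y w].
  by apply/seteqP; split => w /=; rewrite lee_fin ger0_norm.
have -> : (\int[P]_x `|(EFin \o Y) x| = \sum_(t < N) \int[Q2 P X]_z `|D z|%:E)%E.
  transitivity (\sum_(t < N) \int[P]_w `|D (X t w, X t.+1 w)|%:E)%E; last first.
    apply: eq_bigr => t _; rewrite (integral_step hX t (F := fun z => `|D z|%:E)) //.
    by apply/measurable_EFinP; exact: measurableT_comp.
  rewrite -(@ge0_integral_sum _ _ _ P _ measurableT _ (fun (t : 'I_N) w => `|D (X t w, X t.+1 w)|%:E)) //.
  - by apply: eq_integral => w _; rewrite /= ger0_norm // /Y sumEFin.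
  - by move=> t; apply/measurable_EFinP; exact: mt.
move=> h; rewrite -(@lee_pmul2l _ c%:E) ?lte_fin //.
apply: le_trans h _; rewrite -EFinM mulrC divfK ?gt_eqF //.
apply: (@le_trans _ _ (\sum_(t < N) v%:E)%E); first by apply: lee_sum.
by rewrite sumEFin sumr_const card_ord -[_ *+ _]mulr_natl.
Qed.

Section sequence.
Variables (b : forall k : nat, 'I_k -> T -> R) (k : nat -> nat).
Arguments b : clear implicits.
Hypotheses (b_L2 : forall k j, L2 Q (b k j)) (b_indep : forall k, lin_indep Q (b k)).
Arguments b_L2 : clear implicits.
Arguments b_indep : clear implicits.
Hypothesis A2 : (fun n => sieve_op_err (b (k n))) @ \oo --> 0%E.

Lemma sieve_finite_rank_limit : forall e : R, 0 < e -> exists l (f : 'I_l -> H),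
  (forall j, n (f j) <= 1) /\
  forall u, n (M u - \sum_j ip (M u) (f j) *: f j) <= e * n u.
Proof.
move=> e e0.
have /cvge0_near_le h : forall N, (0 <= sieve_op_err (b (k N)))%E.
  by move=> N; exact: opnorm_ge0.
have [N _ /(_ N (leqnn N)) hN] := proj1 h A2 e e0.
have [f hf] := sieve_finite_rank hX m_meas m_pos A1 (b_L2 (k N)) (b_indep (k N)) hN.
by exists (k N), f.
Qed.

Hypothesis A4a_phi : (fun n : nat => (Num.sqrt n%:R)%:E *
  L2norm Q (sieve_proj Q (b (k n)) phi \- phi)%R)%E @ \oo --> 0%E.
Hypothesis A4a_phis : (fun n : nat => (Num.sqrt n%:R)%:E *
  L2norm Q (sieve_proj Q (b (k n)) phis \- phis)%R)%E @ \oo --> 0%E.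
Hypothesis A4b_G : is_op P (fun n => Gerr P X (b (k n)) n) (fun n => n%:R `^ (- 4^-1)).
Hypothesis A4b_M : is_op P (fun n => Merr P X m (b (k n)) n) (fun n => n%:R `^ (- 4^-1)).

Theorem rhohat_asymptotically_linear :
  asymptotically_linear P X (fun n => rhohat X m (b (k n)) n) rho (psi_rho m rho phi phis).
Proof.
have alg1 (N r c x y : R) : N = r * r -> N * (c * (x + y)) = r * (c * (r * x + r * y)).
  by move=> ->; ring.
have alg2 (c z z' : R) : 0 < c -> c * (z / 2 * (z' / 3) / (2 * c) + z / 2 * (z' / 3) / (2 * c)) = z' / 3 * (z / 2).
  by move=> c0; field; rewrite gt_eqF.
have alg3 (x y : R) : 3 * x * (3 * x) * (y * y) = (x * y + x * y + x * y) * (x * y + x * y + x * y).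
  by ring.
have alg4 (r N x y z u q : R) : 0 < r -> N = r * r ->
    r * (x - y) - r^-1 * u = r * (x - y - (N^-1 * z - y * (N^-1 * q))) + r^-1 * (z - y * q - u).
  by move=> r0 ->; field; rewrite gt_eqF.
have alg5 (x : R) : x / 3 + x / 3 + x / 3 = x by field.
have alg6 (x : R) : x = x / 2 + x / 2 by field.
have [t0 [C [t00 C0 hC]]] := rhohat_expansion sieve_finite_rank_limit.
pose a f N := n (sieve_iota P X Q (b (k N)) (sieve_coord ip (sieve_iota P X Q (b (k N))) (cls Q f)) - cls Q f).
have a0 f N : 0 <= a f N by exact: ipnorm_ge0.
have aE f N : L2 Q f -> L2norm Q (sieve_proj Q (b (k N)) f \- f)%R = (a f N)%:E.
  by move=> Lf; rewrite (sieve_proj_dist hX).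
have h1 : (fun N : nat => (Num.sqrt N%:R)%:E * (a phi N)%:E)%E @ \oo --> 0%E.
  by under eq_fun do rewrite -aE //.
have h2 : (fun N : nat => (Num.sqrt N%:R)%:E * (a phis N)%:E)%E @ \oo --> 0%E.
  by under eq_fun do rewrite -aE //.
have {}h1 := sqrt_scaled_near_le (a0 phi) h1.
have {}h2 := sqrt_scaled_near_le (a0 phis) h2.
move=> e e0; have mu0 A : (0 <= mu_ext P A)%E by exact: mu_ext_ge0.
apply/cvge0_near_le => // e' e'0.
(* Once the two matrix errors and the two projection errors are at most [s n^(-1/4)], both factors
   of the remainder are at most [3 s n^(-1/4)]. This [s] keeps them in the range of
   [rhohat_expansion] and makes [C (3 s)^2] at most [e / 2]. *)
pose s := Num.min (t0 / 3) (Num.min 3^-1 (e / (18 * (C + 1)))).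
have C1 : 0 < C + 1 by rewrite ltr_wpDl.
have s0 : 0 < s.
  by rewrite /s !lt_min divr_gt0 // invr_gt0 ltr0n /= divr_gt0 // mulr_gt0.
have st : 3 * s <= t0 by rewrite mulrC -ler_pdivlMr // ge_min lexx.
have s1 : 3 * s <= 1 by rewrite mulrC -ler_pdivlMr // div1r !ge_min lexx !orbT.
have s_t0 : s <= t0 by lra.
have s_1 : s <= 1 by lra.
have ss_t0 : s + s <= t0 by lra.
have se : C * (3 * s * (3 * s)) <= e / 2.
  have h : s * (18 * (C + 1)) <= e by rewrite -ler_pdivlMr ?mulr_gt0 // !ge_min lexx !orbT.
  have h' : C * (3 * s * (3 * s)) <= (C + 1) * (3 * s * (3 * s)).
    by rewrite ler_wpM2r ?lerDl // !mulr_ge0 // ltW.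
  have h'' : (C + 1) * (3 * s * (3 * s)) <= (C + 1) * (3 * s * 1).
    by rewrite ler_wpM2l ?(ltW C1) // ler_wpM2l // mulr_ge0 // ltW.
  have e18 : s * (18 * (C + 1)) = 6 * ((C + 1) * (3 * s * 1)) by ring.
  rewrite e18 in h; move: h h' h''; set x := (C + 1) * (3 * s * 1) => h h' h''.
  rewrite ler_pdivlMr //.
  have x0 : 0 <= x by rewrite /x !mulr_ge0 // ltW.
  lra.
clearbody a s.
have e3 : 0 < e' / 3 by rewrite divr_gt0.
have /cvge0_near_le hG := fun N => mu0 [set w | s * N%:R `^ (- 4^-1) < `|Gerr P X (b (k N)) N w|].
have {}hG := proj1 hG (A4b_G s0) _ e3.
have /cvge0_near_le hM := fun N => mu0 [set w | s * N%:R `^ (- 4^-1) < `|Merr P X m (b (k N)) N w|].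
have {}hM := proj1 hM (A4b_M s0) _ e3.
have /cvge0_near_le hA : forall N, (0 <= sieve_op_err (b (k N)))%E.
  by move=> N; exact: opnorm_ge0.
have {}hA := proj1 hA A2 _ t00.
pose C2 := (op_bound Q P1 m + rho) * (n phiH + 1 + n phisH).
have C20 : 0 <= C2.
  by rewrite /C2 mulr_ge0 // !addr_ge0 ?ipnorm_ge0 ?(ltW rho0) // op_bound_ge0.
(* If [sqrt n] times each projection error is at most [v], Markov's inequality at the level
   [e / 2 * sqrt n] gives a probability of at most [e' / 3]. *)
pose v := e / 2 * (e' / 3) / (2 * (C2 + 1)).
have C21 : 0 < C2 + 1 by rewrite ltr_wpDl.
have v0 : 0 < v by rewrite !(divr_gt0, mulr_gt0).
have pos : \forall N \near \oo, (0 < N)%N by exists 1.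
apply: filterS3 hG hM (filterI hA (filterI pos (filterI (filterI (h1 _ s0) (h2 _ s0))
  (filterI (h1 _ v0) (h2 _ v0))))) => N {}hG {}hM [{}hA [N0 [[b1 b2] [c1 c2]]]].
have [y0 y1 ys] := rate_bounds R N0; have yy := rate_sqr R N0.
set y := N%:R `^ _ in y0 y1 ys yy hG hM.
have r0 : 0 < Num.sqrt N%:R :> R by rewrite sqrtr_gt0 ltr0n.
set rt := Num.sqrt N%:R in r0 ys yy b1 b2 c1 c2 *.
(* The projection errors are brought down to the common scale [s n^(-1/4)] of the matrix errors;
   their sharper rate is kept in [c1] and [c2] for the Markov bound. *)
have small x : rt * x <= s -> x <= s * y.
  move=> h; apply: le_trans (_ : s * rt^-1 <= _); last by rewrite ler_wpM2l // ltW.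
  by rewrite ler_pdivlMr // mulrC.
have {}b1 := small _ b1; have {}b2 := small _ b2.
have sy : s * y <= s by rewrite ler_piMr // ltW.
have sy0 : 0 < s * y by rewrite mulr_gt0.
have b1t : a phi N <= t0 by apply: le_trans b1 (le_trans sy s_t0).
have [f1 [f2 [L1 L2' d1 d2 hw]]] := hC (k N) (b (k N)) (a phi N) (a phis N) (b_L2 (k N))
  (b_indep (k N)) hA (aE _ _ Lphi) b1t (aE _ _ Lphis).
have mD := measurable_influence_err L1 L2'.
have close1 : n (cls Q f1 - phiH) <= 1.
  by rewrite d1; apply: le_trans b1 (le_trans sy s_1).
have hD := influence_err_bound L1 L2' close1; rewrite d1 d2 -/C2 in hD.
have c0 : 0 < e / 2 * rt by rewrite !(divr_gt0, mulr_gt0).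
have [mB PB] := sum_step_markov N mD c0 hD.
set D := influence_err f1 f2 in mB PB.
set B := [set w | _] in mB PB.
have {}PB : (mu_ext P B <= (e' / 3)%:E)%E.
  rewrite measurable_mu_extE //; apply: le_trans PB _; rewrite lee_fin ler_pdivrMr //.
  have NE : N%:R = rt * rt by rewrite -expr2 sqr_sqrtr // ler0n.
  rewrite (alg1 _ _ _ _ _ NE) [e' / 3 * _]mulrA [leRHS]mulrC ler_pM2l //; apply: le_trans (_ : C2 * (v + v) <= _).
    exact: (ler_wpM2l C20 (lerD c1 c2)).
  apply: le_trans (_ : (C2 + 1) * (v + v) <= _).
    by apply: ler_wpM2r; [apply: addr_ge0; exact: ltW|rewrite lerDl ler01].
  by rewrite /v alg2.
clearbody C2 v.
set SG := [set w | _] in hG; set SM := [set w | _] in hM.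
(* Outside three sets, each of outer probability at most [e' / 3], the second order remainder and
   the cost of replacing [f1], [f2] by [phi], [phis] are each at most [e / 2]. The outer measure is
   subadditive, so the measurability of [rhohat] does not come up. *)
have sub : [set w | e * 1 < `|rt * (rhohat X m (b (k N)) N w - rho) -
    rt^-1 * \sum_(t < N) psi_rho m rho phi phis (X t w, X t.+1 w)|] `<=` (SG `|` SM) `|` B.
  move=> w /= hwe; apply: contrapT => nin; move: hwe; apply/negP; rewrite -leNgt mulr1.
  have nG : `|Gerr P X (b (k N)) N w| <= s * y.
    by rewrite leNgt; apply/negP => h; apply: nin; left; left.
  have nM : `|Merr P X m (b (k N)) N w| <= s * y.
    by rewrite leNgt; apply/negP => h; apply: nin; left; right.
  have nB : \sum_(t < N) `|D (X t w, X t.+1 w)| <= e / 2 * rt.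
    by rewrite leNgt; apply/negP => h; apply: nin; right; exact: ltW.
  have := hw N w (s * y + s * y) (lerD (le_trans (ler_norm _) nG) (le_trans (ler_norm _) nM)).
  set Z := _ - (_ - _); move=> hZ.
  have {}hZ : `|Z| <= C * (3 * s * (3 * s)) * (y * y).
    apply: le_trans (hZ (le_trans (lerD sy sy) ss_t0)) _.
    rewrite -mulrA; apply: ler_wpM2l => //.
    rewrite alg3; by apply: ler_pM; rewrite ?addr_ge0 ?(ltW sy0) // lerD2l.
  have -> : rt * (rhohat X m (b (k N)) N w - rho) -
      rt^-1 * \sum_(t < N) psi_rho m rho phi phis (X t w, X t.+1 w) =
      rt * Z + rt^-1 * \sum_(t < N) D (X t w, X t.+1 w).
    have DE : \sum_(t < N) D (X t w, X t.+1 w) =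
        (\sum_(t < N) f2 (X t w) * m (X t w, X t.+1 w) * f1 (X t.+1 w) -
          rho * \sum_(t < N) f2 (X t w) * f1 (X t w)) -
        \sum_(t < N) psi_rho m rho phi phis (X t w, X t.+1 w).
      rewrite mulr_sumr -!sumrB; apply: eq_bigr => t _.
      by rewrite /D /influence_err /psi_rho /=; ring.
    have NE : N%:R = rt * rt by rewrite -expr2 sqr_sqrtr // ler0n.
    rewrite DE /Z; exact: alg4.
  apply: le_trans (ler_normD _ _) _; rewrite [leRHS]alg6.
  apply: lerD.
    rewrite normrM (ger0_norm (ltW r0)); apply: le_trans (ler_wpM2l (ltW r0) hZ) _.
    by rewrite mulrCA yy mulr1.
  rewrite normrM ger0_norm ?invr_ge0 ?(ltW r0) // ler_pdivrMl // mulrC.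
  by apply: le_trans (ler_norm_sum _ _ _) nB.
apply: le_trans (le_mu_ext P sub) _.
apply: le_trans (outer_measureU2 (mu_ext P) _ _) _.
apply: le_trans (leeD (outer_measureU2 (mu_ext P) _ _) (lexx _)) _.
apply: le_trans (leeD (leeD hG hM) PB) _.
by rewrite -!EFinD alg5.
Qed.

End sequence.

End estimator.

Theorem theorem3p3 (R : realType) (d : nat) (XX : set (d.-tuple R)) (x0 : XX)
  (dO : measure_display) (Om : measurableType dO) (P : probability Om R)
  (X : nat -> {mfun Om >-> state x0})
  (Q : probability (state x0) R) (P1 : R.-pker state x0 ~> state x0)
  (m : state x0 * state x0 -> R)
  (b : forall k : nat, 'I_k -> state x0 -> R) (k : nat -> nat)
  (rho : R) (phi phis : state x0 -> R)
  (hX : stationary_ergodic_markov P X Q P1)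
  (m_meas : measurable_fun setT m)
  (m_pos : forall z, 0 < m z)
  (b_L2 : forall k j, L2 Q (b k j))
  (b_indep : forall k, lin_indep Q (b k))
  (k_infty : k @ \oo --> \oo)
  (A1 : principal_eigenpair Q P1 m rho phi phis)
  (A2 : (fun n => opnorm Q
           (fun psi => sieve_proj Q (b (k n)) (Mop P1 m psi) \- Mop P1 m psi))
        @ \oo --> 0%E)
  (A3_G : is_op P (fun n => Gerr P X (b (k n)) n) (fun=> 1))
  (A3_M : is_op P (fun n => Merr P X m (b (k n)) n) (fun=> 1))
  (A4a_phi : (fun n : nat => (Num.sqrt n%:R)%:E *
                L2norm Q (sieve_proj Q (b (k n)) phi \- phi)%R)%E @ \oo --> 0%E)
  (A4a_phis : (fun n : nat => (Num.sqrt n%:R)%:E *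
                L2norm Q (sieve_proj Q (b (k n)) phis \- phis)%R)%E @ \oo --> 0%E)
  (A4b_G : is_op P (fun n => Gerr P X (b (k n)) n) (fun n => n%:R `^ (- 4^-1)))
  (A4b_M : is_op P (fun n => Merr P X m (b (k n)) n) (fun n => n%:R `^ (- 4^-1)))
  (A4c : (\int[P]_w ((phis (X 0%N w) * m (X 0%N w, X 1%N w) * phi (X 1%N w))
            ^+ 2)%:E < +oo)%E)
  (A5 : uniformly_ergodic Q P1)
  (phi_norm : L2norm Q phi = 1%E)
  (phi_phis : inner Q phi phis = 1) :
  efficiency_bound P X Q P1 m (V_rho P X m rho phi phis) /\
  semiparametrically_efficient P X Q P1 m
    (fun n => rhohat X m (b (k n)) n) rho.
Proof.
have A2' : (fun n => sieve_op_err Q P1 m (b (k n))) @ \oo --> 0%E by [].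
have eff : efficient_influence P X Q P1 m (psi_rho m rho phi phis).
  apply: (psi_rho_efficient_influence (hX := hX) (m_meas := m_meas) (m_pos := m_pos)
    (A1 := A1) phi_phis A4c).
  exact: (sieve_finite_rank_limit hX m_meas m_pos A1 b_L2 b_indep A2').
split; exists (psi_rho m rho phi phis) => //; first exact: (V_rhoE hX m_meas A1).
exact: (rhohat_asymptotically_linear hX m_meas m_pos A1 phi_phis b_L2 b_indep A2'
  A4a_phi A4a_phis A4b_G A4b_M).
Qed.
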